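(* Let $0<\alpha<1$. Then $$ \sqrt3\,\alpha< \frac{\alpha+(1+\alpha)\sin(\pi\alpha/2)}{\sqrt{1+2\sin(\pi\alpha/2)}} <\gamma(\mathcal{S}^*_{\alpha})<\frac{\sqrt3\,\pi\alpha}{\sqrt{3+\alpha}}. $$
   Context: $\mathbb{D}=\{z\in\mathbb{C}:|z|<1\}$. $\mathcal{A}_1$ is the class of holomorphic functions $f$ on $\mathbb{D}$ with $f(0)=f'(0)-1=0$. For $\alpha>0$, a function $f\in\mathcal{A}_1$ is called strongly starlike of order $\alpha$ if $|\arg[zf'(z)/f(z)]|<\pi\alpha/2$ for all $z\in\mathbb{D}$ (where $zf'(z)/f(z)$ takes the value $1$ at $z=0$); $\mathcal{S}^*_\alpha$ denotes the class of such functions. For $f\in\mathcal{A}_1$ put $\varphi_f(z)=1+zf''(z)/f'(z)$, and for $\gamma\ge 0$ let $W_\gamma=\{w\in\mathbb{C}:|\operatorname{Im} w|<\gamma\}$. For a subset $\mathcal{F}$ of $\mathcal{A}_1$ define $$\gamma(\mathcal{F})=\sup\{\gamma\ge0:\ \text{for every } f\in\mathcal{A}_1,\ \varphi_f(\mathbb{D})\subset W_\gamma \text{ implies } f\in\mathcal{F}\}.$$ (The condition $\varphi_f(\mathbb{D})\subset W_\gamma$ includes that $f'$ has no zeros in $\mathbb{D}$, since $\varphi_f$ has a pole at any zero of $f'$ in $\mathbb{D}$.) *)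

(* Defs.v *)
From Stdlib Require Import Reals.
From Coquelicot Require Import Coquelicot.

Open Scope R_scope.

Definition unit_disk (z : C) : Prop := Cmod z < 1.

(* A function on the disk is represented by a total function [C -> C]; nothing
   below depends on its values off the (open) disk. *)
Definition holomorphic_on_disk (f : C -> C) : Prop :=
  forall z : C, unit_disk z -> @ex_derive C_AbsRing C_NormedModule f z.

Definition classA1 (f : C -> C) : Prop :=
  holomorphic_on_disk f /\ f (RtoC 0) = RtoC 0 /\
  C_derive f (RtoC 0) = RtoC 1.

(* Principal argument, with values in (-PI, PI]; meaningful only for w <> 0. *)
Definition Carg (w : C) : R :=
  if Rle_dec 0 (Im w) then acos (Re w / Cmod w) else - acos (Re w / Cmod w).

(* z f'(z) / f(z), extended by its limit 1 at the origin. *)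
Definition starlike_quotient (f : C -> C) (z : C) : C :=
  if Ceq_dec z (RtoC 0) then RtoC 1 else (z * C_derive f z / f z)%C.

(* Division by zero is total here, so the requirements that the quotient has no
   pole (f has no zero other than the origin) and no zero (where it would have
   no argument) are explicit.  The principal argument is the continuous branch
   vanishing at z = 0 as long as alpha <= 2. *)
Definition strongly_starlike (alpha : R) (f : C -> C) : Prop :=
  classA1 f /\
  forall z : C, unit_disk z ->
    (z <> RtoC 0 -> f z <> RtoC 0) /\
    starlike_quotient f z <> RtoC 0 /\
    Rabs (Carg (starlike_quotient f z)) < PI * alpha / 2.

Definition phi (f : C -> C) (z : C) : C :=
  (RtoC 1 + z * C_derive (C_derive f) z / C_derive f z)%C.

Definition strip (g : R) (w : C) : Prop := Rabs (Im w) < g.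

(* The condition C_derive f z <> 0 says that phi f has no pole at z. *)
Definition phi_maps_into (f : C -> C) (W : C -> Prop) : Prop :=
  forall z : C, unit_disk z -> C_derive f z <> RtoC 0 /\ W (phi f z).

(* The supremum is taken in the extended reals. *)
Definition gamma (F : (C -> C) -> Prop) : Rbar :=
  Lub_Rbar (fun g : R =>
    0 <= g /\
    forall f : C -> C, classA1 f -> phi_maps_into f (strip g) -> F f).

(* Main.v *)
Require Import Defs.
From Stdlib Require Import Reals Lra Psatz Classical ClassicalEpsilon.
From Coquelicot Require Import Coquelicot.

(** For f in the class put q = f / (z f'), so that z q' + q phi_f = 1 and q(0) = 1;
f is strongly starlike of order a exactly when q stays in the sector
|arg w| < pi a / 2.

Lower bound.  At a point z0 of smallest modulus where q leaves the sector,
P = q^(-1/a) is purely imaginary while Re P > 0 for |z| < |z0|.  The boundary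
Schwarz lemma applied to (P - 1) / (P + 1) then gives
|Im phi_f(z0)| >= x^a sin(pi a / 2) + a (x + 1/x) / 2 with x = |P(z0)|, and the
minimum of this function of x exceeds the stated bound.

Upper bound.  Let phi_f = 1 + 2 a b Log((1+z)/(1-z)), whose image has height
g = pi a b.  If f were strongly starlike, (P - 1) / (P + 1) would be bounded by 1;
its first four Taylor coefficients are explicit, and two steps of the Schur
algorithm give a function a0 + a1 z + a2 z^2 + ... bounded by 1, whence
|a2| <= 1 - a0^2.  At b^2 = 3 / (3 + a) one has a0 = -1 and a2 > 0, so the
inequality fails for some slightly smaller b. *)

Open Scope R_scope.


(** Passing to q instead of z f' / f makes the equation linear, and q is holomorphic as soon as f'
    has no zeros, whatever the zeros of f. In terms of P the equation reads phi_f = P^a + a z P' /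
    P. At the exit point the imaginary parts of the two summands have the same sign, so their lower
    bounds add up.

    With s = sin(pi a / 2), the height is minimal where 2 s x^(1+a) = 1 - x^2, and its minimum is
    ((1+a)/x - (1-a) x) / 2 at that x. This expression decreases in x and equals the stated bound at
    x = 1/sqrt(1 + 2 s); since x^a > x on (0, 1), the root lies strictly below that point, which
    makes the inequality strict.

    The value b^2 = 3 / (3 + a) is the solution of a0 = -1, that is of a b^2 / 3 = 1 - b^2; there pi
    a b is the stated upper bound.

    The function theory is built up from Goursat's lemma on rectangles. Power series never occur:
    Taylor coefficients come from repeated division by z. *)

(** * Complex differentiability in epsilon-delta form *)

(** The little-o form with [<=] makes no exception for w = z and involves no quotient, so remainders
    can be added and composed directly. *)
Definition cder (f : C -> C) (z l : C) : Prop :=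
  forall eps, 0 < eps -> exists delta, 0 < delta /\
    forall w, Cmod (w - z) < delta ->
      Cmod (f w - f z - l * (w - z)) <= eps * Cmod (w - z).

Lemma cder_is_derive (f : C -> C) (z l : C) :
  cder f z l -> @is_derive C_AbsRing C_NormedModule f z l.
Proof.
  intros H. split. { apply is_linear_scal_l. }
  intros x Hx.
  (* [is_derive] speaks about every limit point of the neighbourhood filter of z; by separation z is
     the only one. *)
  replace x with z by (apply (is_filter_lim_locally_unique (V := AbsRing_NormedModule C_AbsRing) z x); exact Hx).
  intros eps. destruct (H eps (cond_pos eps)) as [d [Hd Hw]].
  exists (mkposreal d Hd). intros w Bw.
  change (Cmod (w - z) < d) in Bw. specialize (Hw w Bw).
  change (Cmod (f w - f z - (w - z) * l) <= eps * Cmod (w - z)).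
  rewrite (Cmult_comm (w - z) l). exact Hw.
Qed.

Lemma is_derive_cder (f : C -> C) (z l : C) :
  @is_derive C_AbsRing C_NormedModule f z l -> cder f z l.
Proof.
  intros [_ H] eps Heps.
  destruct (H z (fun P HP => HP) (mkposreal eps Heps)) as [[d Hd] Hw].
  exists d. split; [exact Hd|]. intros w Bw. specialize (Hw w Bw).
  change (Cmod (f w - f z - (w - z) * l) <= eps * Cmod (w - z)) in Hw.
  rewrite (Cmult_comm l). exact Hw.
Qed.

Lemma cder_C_derive (f : C -> C) (z l : C) : cder f z l -> C_derive f z = l.
Proof. intros H. apply is_C_derive_unique, cder_is_derive, H. Qed.

Definition ccont (f : C -> C) (z : C) : Prop :=
  forall eps, 0 < eps -> exists delta, 0 < delta /\
    forall w, Cmod (w - z) < delta -> Cmod (f w - f z) < eps.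

Lemma Cmod_minus_sym (a b : C) : Cmod (a - b) = Cmod (b - a).
Proof. rewrite <- Cmod_opp. f_equal. ring. Qed.

Lemma Cmod_triangle_inv (a b : C) : Cmod a - Cmod b <= Cmod (a - b).
Proof.
  generalize (Cmod_triangle (a - b) b).
  replace (a - b + b)%C with a by ring. lra.
Qed.

Lemma Cmod_minus_le (a b : C) : Cmod (a - b) <= Cmod a + Cmod b.
Proof. unfold Cminus. rewrite <- (Cmod_opp b). apply Cmod_triangle. Qed.

Lemma cder_ext_loc (f g : C -> C) (z l : C) d : 0 < d ->
  (forall w, Cmod (w - z) < d -> f w = g w) -> cder f z l -> cder g z l.
Proof.
  intros Hd E H eps Heps. destruct (H eps Heps) as [d' [Hd' Hw]].
  exists (Rmin d d'). split; [now apply Rmin_pos|].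
  intros w Bw. rewrite <- !E.
  - apply Hw. apply Rlt_le_trans with (1 := Bw), Rmin_r.
  - replace (z - z)%C with (RtoC 0) by ring. rewrite Cmod_0. exact Hd.
  - apply Rlt_le_trans with (1 := Bw), Rmin_l.
Qed.

Lemma cder_ext (f g : C -> C) (z l : C) :
  (forall w, f w = g w) -> cder f z l -> cder g z l.
Proof. intros E. apply cder_ext_loc with 1; [lra|auto]. Qed.

Lemma cder_lip (f : C -> C) (z l : C) : cder f z l ->
  exists d, 0 < d /\ forall w, Cmod (w - z) < d ->
    Cmod (f w - f z) <= (Cmod l + 1) * Cmod (w - z).
Proof.
  intros H. destruct (H 1 Rlt_0_1) as [d [Hd Hw]]. exists d. split; [exact Hd|].
  intros w Bw. specialize (Hw w Bw).
  replace (f w - f z)%C with ((f w - f z - l * (w - z)) + l * (w - z))%C by ring.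
  eapply Rle_trans; [apply Cmod_triangle|]. rewrite Cmod_mult. lra.
Qed.

Lemma cder_cont (f : C -> C) (z l : C) : cder f z l -> ccont f z.
Proof.
  intros H eps Heps. destruct (cder_lip f z l H) as [d [Hd Hw]].
  assert (K := Cmod_ge_0 l).
  exists (Rmin d (eps / (Cmod l + 1))). split.
  { apply Rmin_pos; [exact Hd|]. apply Rdiv_lt_0_compat; lra. }
  intros w Bw.
  eapply Rle_lt_trans; [apply Hw; apply Rlt_le_trans with (1 := Bw), Rmin_l|].
  assert (B2 : Cmod (w - z) < eps / (Cmod l + 1))
    by (apply Rlt_le_trans with (1 := Bw), Rmin_r).
  apply Rmult_lt_compat_l with (r := Cmod l + 1) in B2; [|lra].
  replace ((Cmod l + 1) * (eps / (Cmod l + 1))) with eps in B2 by (field; lra).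
  exact B2.
Qed.

Lemma cder_const (c z : C) : cder (fun _ => c) z 0.
Proof.
  intros eps Heps. exists 1. split; [lra|]. intros w _.
  replace (c - c - 0 * (w - z))%C with (RtoC 0) by ring. rewrite Cmod_0.
  apply Rmult_le_pos; [lra|apply Cmod_ge_0].
Qed.

Lemma cder_id (z : C) : cder (fun w => w) z 1.
Proof.
  intros eps Heps. exists 1. split; [lra|]. intros w _.
  replace (w - z - 1 * (w - z))%C with (RtoC 0) by ring. rewrite Cmod_0.
  apply Rmult_le_pos; [lra|apply Cmod_ge_0].
Qed.

Lemma cder_plus (f g : C -> C) (z a b : C) :
  cder f z a -> cder g z b -> cder (fun w => f w + g w)%C z (a + b).
Proof.
  intros Hf Hg. apply is_derive_cder.
  apply (is_derive_plus (K := C_AbsRing) (V := C_NormedModule) f g);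
    now apply cder_is_derive.
Qed.

Lemma cder_opp (f : C -> C) (z a : C) :
  cder f z a -> cder (fun w => - f w)%C z (- a).
Proof.
  intros Hf. apply is_derive_cder.
  apply (is_derive_opp (K := C_AbsRing) (V := C_NormedModule) f);
    now apply cder_is_derive.
Qed.

Lemma cder_minus (f g : C -> C) (z a b : C) :
  cder f z a -> cder g z b -> cder (fun w => f w - g w)%C z (a - b).
Proof. intros Hf Hg. apply cder_plus; [exact Hf|now apply cder_opp]. Qed.

Lemma cder_comp (f g : C -> C) (z a b : C) :
  cder f (g z) a -> cder g z b -> cder (fun w => f (g w)) z (a * b).
Proof.
  intros Hf Hg eps Heps.
  assert (Ka := Cmod_ge_0 a). assert (Kb := Cmod_ge_0 b).
  destruct (Hf (eps / (2 * (Cmod b + 1)))) as [d1 [Hd1 H1]].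
  { apply Rdiv_lt_0_compat; lra. }
  destruct (Hg (eps / (2 * (Cmod a + 1)))) as [d2 [Hd2 H2]].
  { apply Rdiv_lt_0_compat; lra. }
  destruct (cder_lip g z b Hg) as [d3 [Hd3 H3]].
  destruct (cder_cont g z b Hg d1 Hd1) as [d4 [Hd4 H4]].
  exists (Rmin d2 (Rmin d3 d4)). split; [repeat apply Rmin_pos; assumption|].
  intros w Bw.
  assert (B2 : Cmod (w - z) < d2) by (apply Rlt_le_trans with (1 := Bw), Rmin_l).
  assert (B3 : Cmod (w - z) < d3).
  { eapply Rlt_le_trans; [exact Bw|]. eapply Rle_trans; [apply Rmin_r|apply Rmin_l]. }
  assert (B4 : Cmod (w - z) < d4).
  { eapply Rlt_le_trans; [exact Bw|]. eapply Rle_trans; [apply Rmin_r|apply Rmin_r]. }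
  specialize (H1 (g w) (H4 w B4)). specialize (H2 w B2). specialize (H3 w B3).
  replace (f (g w) - f (g z) - a * b * (w - z))%C with
    ((f (g w) - f (g z) - a * (g w - g z)) + a * (g w - g z - b * (w - z)))%C by ring.
  eapply Rle_trans; [apply Cmod_triangle|]. rewrite Cmod_mult.
  assert (Kw := Cmod_ge_0 (w - z)).
  assert (E1 : eps / (2 * (Cmod b + 1)) * Cmod (g w - g z) <= eps / 2 * Cmod (w - z)).
  { replace (eps / 2 * Cmod (w - z)) with
      (eps / (2 * (Cmod b + 1)) * ((Cmod b + 1) * Cmod (w - z))) by (field; lra).
    apply Rmult_le_compat_l; [|exact H3]. apply Rlt_le, Rdiv_lt_0_compat; lra. }
  assert (E2 : Cmod a * Cmod (g w - g z - b * (w - z)) <= eps / 2 * Cmod (w - z)).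
  { apply Rle_trans with
      ((Cmod a + 1) * (eps / (2 * (Cmod a + 1)) * Cmod (w - z))).
    - apply Rmult_le_compat; [lra|apply Cmod_ge_0|lra|exact H2].
    - apply Req_le. field. lra. }
  lra.
Qed.

Lemma cder_mult (f g : C -> C) (z a b : C) :
  cder f z a -> cder g z b ->
  cder (fun w => f w * g w)%C z (a * g z + f z * b).
Proof.
  intros Hf Hg eps Heps.
  set (M := Cmod (f z) + Cmod (g z) + Cmod a + 1).
  assert (Kf := Cmod_ge_0 (f z)). assert (Kg := Cmod_ge_0 (g z)).
  assert (Ka := Cmod_ge_0 a).
  assert (HM : 0 < M) by (unfold M; lra).
  set (e := eps / M).
  assert (He : 0 < e) by (apply Rdiv_lt_0_compat; lra).
  assert (EM : e * M = eps) by (unfold e; field; lra).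
  destruct (Hf e He) as [d1 [Hd1 H1]].
  destruct (Hg e He) as [d2 [Hd2 H2]].
  destruct (cder_lip f z a Hf) as [d3 [Hd3 H3]].
  destruct (cder_cont g z b Hg e He) as [d4 [Hd4 H4]].
  exists (Rmin d1 (Rmin d2 (Rmin d3 d4))). split; [repeat apply Rmin_pos; assumption|].
  intros w Bw.
  apply Rmin_Rgt_l in Bw. destruct Bw as [B1 Bw].
  apply Rmin_Rgt_l in Bw. destruct Bw as [B2 Bw].
  apply Rmin_Rgt_l in Bw. destruct Bw as [B3 B4].
  specialize (H1 w B1). specialize (H2 w B2). specialize (H3 w B3). specialize (H4 w B4).
  replace (f w * g w - f z * g z - (a * g z + f z * b) * (w - z))%C with
    ((f w - f z - a * (w - z)) * g z +
     (f z * (g w - g z - b * (w - z)) + (f w - f z) * (g w - g z)))%C by ring.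
  eapply Rle_trans; [apply Cmod_triangle|].
  eapply Rle_trans; [apply Rplus_le_compat_l, Cmod_triangle|].
  rewrite !Cmod_mult.
  assert (Kw := Cmod_ge_0 (w - z)).
  assert (T1 := Rmult_le_compat_r _ _ _ Kg H1).
  assert (T2 := Rmult_le_compat_l _ _ _ Kf H2).
  assert (T3 : Cmod (f w - f z) * Cmod (g w - g z) <= (Cmod a + 1) * Cmod (w - z) * e).
  { apply Rmult_le_compat; try apply Cmod_ge_0; lra. }
  rewrite <- EM. unfold M.
  replace (e * (Cmod (f z) + Cmod (g z) + Cmod a + 1) * Cmod (w - z)) with
    (e * Cmod (w - z) * Cmod (g z) + (Cmod (f z) * (e * Cmod (w - z)) +
     (Cmod a + 1) * Cmod (w - z) * e)) by ring.
  lra.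
Qed.

Lemma cder_inv (z : C) : z <> 0 -> cder (fun w => / w)%C z (- / (z * z)).
Proof.
  intros Hz eps Heps. assert (K := proj1 (Cmod_gt_0 z) Hz).
  set (m := Cmod z) in *.
  (* The remainder of 1/w is (w - z)^2 / (w z^2). The first bound keeps |w| > m/2, the second makes
     |w - z| absorb the denominator. *)
  exists (Rmin (m / 2) (eps * (m * m * m) / 2)). split.
  { apply Rmin_pos; [lra|]. apply Rdiv_lt_0_compat; [|lra].
    repeat apply Rmult_lt_0_compat; lra. }
  intros w Bw.
  assert (B1 : Cmod (w - z) < m / 2) by (apply Rlt_le_trans with (1 := Bw), Rmin_l).
  assert (B2 : Cmod (w - z) < eps * (m * m * m) / 2)
    by (apply Rlt_le_trans with (1 := Bw), Rmin_r).
  assert (Kw : m / 2 < Cmod w).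
  { generalize (Cmod_triangle_inv z w). rewrite Cmod_minus_sym. fold m. lra. }
  assert (Hw : w <> 0) by (apply Cmod_gt_0; lra).
  replace (/ w - / z - - / (z * z) * (w - z))%C
    with ((w - z) * (w - z) / (w * (z * z)))%C by (field; auto).
  rewrite Cmod_div by (repeat apply Cmult_neq_0; auto).
  rewrite !Cmod_mult. fold m.
  assert (Kwz := Cmod_ge_0 (w - z)).
  apply Rmult_le_reg_r with (Cmod w * (m * m)).
  { repeat apply Rmult_lt_0_compat; lra. }
  unfold Rdiv at 1. rewrite Rmult_assoc, Rinv_l, Rmult_1_r.
  2:{ apply Rgt_not_eq. repeat apply Rmult_lt_0_compat; lra. }
  apply Rle_trans with (eps * (m * m * m) / 2 * Cmod (w - z)).
  { apply Rmult_le_compat_r; lra. }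
  replace (eps * (m * m * m) / 2 * Cmod (w - z))
    with (eps * Cmod (w - z) * (m / 2 * (m * m))) by field.
  apply Rmult_le_compat_l. { apply Rmult_le_pos; lra. }
  apply Rmult_le_compat_r; [nra|lra].
Qed.

Lemma cder_div (f g : C -> C) (z a b : C) : g z <> 0 ->
  cder f z a -> cder g z b ->
  cder (fun w => f w / g w)%C z ((a * g z - f z * b) / (g z * g z)).
Proof.
  intros N Hf Hg.
  assert (H := cder_mult f (fun w => / g w)%C z _ _ Hf
                 (cder_comp (fun w => / w)%C g z _ _ (cder_inv _ N) Hg)).
  replace ((a * g z - f z * b) / (g z * g z))%C
    with (a * / g z + f z * (- / (g z * g z) * b))%C by (field; auto).
  exact H.
Qed.

Lemma cder_scal (c : C) (f : C -> C) (z a : C) :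
  cder f z a -> cder (fun w => c * f w)%C z (c * a).
Proof.
  intros Hf. replace (c * a)%C with (0 * f z + c * a)%C by ring.
  apply (cder_mult (fun _ => c)); [apply cder_const|exact Hf].
Qed.

Lemma cder_unique (f : C -> C) (z a b : C) : cder f z a -> cder f z b -> a = b.
Proof.
  intros Ha Hb. rewrite <- (cder_C_derive _ _ _ Ha). now apply cder_C_derive.
Qed.

Lemma cder_eq (f : C -> C) (z a b : C) : a = b -> cder f z a -> cder f z b.
Proof. now intros ->. Qed.

(** * The complex exponential *)

Definition cexp (z : C) : C := (exp (Re z) * cos (Im z), exp (Re z) * sin (Im z)).

Lemma cexp_plus (z w : C) : cexp (z + w) = (cexp z * cexp w)%C.
Proof.
  destruct z as [a b], w as [c d]. unfold cexp, Cmult, Cplus; simpl.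
  rewrite exp_plus, cos_plus, sin_plus. f_equal; ring.
Qed.

Lemma cexp_0 : cexp 0 = 1.
Proof. unfold cexp; simpl. rewrite exp_0, cos_0, sin_0. unfold RtoC. f_equal; ring. Qed.

Lemma Cmod_cexp (z : C) : Cmod (cexp z) = exp (Re z).
Proof.
  unfold Cmod, cexp; simpl. apply sqrt_lem_1.
  - nra.
  - apply Rlt_le, exp_pos.
  - assert (H := sin2_cos2 (Im z)). unfold Rsqr in H. nra.
Qed.

Lemma cexp_neq_0 (z : C) : cexp z <> 0.
Proof. apply Cmod_gt_0. rewrite Cmod_cexp. apply exp_pos. Qed.

Lemma cexp_opp (z : C) : cexp (- z) = (/ cexp z)%C.
Proof.
  assert (N := cexp_neq_0 z).
  replace (cexp (- z)) with (cexp z * cexp (- z) / cexp z)%C by (field; exact N).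
  rewrite <- cexp_plus. replace (z + - z)%C with (RtoC 0) by ring.
  rewrite cexp_0. field. exact N.
Qed.

Lemma Cmod_le_Rabs (x y : R) : Cmod (x, y) <= Rabs x + Rabs y.
Proof.
  replace (x, y) with (RtoC x + Ci * RtoC y)%C
    by (unfold Cplus, Cmult, RtoC, Ci; simpl; f_equal; ring).
  eapply Rle_trans; [apply Cmod_triangle|].
  rewrite Cmod_mult, Cmod_Ci, !Cmod_R. lra.
Qed.

Lemma Rabs_le_Cmod_l (x y : R) : Rabs x <= Cmod (x, y).
Proof. apply (re_le_Cmod (x, y)). Qed.

Lemma Rabs_le_Cmod_r (x y : R) : Rabs y <= Cmod (x, y).
Proof.
  eapply Rle_trans; [|apply (Rmax_Cmod (x, y))]. apply Rmax_r.
Qed.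

Lemma is_derive_littleo (f : R -> R) (x l : R) : is_derive f x l ->
  forall eps, 0 < eps -> exists delta, 0 < delta /\
    forall h, Rabs h < delta -> Rabs (f (x + h) - f x - l * h) <= eps * Rabs h.
Proof.
  intros [_ H] eps Heps.
  destruct (H x (fun P HP => HP) (mkposreal eps Heps)) as [[d Hd] Hw].
  exists d. split; [exact Hd|]. intros h Bh.
  assert (B : ball x d (x + h)).
  { change (Rabs (x + h - x) < d). replace (x + h - x) with h by ring. exact Bh. }
  specialize (Hw _ B).
  change (Rabs (f (x + h) - f x - (x + h - x) * l) <= eps * Rabs (x + h - x)) in Hw.
  replace (x + h - x) with h in Hw by ring.
  rewrite (Rmult_comm l). exact Hw.
Qed.

Lemma cder_cexp_0 : cder cexp 0 1.
Proof.
  (* The remainders r, c, s of exp, cos and sin are each at most e |w|; the four terms below add up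
     to at most 9 e |w|. *)
  intros eps Heps. set (e := Rmin 1 (eps / 10)).
  assert (He : 0 < e) by (apply Rmin_pos; lra).
  assert (He1 : e <= 1) by apply Rmin_l.
  assert (He2 : e <= eps / 10) by apply Rmin_r.
  destruct (is_derive_littleo exp 0 (exp 0) (is_derive_exp 0) e He) as [d1 [Hd1 H1]].
  destruct (is_derive_littleo cos 0 (- sin 0) (is_derive_cos 0) e He) as [d2 [Hd2 H2]].
  destruct (is_derive_littleo sin 0 (cos 0) (is_derive_sin 0) e He) as [d3 [Hd3 H3]].
  exists (Rmin e (Rmin d1 (Rmin d2 d3))). split.
  { repeat (apply Rmin_pos; [assumption|]); assumption. }
  intros [x y] Bw. replace ((x, y) - 0)%C with ((x, y) : C) in *
    by (unfold Cminus, Cplus, Copp, RtoC; simpl; f_equal; ring).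
  assert (Kx := Rabs_le_Cmod_l x y). assert (Ky := Rabs_le_Cmod_r x y).
  apply Rmin_Rgt_l in Bw. destruct Bw as [B0 Bw].
  apply Rmin_Rgt_l in Bw. destruct Bw as [B1 Bw].
  apply Rmin_Rgt_l in Bw. destruct Bw as [B2 B3].
  specialize (H1 x ltac:(lra)). specialize (H2 y ltac:(lra)). specialize (H3 y ltac:(lra)).
  rewrite !Rplus_0_l, exp_0 in H1. rewrite !Rplus_0_l, cos_0, sin_0 in H2.
  rewrite !Rplus_0_l, cos_0, sin_0 in H3.
  rewrite cexp_0.
  set (r := exp x - 1 - 1 * x) in *. set (c := cos y - 1 - -0 * y) in *.
  set (s := sin y - 0 - 1 * y) in *.
  replace (cexp (x, y) - 1 - 1 * (x, y))%C with
    ((r + (1 + x + r) * c, (1 + x + r) * s + (x + r) * y) : C)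
    by (unfold cexp, r, c, s, Cminus, Cplus, Copp, Cmult, RtoC; simpl; f_equal; ring).
  eapply Rle_trans; [apply Cmod_le_Rabs|].
  set (m := Cmod (x, y)) in *.
  eapply Rle_trans; [apply Rplus_le_compat; apply Rabs_triang|].
  rewrite !Rabs_mult.
  assert (A : Rabs (1 + x + r) <= 3).
  { eapply Rle_trans; [apply Rabs_triang|].
    eapply Rle_trans; [apply Rplus_le_compat_r, Rabs_triang|]. rewrite Rabs_R1. nra. }
  assert (B : Rabs (x + r) <= 2 * e).
  { eapply Rle_trans; [apply Rabs_triang|]. assert (K := Rabs_pos x). nra. }
  assert (Kr := Rabs_pos r). assert (Kc := Rabs_pos c). assert (Ks := Rabs_pos s).
  assert (Kxx := Rabs_pos x). assert (Kyy := Rabs_pos y).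
  assert (Kz := Rabs_pos (1 + x + r)). assert (Kv := Rabs_pos (x + r)).
  assert (r1 : Rabs r <= e * m) by nra.
  assert (c1 : Rabs c <= e * m) by nra.
  assert (s1 : Rabs s <= e * m) by nra.
  assert (T1 : Rabs (1 + x + r) * Rabs c <= 3 * (e * m)) by nra.
  assert (T2 : Rabs (1 + x + r) * Rabs s <= 3 * (e * m)) by nra.
  assert (T3 : Rabs (x + r) * Rabs y <= 2 * e * m) by nra.
  assert (Km : 0 <= m) by apply Cmod_ge_0.
  nra.
Qed.

Lemma cder_cexp (z : C) : cder cexp z (cexp z).
Proof.
  apply cder_ext with (fun w => cexp z * cexp (w - z))%C.
  { intros w. rewrite <- cexp_plus. f_equal. ring. }
  apply cder_eq with (cexp z * (1 * (1 - 0)))%C; [ring|].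
  apply cder_scal. apply (cder_comp cexp (fun w => w - z)%C).
  - replace (z - z)%C with (RtoC 0) by ring. apply cder_cexp_0.
  - apply cder_minus; [apply cder_id|apply cder_const].
Qed.


(** * Integrals of complex-valued functions of a real variable *)

Definition pcont (f : R -> C) (x : R) : Prop :=
  forall eps, 0 < eps -> exists delta, 0 < delta /\
    forall y, Rabs (y - x) < delta -> Cmod (f y - f x) < eps.

Definition pcont_on (f : R -> C) (a b : R) : Prop :=
  forall x, a <= x <= b -> pcont f x.

Lemma pcont_continuous (f : R -> C) (x : R) :
  pcont f x -> continuous (f : R -> C_R_NormedModule) x.
Proof.
  intros H P [eps HP]. destruct (H eps (cond_pos eps)) as [d [Hd Hy]].
  exists (mkposreal d Hd). intros y By. apply HP.
  specialize (Hy y By). split.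
  - change (Rabs (fst (f y) - fst (f x)) < eps).
    eapply Rle_lt_trans; [apply (Rabs_le_Cmod_l _ (snd (f y) - snd (f x)))|exact Hy].
  - change (Rabs (snd (f y) - snd (f x)) < eps).
    eapply Rle_lt_trans; [apply (Rabs_le_Cmod_r (fst (f y) - fst (f x)))|exact Hy].
Qed.

Definition CInt (f : R -> C) (a b : R) : C :=
  RInt (V := C_R_CompleteNormedModule) f a b.

Definition is_CInt (f : R -> C) (a b : R) (l : C) : Prop :=
  is_RInt (V := C_R_NormedModule) f a b l.

Lemma CInt_correct (f : R -> C) (a b : R) : a <= b -> pcont_on f a b ->
  is_CInt f a b (CInt f a b).
Proof.
  intros Hab H. apply (RInt_correct (V := C_R_CompleteNormedModule)).
  apply (ex_RInt_continuous (V := C_R_CompleteNormedModule)).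
  intros z. rewrite Rmin_left, Rmax_right by exact Hab. intros Hz.
  apply pcont_continuous, H, Hz.
Qed.

Lemma is_CInt_unique (f : R -> C) (a b : R) (l : C) :
  is_CInt f a b l -> CInt f a b = l.
Proof. apply (is_RInt_unique (V := C_R_CompleteNormedModule)). Qed.

Lemma is_CInt_ext (f g : R -> C) (a b : R) (l : C) : a <= b ->
  (forall x, a <= x <= b -> f x = g x) -> is_CInt f a b l -> is_CInt g a b l.
Proof.
  intros Hab E. apply (is_RInt_ext (V := C_R_NormedModule)).
  intros x. rewrite Rmin_left, Rmax_right by exact Hab. intros Hx. apply E. lra.
Qed.

Lemma CInt_ext (f g : R -> C) (a b : R) : a <= b ->
  (forall x, a <= x <= b -> f x = g x) -> CInt f a b = CInt g a b.
Proof.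
  intros Hab E. apply (RInt_ext (V := C_R_CompleteNormedModule)).
  intros x. rewrite Rmin_left, Rmax_right by exact Hab. intros Hx. apply E. lra.
Qed.

Lemma is_CInt_plus (f g : R -> C) (a b : R) (l m : C) :
  is_CInt f a b l -> is_CInt g a b m -> is_CInt (fun x => f x + g x)%C a b (l + m).
Proof. apply (is_RInt_plus (V := C_R_NormedModule)). Qed.

Lemma is_CInt_minus (f g : R -> C) (a b : R) (l m : C) :
  is_CInt f a b l -> is_CInt g a b m -> is_CInt (fun x => f x - g x)%C a b (l - m).
Proof. apply (is_RInt_minus (V := C_R_NormedModule)). Qed.

(** The integral is taken in a real vector space, where only real factors come out for free; a
    complex factor mixes the two components. *)
Lemma is_CInt_scal (c : C) (f : R -> C) (a b : R) (l : C) :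
  is_CInt f a b l -> is_CInt (fun x => c * f x)%C a b (c * l).
Proof.
  intros H.
  assert (H1 := is_RInt_fct_extend_fst (U := R_NormedModule) (V := R_NormedModule) _ _ _ _ H).
  assert (H2 := is_RInt_fct_extend_snd (U := R_NormedModule) (V := R_NormedModule) _ _ _ _ H).
  apply (is_RInt_fct_extend_pair (U := R_NormedModule) (V := R_NormedModule)
           (fun x => c * f x)%C); simpl.
  - apply (is_RInt_minus (V := R_NormedModule));
      apply (is_RInt_scal (V := R_NormedModule)); assumption.
  - apply (is_RInt_plus (V := R_NormedModule));
      apply (is_RInt_scal (V := R_NormedModule)); assumption.
Qed.

Lemma is_CInt_const (c : C) (a b : R) : is_CInt (fun _ => c) a b (RtoC (b - a) * c).
Proof.
  assert (H := is_RInt_const (V := C_R_NormedModule) a b c).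
  unfold is_CInt. replace (RtoC (b - a) * c)%C with (scal (b - a) (c : C_R_NormedModule)).
  - exact H.
  - unfold scal; simpl. unfold prod_scal, scal, Cmult, RtoC; simpl. unfold mult; simpl.
    f_equal; ring.
Qed.

Lemma is_CInt_chasles (f : R -> C) (a b c : R) (l m : C) :
  is_CInt f a b l -> is_CInt f b c m -> is_CInt f a c (l + m).
Proof. apply (is_RInt_Chasles (V := C_R_NormedModule)). Qed.

Lemma is_CInt_bound (f : R -> C) (a b M : R) (l : C) : a <= b ->
  (forall x, a <= x <= b -> Cmod (f x) <= M) -> is_CInt f a b l ->
  Cmod l <= M * (b - a).
Proof.
  intros Hab HM H. rewrite Cmod_norm.
  apply (norm_RInt_le (V := C_R_NormedModule) f (fun _ => M) a b l); [exact Hab| |exact H|].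
  - intros x Hx. specialize (HM x Hx). rewrite Cmod_norm in HM. exact HM.
  - assert (K := is_RInt_const (V := R_NormedModule) a b M).
    unfold scal in K; simpl in K. unfold mult in K; simpl in K.
    rewrite Rmult_comm. exact K.
Qed.

Definition pder (f : R -> C) (x : R) (l : C) : Prop :=
  forall eps, 0 < eps -> exists delta, 0 < delta /\
    forall y, Rabs (y - x) < delta ->
      Cmod (f y - f x - RtoC (y - x) * l) <= eps * Rabs (y - x).

Lemma pder_is_derive (f : R -> C) (x : R) (l : C) :
  pder f x l -> is_derive (f : R -> C_R_NormedModule) x l.
Proof.
  intros H. split. { apply (is_linear_scal_l (V := C_R_NormedModule)). }
  intros u Hu.
  replace u with x by (apply (is_filter_lim_locally_unique x u); exact Hu).
  intros eps. destruct (H eps (cond_pos eps)) as [d [Hd Hw]].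
  exists (mkposreal d Hd). intros y By. specialize (Hw y By).
  rewrite Cmod_norm in Hw.
  replace (f y - f x - RtoC (y - x) * l)%C with
    (minus (minus (f y : C_R_NormedModule) (f x)) (scal (minus y x) (l : C_R_NormedModule)))
    in Hw; [exact Hw|].
  unfold minus, plus, opp, scal; simpl.
  unfold prod_plus, prod_opp, prod_scal, minus, plus, opp, scal, Cminus, Cplus, Copp, Cmult, RtoC; simpl.
  unfold mult, plus; simpl. f_equal; ring.
Qed.

Lemma is_CInt_FTC (F f : R -> C) (a b : R) : a <= b ->
  (forall x, a <= x <= b -> pder F x (f x)) -> pcont_on f a b ->
  is_CInt f a b (F b - F a).
Proof.
  intros Hab HF Hf. apply (is_RInt_derive (V := C_R_CompleteNormedModule) F f).
  - intros x. rewrite Rmin_left, Rmax_right by exact Hab.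
    intros Hx. apply pder_is_derive, HF, Hx.
  - intros x. rewrite Rmin_left, Rmax_right by exact Hab.
    intros Hx. apply pcont_continuous, Hf, Hx.
Qed.

Lemma pder_comp_cder (f : C -> C) (g : R -> C) (x : R) (a b : C) :
  cder f (g x) a -> pder g x b -> pder (fun t => f (g t)) x (a * b).
Proof.
  intros Hf Hg eps Heps.
  assert (Ka := Cmod_ge_0 a). assert (Kb := Cmod_ge_0 b).
  destruct (Hf (eps / (2 * (Cmod b + 1)))) as [d1 [Hd1 H1]].
  { apply Rdiv_lt_0_compat; lra. }
  destruct (Hg (Rmin 1 (eps / (2 * (Cmod a + 1))))) as [d2 [Hd2 H2]].
  { apply Rmin_pos; [lra|]. apply Rdiv_lt_0_compat; lra. }
  exists (Rmin d2 (d1 / (Cmod b + 1))). split.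
  { apply Rmin_pos; [assumption|]. apply Rdiv_lt_0_compat; lra. }
  intros y By. apply Rmin_Rgt_l in By. destruct By as [B1 B2].
  specialize (H2 y B1). assert (Ky := Rabs_pos (y - x)).
  assert (L : Cmod (g y - g x) <= (Cmod b + 1) * Rabs (y - x)).
  { replace (g y - g x)%C with ((g y - g x - RtoC (y - x) * b) + RtoC (y - x) * b)%C by ring.
    eapply Rle_trans; [apply Cmod_triangle|]. rewrite Cmod_mult, Cmod_R.
    assert (Rmin 1 (eps / (2 * (Cmod a + 1))) <= 1) by apply Rmin_l. nra. }
  assert (H2' : Cmod (g y - g x - RtoC (y - x) * b) <= eps / (2 * (Cmod a + 1)) * Rabs (y - x)).
  { eapply Rle_trans; [exact H2|]. apply Rmult_le_compat_r; [lra|apply Rmin_r]. }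
  assert (B : Cmod (g y - g x) < d1).
  { eapply Rle_lt_trans; [exact L|].
    apply Rlt_le_trans with ((Cmod b + 1) * (d1 / (Cmod b + 1))).
    - apply Rmult_lt_compat_l; lra.
    - apply Req_le. field. lra. }
  specialize (H1 (g y) B).
  replace (f (g y) - f (g x) - RtoC (y - x) * (a * b))%C with
    ((f (g y) - f (g x) - a * (g y - g x)) + a * (g y - g x - RtoC (y - x) * b))%C by ring.
  eapply Rle_trans; [apply Cmod_triangle|]. rewrite Cmod_mult.
  assert (E1 : eps / (2 * (Cmod b + 1)) * Cmod (g y - g x) <= eps / 2 * Rabs (y - x)).
  { replace (eps / 2 * Rabs (y - x)) with
      (eps / (2 * (Cmod b + 1)) * ((Cmod b + 1) * Rabs (y - x))) by (field; lra).
    apply Rmult_le_compat_l; [|exact L]. apply Rlt_le, Rdiv_lt_0_compat; lra. }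
  assert (E2 : Cmod a * Cmod (g y - g x - RtoC (y - x) * b) <= eps / 2 * Rabs (y - x)).
  { apply Rle_trans with
      ((Cmod a + 1) * (eps / (2 * (Cmod a + 1)) * Rabs (y - x))).
    - apply Rmult_le_compat; [lra|apply Cmod_ge_0|lra|exact H2'].
    - apply Req_le. field. lra. }
  lra.
Qed.

Lemma pder_affine (p q : C) (x : R) : pder (fun t => p + RtoC t * q)%C x q.
Proof.
  intros eps Heps. exists 1. split; [lra|]. intros y _.
  replace (p + RtoC y * q - (p + RtoC x * q) - RtoC (y - x) * q)%C with (RtoC 0)
    by (rewrite RtoC_minus; ring).
  rewrite Cmod_0. apply Rmult_le_pos; [lra|apply Rabs_pos].
Qed.

Lemma pcont_comp (f : C -> C) (g : R -> C) (x : R) :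
  ccont f (g x) -> pcont g x -> pcont (fun t => f (g t)) x.
Proof.
  intros Hf Hg eps Heps. destruct (Hf eps Heps) as [d [Hd H1]].
  destruct (Hg d Hd) as [d' [Hd' H2]]. exists d'. split; [exact Hd'|]. auto.
Qed.

Lemma pder_pcont (f : R -> C) (x : R) (l : C) : pder f x l -> pcont f x.
Proof.
  intros H eps Heps. destruct (H 1 Rlt_0_1) as [d [Hd Hy]].
  assert (K := Cmod_ge_0 l).
  exists (Rmin d (eps / (Cmod l + 2))). split.
  { apply Rmin_pos; [exact Hd|]. apply Rdiv_lt_0_compat; lra. }
  intros y By. apply Rmin_Rgt_l in By. destruct By as [B1 B2]. specialize (Hy y B1).
  replace (f y - f x)%C with ((f y - f x - RtoC (y - x) * l) + RtoC (y - x) * l)%C by ring.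
  eapply Rle_lt_trans; [apply Cmod_triangle|]. rewrite Cmod_mult, Cmod_R.
  apply Rmult_gt_compat_l with (r := Cmod l + 2) in B2; [|lra].
  replace ((Cmod l + 2) * (eps / (Cmod l + 2))) with eps in B2 by (field; lra).
  assert (Ky := Rabs_pos (y - x)). nra.
Qed.

Lemma pcont_affine (p q : C) (x : R) : pcont (fun t => p + RtoC t * q)%C x.
Proof. eapply pder_pcont, pder_affine. Qed.

Lemma pcont_ext (f g : R -> C) (x : R) :
  (forall t, f t = g t) -> pcont f x -> pcont g x.
Proof.
  intros E H eps Heps. destruct (H eps Heps) as [d Hd]. exists d.
  now setoid_rewrite <- E.
Qed.

Lemma pcont_mult (f g : R -> C) (x : R) :
  pcont f x -> pcont g x -> pcont (fun t => f t * g t)%C x.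
Proof.
  intros Hf Hg eps Heps.
  set (M := Cmod (f x) + Cmod (g x) + 2).
  assert (Kf := Cmod_ge_0 (f x)). assert (Kg := Cmod_ge_0 (g x)).
  assert (HM : 0 < M) by (unfold M; lra).
  set (e := Rmin 1 (eps / M)).
  assert (He : 0 < e) by (apply Rmin_pos; [lra|apply Rdiv_lt_0_compat; lra]).
  destruct (Hf e He) as [d1 [Hd1 H1]].
  destruct (Hg e He) as [d2 [Hd2 H2]].
  exists (Rmin d1 d2). split; [now apply Rmin_pos|]. intros w Bw.
  replace (f w * g w - (f x * g x))%C with
    ((f w - f x) * (g w - g x) + ((f w - f x) * g x + f x * (g w - g x)))%C by ring.
  assert (F : Cmod (f w - f x) < e)
    by (apply H1, Rlt_le_trans with (1 := Bw), Rmin_l).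
  assert (G : Cmod (g w - g x) < e)
    by (apply H2, Rlt_le_trans with (1 := Bw), Rmin_r).
  eapply Rle_lt_trans; [apply Cmod_triangle|].
  eapply Rle_lt_trans;
    [apply Rplus_le_compat_l, Cmod_triangle|].
  rewrite !Cmod_mult.
  assert (E1 : e <= 1) by apply Rmin_l.
  assert (E2 : e * M <= eps).
  { replace eps with (eps / M * M) at 1 by (field; lra).
    apply Rmult_le_compat_r; [lra|apply Rmin_r]. }
  assert (K1 := Cmod_ge_0 (f w - f x)). assert (K2 := Cmod_ge_0 (g w - g x)).
  unfold M in E2. nra.
Qed.

Lemma pcont_plus (f g : R -> C) (x : R) :
  pcont f x -> pcont g x -> pcont (fun t => f t + g t)%C x.
Proof.
  intros Hf Hg eps Heps.
  destruct (Hf (eps / 2)) as [d1 [Hd1 H1]]; [lra|].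
  destruct (Hg (eps / 2)) as [d2 [Hd2 H2]]; [lra|].
  exists (Rmin d1 d2). split; [now apply Rmin_pos|]. intros w Bw.
  replace (f w + g w - (f x + g x))%C with ((f w - f x) + (g w - g x))%C by ring.
  eapply Rle_lt_trans; [apply Cmod_triangle|].
  assert (Cmod (f w - f x) < eps / 2)
    by (apply H1, Rlt_le_trans with (1 := Bw), Rmin_l).
  assert (Cmod (g w - g x) < eps / 2)
    by (apply H2, Rlt_le_trans with (1 := Bw), Rmin_r).
  lra.
Qed.

Lemma pcont_const (c : C) (x : R) : pcont (fun _ => c) x.
Proof.
  apply pcont_ext with (fun t => c + RtoC t * 0)%C; [intros; ring|apply pcont_affine].
Qed.

(** * Goursat's lemma on rectangles *)

(** The integral of h dz counterclockwise along the boundary of [a, b] x [c, d]; the factor [Ci] is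
    dz / dv on the vertical sides. *)
Definition rect_int (h : C -> C) (a b c d : R) : C :=
  (CInt (fun u => h (u, c)) a b + Ci * CInt (fun v => h (b, v)) c d
   - CInt (fun u => h (u, d)) a b - Ci * CInt (fun v => h (a, v)) c d)%C.

Definition cont_rect (h : C -> C) (a b c d : R) : Prop :=
  forall x y, a <= x <= b -> c <= y <= d -> ccont h (x, y).

Lemma pcont_row (h : C -> C) (u c : R) : ccont h (u, c) -> pcont (fun t => h (t, c)) u.
Proof.
  intros H. apply (pcont_comp h (fun t => (t, c))); [exact H|].
  apply pcont_ext with (fun t => (0, c) + RtoC t * 1)%C; [|apply pcont_affine].
  intros t. unfold Cplus, Cmult, RtoC; simpl. f_equal; ring.
Qed.

Lemma pcont_col (h : C -> C) (u c : R) : ccont h (u, c) -> pcont (fun t => h (u, t)) c.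
Proof.
  intros H. apply (pcont_comp h (fun t => (u, t))); [exact H|].
  apply pcont_ext with (fun t => (u, 0) + RtoC t * Ci)%C; [|apply pcont_affine].
  intros t. unfold Cplus, Cmult, RtoC, Ci; simpl. f_equal; ring.
Qed.

Lemma CInt_split (f : R -> C) (a m b : R) : a <= m <= b -> pcont_on f a b ->
  CInt f a b = (CInt f a m + CInt f m b)%C.
Proof.
  intros Hm H. apply is_CInt_unique, is_CInt_chasles with m; apply CInt_correct; try lra;
    intros x Hx; apply H; lra.
Qed.

(** Each inner side is run through twice in opposite directions. *)
Lemma rect_int_quarter (h : C -> C) (a m b c n d : R) :
  a <= m <= b -> c <= n <= d -> cont_rect h a b c d ->
  rect_int h a b c d =
    (rect_int h a m c n + rect_int h m b c n + rect_int h a m n d + rect_int h m b n d)%C.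
Proof.
  intros Hm Hn H. unfold rect_int.
  rewrite (CInt_split (fun u => h (u, c)) a m b Hm), (CInt_split (fun u => h (u, d)) a m b Hm),
    (CInt_split (fun v => h (a, v)) c n d Hn), (CInt_split (fun v => h (b, v)) c n d Hn).
  - ring.
  - intros x Hx. apply pcont_col, H; lra.
  - intros x Hx. apply pcont_col, H; lra.
  - intros x Hx. apply pcont_row, H; lra.
  - intros x Hx. apply pcont_row, H; lra.
Qed.

Lemma RtoC_half_sqr_pder (p q : C) (x : R) :
  pder (fun t => RtoC t * p + RtoC (t * t / 2) * q)%C x (p + RtoC x * q).
Proof.
  intros eps Heps. assert (K := Cmod_ge_0 q).
  exists (eps / (Cmod q + 1)). split; [apply Rdiv_lt_0_compat; lra|]. intros y By.
  replace (RtoC y * p + RtoC (y * y / 2) * q - (RtoC x * p + RtoC (x * x / 2) * q)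
           - RtoC (y - x) * (p + RtoC x * q))%C with (RtoC ((y - x) * (y - x) / 2) * q)%C.
  2:{ destruct p, q; unfold Cminus, Cplus, Copp, Cmult, RtoC; simpl. f_equal; field. }
  rewrite Cmod_mult, Cmod_R. unfold Rdiv. rewrite !Rabs_mult, (Rabs_right (/ 2)) by lra.
  assert (Ky := Rabs_pos (y - x)).
  apply Rmult_lt_compat_l with (r := Cmod q + 1) in By; [|lra].
  replace ((Cmod q + 1) * (eps / (Cmod q + 1))) with eps in By by (field; lra).
  assert (T : Rabs (y - x) * Cmod q <= eps) by nra.
  apply Rmult_le_compat_r with (r := Rabs (y - x)) in T; [|lra]. nra.
Qed.

Lemma is_CInt_affine (p q : C) (a b : R) : a <= b ->
  is_CInt (fun t => p + RtoC t * q)%C a b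
    ((RtoC b * p + RtoC (b * b / 2) * q) - (RtoC a * p + RtoC (a * a / 2) * q)).
Proof.
  intros Hab. apply (is_CInt_FTC (fun t => RtoC t * p + RtoC (t * t / 2) * q)%C); [exact Hab| |].
  - intros x _. apply RtoC_half_sqr_pder.
  - intros x _. apply pcont_affine.
Qed.

(** An affine function has an explicit primitive, so its integral along the boundary is 0. Only the
    deviation contributes, at most M times the perimeter. *)
Lemma rect_int_affine_err (h : C -> C) (p q : C) (a b c d M : R) :
  a <= b -> c <= d -> cont_rect h a b c d ->
  (forall x y, a <= x <= b -> c <= y <= d -> Cmod (h (x, y) - (p + q * (x, y))) <= M) ->
  Cmod (rect_int h a b c d) <= 2 * M * ((b - a) + (d - c)).
Proof.
  intros Hab Hcd Hh HM.
  set (k := fun z : C => (p + q * z)%C).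
  assert (R1 : forall y, c <= y <= d -> is_CInt (fun u => h (u, y)) a b (CInt (fun u => h (u, y)) a b)).
  { intros y Hy. apply CInt_correct; [exact Hab|]. intros x Hx. apply pcont_row, Hh; assumption. }
  assert (R2 : forall x, a <= x <= b -> is_CInt (fun v => h (x, v)) c d (CInt (fun v => h (x, v)) c d)).
  { intros x Hx. apply CInt_correct; [exact Hcd|]. intros y Hy. apply pcont_col, Hh; assumption. }
  assert (A1 : forall y, is_CInt (fun u => k (u, y)) a b
     ((RtoC b * (p + q * (0, y)) + RtoC (b * b / 2) * q)
      - (RtoC a * (p + q * (0, y)) + RtoC (a * a / 2) * q))).
  { intros y. eapply is_CInt_ext; [exact Hab| |apply (is_CInt_affine (p + q * (0, y)) q a b Hab)].
    intros x _. unfold k. destruct p, q; unfold Cplus, Cmult, RtoC; simpl. f_equal; ring. }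
  assert (A2 : forall x, is_CInt (fun v => k (x, v)) c d
     ((RtoC d * (p + q * (x, 0)) + RtoC (d * d / 2) * (q * Ci))
      - (RtoC c * (p + q * (x, 0)) + RtoC (c * c / 2) * (q * Ci)))).
  { intros x. eapply is_CInt_ext; [exact Hcd| |apply (is_CInt_affine (p + q * (x, 0)) (q * Ci) c d Hcd)].
    intros y _. unfold k. destruct p, q; unfold Cplus, Cmult, RtoC, Ci; simpl. f_equal; ring. }
  assert (B1 := fun y Hy => is_CInt_bound _ a b M _ Hab (fun x Hx => HM x y Hx Hy)
                   (is_CInt_minus _ _ _ _ _ _ (R1 y Hy) (A1 y))).
  assert (B2 := fun x Hx => is_CInt_bound _ c d M _ Hcd (fun y Hy => HM x y Hx Hy)
                   (is_CInt_minus _ _ _ _ _ _ (R2 x Hx) (A2 x))).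
  unfold rect_int.
  match goal with |- Cmod ?L <= _ => replace L with
    ((CInt (fun u => h (u, c)) a b - (RtoC b * (p + q * (0, c)) + RtoC (b * b / 2) * q
          - (RtoC a * (p + q * (0, c)) + RtoC (a * a / 2) * q)))
     + (Ci * (CInt (fun v => h (b, v)) c d - (RtoC d * (p + q * (b, 0)) + RtoC (d * d / 2) * (q * Ci)
          - (RtoC c * (p + q * (b, 0)) + RtoC (c * c / 2) * (q * Ci))))
     + (- (CInt (fun u => h (u, d)) a b - (RtoC b * (p + q * (0, d)) + RtoC (b * b / 2) * q
          - (RtoC a * (p + q * (0, d)) + RtoC (a * a / 2) * q)))
     + - (Ci * (CInt (fun v => h (a, v)) c d - (RtoC d * (p + q * (a, 0)) + RtoC (d * d / 2) * (q * Ci)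
          - (RtoC c * (p + q * (a, 0)) + RtoC (c * c / 2) * (q * Ci))))))))%C end.
  2:{ generalize (CInt (fun u => h (u, c)) a b) (CInt (fun u => h (u, d)) a b)
        (CInt (fun v => h (b, v)) c d) (CInt (fun v => h (a, v)) c d).
      intros [] [] [] []. destruct p, q.
      unfold Cminus, Cplus, Copp, Cmult, RtoC, Ci; simpl. f_equal; field. }
  eapply Rle_trans; [apply Cmod_triangle|].
  eapply Rle_trans; [apply Rplus_le_compat_l, Cmod_triangle|].
  eapply Rle_trans; [apply Rplus_le_compat_l, Rplus_le_compat_l, Cmod_triangle|].
  rewrite !Cmod_opp, !(Cmod_mult Ci), Cmod_Ci.
  generalize (B1 c (conj (Rle_refl c) Hcd)) (B1 d (conj Hcd (Rle_refl d)))
    (B2 a (conj (Rle_refl a) Hab)) (B2 b (conj Hab (Rle_refl b))).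
  lra.
Qed.


Lemma nested_intervals (a b : nat -> R) :
  (forall n, a n <= a (S n)) -> (forall n, b (S n) <= b n) -> (forall n, a n <= b n) ->
  exists x, forall n, a n <= x <= b n.
Proof.
  intros Ha Hb Hab.
  assert (Ma : forall n k, a n <= a (n + k)%nat).
  { intros n k. induction k; [rewrite Nat.add_0_r; lra|].
    rewrite Nat.add_succ_r. specialize (Ha (n + k)%nat). lra. }
  assert (Mb : forall n k, b (n + k)%nat <= b n).
  { intros n k. induction k; [rewrite Nat.add_0_r; lra|].
    rewrite Nat.add_succ_r. specialize (Hb (n + k)%nat). lra. }
  assert (Mab : forall n m, a n <= b m).
  { intros n m. specialize (Ma n m). specialize (Mb m n).
    rewrite Nat.add_comm in Mb. specialize (Hab (n + m)%nat). lra. }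
  destruct (completeness (fun r => exists n, r = a n)) as [x [Hx1 Hx2]].
  - exists (b O). intros r [n ->]. apply Mab.
  - exists (a O), O. reflexivity.
  - exists x. intros n. split.
    + apply Hx1. now exists n.
    + apply Hx2. intros r [m ->]. apply Mab.
Qed.

Lemma half_pow_small (w delta : R) : 0 < delta -> exists n, w * (/ 2) ^ n < delta.
Proof.
  intros Hd.
  destruct (pow_lt_1_zero (/ 2)) with (y := delta / (Rabs w + 1)) as [n Hn].
  - rewrite Rabs_right; lra.
  - apply Rdiv_lt_0_compat; [exact Hd|]. generalize (Rabs_pos w). lra.
  - exists n. specialize (Hn n (le_n n)).
    assert (K : 0 < (/ 2) ^ n) by (apply pow_lt; lra).
    rewrite Rabs_right in Hn by lra. assert (Kw := Rabs_pos w). assert (L := Rle_abs w).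
    apply Rmult_lt_compat_l with (r := Rabs w + 1) in Hn; [|lra].
    replace ((Rabs w + 1) * (delta / (Rabs w + 1))) with delta in Hn by (field; lra).
    nra.
Qed.

Definition subrect (r' r : R * R * R * R) : Prop :=
  let '(a', b', c', d') := r' in let '(a, b, c, d) := r in
  a <= a' <= b' /\ b' <= b /\ c <= c' <= d' /\ d' <= d.

Definition quarter (r' r : R * R * R * R) : Prop :=
  let '(a', b', c', d') := r' in let '(a, b, c, d) := r in
  ((a' = a /\ b' = (a + b) / 2) \/ (a' = (a + b) / 2 /\ b' = b)) /\
  ((c' = c /\ d' = (c + d) / 2) \/ (c' = (c + d) / 2 /\ d' = d)).

(** Compactness by bisection: if P failed, repeatedly choosing a bad quarter would give bad
    rectangles shrinking to a point, against the local hypothesis at that point. Both Goursat's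
    lemma and the Lebesgue number below rest on it. *)
Lemma rect_induction (P : R * R * R * R -> Prop) (a b c d : R) : a <= b -> c <= d ->
  (forall r, subrect r (a, b, c, d) -> (forall r', quarter r' r -> P r') -> P r) ->
  (forall x y, a <= x <= b -> c <= y <= d -> exists delta, 0 < delta /\
     forall a' b' c' d', subrect (a', b', c', d') (a, b, c, d) ->
       a' <= x <= b' -> c' <= y <= d' -> b' - a' < delta -> d' - c' < delta ->
       P (a', b', c', d')) ->
  P (a, b, c, d).
Proof.
  intros Hab Hcd Hq Hloc. apply NNPP. intros Hbad.
  set (Bad := fun r => subrect r (a, b, c, d) /\ ~ P r).
  (* Carrying the proof of badness in a subtype lets the sequence of rectangles be defined by plain
     recursion. *)
  assert (Hstep : forall r : {r | Bad r}, {r' : {r | Bad r} | quarter (proj1_sig r') (proj1_sig r)}).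
  { intros [r [Hr Nr]]. apply constructive_indefinite_description. simpl.
    apply NNPP. intros N. apply Nr, Hq; [exact Hr|].
    intros r' Hr'. apply NNPP. intros Nr'. apply N.
    assert (B : Bad r').
    { split; [|exact Nr']. destruct r as [[[ar br] cr] dr], r' as [[[a' b'] c'] d'].
      simpl in *. intuition (subst; lra). }
    now exists (exist _ r' B). }
  assert (B0 : Bad (a, b, c, d)) by (split; [simpl; lra|exact Hbad]).
  set (s := fix s n : {r | Bad r} :=
    match n with O => exist _ _ B0 | S k => proj1_sig (Hstep (s k)) end).
  set (fa := fun n => let '(x, _, _, _) := proj1_sig (s n) in x).
  set (fb := fun n => let '(_, x, _, _) := proj1_sig (s n) in x).
  set (fc := fun n => let '(_, _, x, _) := proj1_sig (s n) in x).
  set (fd := fun n => let '(_, _, _, x) := proj1_sig (s n) in x).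
  assert (HB : forall n, Bad (fa n, fb n, fc n, fd n)).
  { intros n. unfold fa, fb, fc, fd. destruct (s n) as [[[[]]] HB]. exact HB. }
  assert (HQ : forall n, quarter (fa (S n), fb (S n), fc (S n), fd (S n)) (fa n, fb n, fc n, fd n)).
  { intros n. unfold fa, fb, fc, fd.
    assert (Q := proj2_sig (Hstep (s n))). change (proj1_sig (Hstep (s n))) with (s (S n)) in Q.
    destruct (proj1_sig (s n)) as [[[]]], (proj1_sig (s (S n))) as [[[]]]. exact Q. }
  assert (HS : forall n, subrect (fa n, fb n, fc n, fd n) (a, b, c, d))
    by (intros n; apply HB).
  destruct (nested_intervals fa fb) as [x Hx];
    try (intros n; specialize (HQ n); specialize (HS n); simpl in HQ, HS; intuition lra).
  destruct (nested_intervals fc fd) as [y Hy];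
    try (intros n; specialize (HQ n); specialize (HS n); simpl in HQ, HS; intuition lra).
  assert (Wx : forall n, fb n - fa n = (b - a) * (/ 2) ^ n).
  { intros n. induction n.
    - unfold fa, fb. simpl. ring.
    - specialize (HQ n). simpl in HQ. simpl. intuition lra. }
  assert (Wy : forall n, fd n - fc n = (d - c) * (/ 2) ^ n).
  { intros n. induction n.
    - unfold fc, fd. simpl. ring.
    - specialize (HQ n). simpl in HQ. simpl. intuition lra. }
  assert (Ix : a <= x <= b) by (apply (Hx O)).
  assert (Iy : c <= y <= d) by (apply (Hy O)).
  destruct (Hloc x y Ix Iy) as [delta [Hd HP]].
  destruct (half_pow_small (Rmax (b - a) (d - c)) delta Hd) as [n Hn].
  assert (K : 0 < (/ 2) ^ n) by (apply pow_lt; lra).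
  apply (proj2 (HB n)). apply HP; auto.
  - rewrite Wx. eapply Rle_lt_trans; [|exact Hn]. apply Rmult_le_compat_r; [lra|apply Rmax_l].
  - rewrite Wy. eapply Rle_lt_trans; [|exact Hn]. apply Rmult_le_compat_r; [lra|apply Rmax_r].
Qed.

(** The bound 2 eps ((b - a) + (d - c))^2 is inherited from the quarters: there are four of them,
    each with a quarter of the squared half-perimeter. On small rectangles it holds because h is
    affine up to eps times the diameter. *)
Lemma goursat_rect (h : C -> C) (a b c d : R) : a <= b -> c <= d ->
  (forall x y, a <= x <= b -> c <= y <= d -> exists l, cder h (x, y) l) ->
  rect_int h a b c d = 0.
Proof.
  intros Hab Hcd Hh.
  assert (Hcont : cont_rect h a b c d).
  { intros x y Hx Hy. destruct (Hh x y Hx Hy) as [l Hl]. eapply cder_cont, Hl. }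
  assert (Hsub : forall a' b' c' d', subrect (a', b', c', d') (a, b, c, d) ->
            cont_rect h a' b' c' d').
  { intros a' b' c' d' Hs x y Hx Hy. simpl in Hs. apply Hcont; lra. }
  assert (Hest : forall eps, 0 < eps ->
    Cmod (rect_int h a b c d) <= 2 * eps * ((b - a) + (d - c)) ^ 2).
  { intros eps Heps.
    apply (rect_induction (fun r => let '(a, b, c, d) := r in
      Cmod (rect_int h a b c d) <= 2 * eps * ((b - a) + (d - c)) ^ 2) a b c d Hab Hcd).
    - intros [[[a' b'] c'] d'] Hs Hq.
      rewrite (rect_int_quarter h a' ((a' + b') / 2) b' c' ((c' + d') / 2) d').
      2,3: simpl in Hs; lra. 2: now apply Hsub.
      eapply Rle_trans; [apply Cmod_triangle|].
      eapply Rle_trans; [apply Rplus_le_compat_r, Cmod_triangle|].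
      eapply Rle_trans; [apply Rplus_le_compat_r, Rplus_le_compat_r, Cmod_triangle|].
      assert (Q1 := Hq (a', (a' + b') / 2, c', (c' + d') / 2)).
      assert (Q2 := Hq ((a' + b') / 2, b', c', (c' + d') / 2)).
      assert (Q3 := Hq (a', (a' + b') / 2, (c' + d') / 2, d')).
      assert (Q4 := Hq ((a' + b') / 2, b', (c' + d') / 2, d')).
      simpl quarter in Q1, Q2, Q3, Q4.
      specialize (Q1 ltac:(tauto)). specialize (Q2 ltac:(tauto)).
      specialize (Q3 ltac:(tauto)). specialize (Q4 ltac:(tauto)).
      replace ((a' + b') / 2 - a') with ((b' - a') / 2) in * by field.
      replace (b' - (a' + b') / 2) with ((b' - a') / 2) in * by field.
      replace ((c' + d') / 2 - c') with ((d' - c') / 2) in * by field.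
      replace (d' - (c' + d') / 2) with ((d' - c') / 2) in * by field.
      replace (2 * eps * (b' - a' + (d' - c')) ^ 2) with
        (4 * (2 * eps * ((b' - a') / 2 + (d' - c') / 2) ^ 2)) by field.
      lra.
    - intros x y Hx Hy. destruct (Hh x y Hx Hy) as [l Hl].
      destruct (Hl eps Heps) as [delta [Hd Hw]].
      exists (delta / 2). split; [lra|].
      intros a' b' c' d' Hs Hx' Hy' Wx Wy.
      eapply Rle_trans.
      + apply (rect_int_affine_err h (h (x, y) - l * (x, y)) l a' b' c' d'
                 (eps * ((b' - a') + (d' - c')))); [lra|lra|now apply Hsub|].
        intros u v Hu Hv.
        assert (E : Cmod ((u, v) - (x, y)) <= (b' - a') + (d' - c')).
        { eapply Rle_trans; [apply Cmod_le_Rabs|]. simpl.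
          apply Rplus_le_compat; apply Rabs_le; lra. }
        replace (h (u, v) - (h (x, y) - l * (x, y) + l * (u, v)))%C
          with (h (u, v) - h (x, y) - l * ((u, v) - (x, y)))%C by ring.
        eapply Rle_trans; [apply Hw; lra|]. apply Rmult_le_compat_l; lra.
      + apply Req_le. ring. }
  apply Cmod_eq_0, Rle_antisym; [|apply Cmod_ge_0].
  apply le_epsilon. intros e He. rewrite Rplus_0_l.
  set (W := 2 * ((b - a) + (d - c)) ^ 2 + 1).
  assert (HW : 0 < W) by (unfold W; nra).
  assert (E := Hest (e / W) (Rdiv_lt_0_compat _ _ He HW)).
  eapply Rle_trans; [exact E|].
  apply Rle_trans with (e / W * W); [|apply Req_le; field; lra].
  assert (0 < e / W) by (now apply Rdiv_lt_0_compat).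
  set (t := e / W) in *. unfold W. lra.
Qed.

(** * Mean values on circles *)

Definition cis (v : R) : C := (cos v, sin v).

Lemma cexp_pair (u v : R) : cexp (u, v) = (RtoC (exp u) * cis v)%C.
Proof. unfold cexp, cis, Cmult, RtoC; simpl. f_equal; ring. Qed.

Lemma Cmod_cis (v : R) : Cmod (cis v) = 1.
Proof.
  unfold Cmod, cis; simpl. apply sqrt_lem_1; [nra|lra|].
  assert (H := sin2_cos2 v). unfold Rsqr in H. lra.
Qed.

Lemma pcont_cis (v : R) : pcont cis v.
Proof.
  apply pcont_ext with (fun t => cexp (0 + RtoC t * Ci)%C).
  { intros t. replace (0 + RtoC t * Ci)%C with ((0, t) : C)
      by (unfold Cplus, Cmult, RtoC, Ci; simpl; f_equal; ring).
    rewrite cexp_pair, exp_0. ring. }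
  apply (pcont_comp cexp); [apply (cder_cont _ _ _ (cder_cexp _))|apply pcont_affine].
Qed.

Definition circ (z : C) (rho v : R) : C := (z + RtoC rho * cis v)%C.

Lemma Cmod_circ (z : C) (rho v : R) : 0 <= rho -> Cmod (circ z rho v - z) = rho.
Proof.
  intros H. unfold circ. replace (z + RtoC rho * cis v - z)%C with (RtoC rho * cis v)%C by ring.
  rewrite Cmod_mult, Cmod_cis, Cmod_R, Rabs_right by lra. ring.
Qed.

Lemma pcont_circ (z : C) (rho v : R) : pcont (circ z rho) v.
Proof.
  apply pcont_plus; [apply pcont_const|].
  apply pcont_mult; [apply pcont_const|apply pcont_cis].
Qed.

(* In the coordinate log(w - z) the annulus becomes a rectangle whose two
   horizontal sides cancel by periodicity. *)
Lemma circle_int_invariant (h : C -> C) (z : C) (r1 r2 : R) : 0 < r1 <= r2 ->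
  (forall w, r1 <= Cmod (w - z) <= r2 -> exists l, cder h w l) ->
  CInt (fun v => h (circ z r1 v)) 0 (2 * PI) = CInt (fun v => h (circ z r2 v)) 0 (2 * PI).
Proof.
  intros Hr Hh. assert (HPI := PI_RGT_0).
  set (k := fun w => h (z + cexp w)%C).
  assert (Hexp : ln r1 <= ln r2).
  { destruct (proj2 Hr) as [L|E]; [left; apply ln_increasing; lra|right; now rewrite E]. }
  assert (G : rect_int k (ln r1) (ln r2) 0 (2 * PI) = 0).
  { apply goursat_rect; [exact Hexp|lra|].
    intros x y Hx Hy. destruct (Hh (z + cexp (x, y))%C) as [l Hl].
    - replace (z + cexp (x, y) - z)%C with (cexp (x, y)) by ring. rewrite Cmod_cexp. simpl.
      assert (Em : forall p q, p <= q -> exp p <= exp q).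
      { intros p q [L|E]; [left; now apply exp_increasing|right; now rewrite E]. }
      generalize (Em _ _ (proj1 Hx)) (Em _ _ (proj2 Hx)). rewrite !exp_ln by lra. lra.
    - exists (l * (0 + cexp (x, y)))%C. apply (cder_comp h (fun w => z + cexp w)%C); [exact Hl|].
      apply cder_plus; [apply cder_const|apply cder_cexp]. }
  unfold rect_int in G.
  rewrite (CInt_ext (fun u => k (u, 2 * PI)) (fun u => k (u, 0))) in G.
  2: exact Hexp.
  2:{ intros u _. unfold k.
      rewrite !cexp_pair. unfold cis. rewrite cos_2PI, sin_2PI, cos_0, sin_0. reflexivity. }
  assert (E : forall r, 0 < r -> CInt (fun v => k (ln r, v)) 0 (2 * PI) =
                CInt (fun v => h (circ z r v)) 0 (2 * PI)).
  { intros r Hrr. apply CInt_ext; [lra|]. intros v _. unfold k, circ.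
    rewrite cexp_pair, exp_ln by exact Hrr. reflexivity. }
  rewrite !E in G by lra.
  set (A := CInt (fun u => k (u, 0)) (ln r1) (ln r2)) in G.
  set (I1 := CInt (fun v => h (circ z r1 v)) 0 (2 * PI)) in *.
  set (I2 := CInt (fun v => h (circ z r2 v)) 0 (2 * PI)) in *.
  transitivity (I2 + Ci * (A + Ci * I2 - A - Ci * I1))%C.
  - destruct I1, I2, A. unfold Cminus, Cplus, Copp, Cmult, Ci; simpl. f_equal; ring.
  - rewrite G. ring.
Qed.

(** The radius may shrink without changing the integral, and continuity at the centre gives the
    limit. Differentiability is asked for off the centre only, so that a difference quotient
    completed at z qualifies. *)
Lemma circle_mean (h : C -> C) (z : C) (r : R) : 0 < r -> ccont h z ->
  (forall w, 0 < Cmod (w - z) <= r -> exists l, cder h w l) ->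
  CInt (fun v => h (circ z r v)) 0 (2 * PI) = (RtoC (2 * PI) * h z)%C.
Proof.
  intros Hr Hc Hh. assert (HPI := PI_RGT_0).
  set (I := CInt (fun v => h (circ z r v)) 0 (2 * PI)).
  replace I with ((I - RtoC (2 * PI) * h z) + RtoC (2 * PI) * h z)%C by ring.
  enough (E : Cmod (I - RtoC (2 * PI) * h z) = 0)
    by (apply Cmod_eq_0 in E; rewrite E; ring).
  apply Rle_antisym; [|apply Cmod_ge_0].
  apply le_epsilon. intros e He. rewrite Rplus_0_l.
  destruct (Hc (e / (2 * PI))) as [d [Hd Hw]]; [apply Rdiv_lt_0_compat; lra|].
  set (s := Rmin r (d / 2)).
  assert (Hs : 0 < s) by (apply Rmin_pos; lra).
  assert (Hsr : s <= r) by apply Rmin_l. assert (Hsd : s <= d / 2) by apply Rmin_r.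
  assert (EI : I = CInt (fun v => h (circ z s v)) 0 (2 * PI)).
  { symmetry. apply circle_int_invariant; [lra|]. intros w Bw. apply Hh. lra. }
  rewrite EI.
  assert (IC := is_CInt_const (h z) 0 (2 * PI)). rewrite Rminus_0_r in IC.
  replace e with (e / (2 * PI) * (2 * PI - 0)) by (field; lra).
  eapply is_CInt_bound; [lra| |].
  2:{ apply is_CInt_minus; [|exact IC].
      apply CInt_correct; [lra|]. intros v _. apply pcont_comp; [|apply pcont_circ].
      destruct (Hh (circ z s v)) as [l Hl]; [rewrite Cmod_circ; lra|].
      eapply cder_cont, Hl. }
  intros v _. simpl. apply Rlt_le, Hw. rewrite Cmod_circ; lra.
Qed.


(** * Holomorphic functions on the unit disk *)

Definition hol (h : C -> C) : Prop :=
  forall z, Cmod z < 1 -> exists l, cder h z l.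

Definition disk_cont (h : C -> C) : Prop := forall z, Cmod z < 1 -> ccont h z.

Lemma hol_cder (h : C -> C) (z : C) : hol h -> Cmod z < 1 -> cder h z (C_derive h z).
Proof.
  intros Hh Hz. destruct (Hh z Hz) as [l Hl]. now rewrite (cder_C_derive h z l Hl).
Qed.

Lemma hol_cont (h : C -> C) : hol h -> disk_cont h.
Proof. intros Hh z Hz. destruct (Hh z Hz) as [l Hl]. eapply cder_cont, Hl. Qed.

Lemma holomorphic_on_disk_hol (h : C -> C) : holomorphic_on_disk h <-> hol h.
Proof.
  split; intros H z Hz; destruct (H z Hz) as [l Hl]; exists l.
  - now apply is_derive_cder.
  - now apply cder_is_derive.
Qed.

(** A Lebesgue number for the closed disk, obtained by bisecting an enclosing square; the condition
    is relativised to points of the disk, so rectangles that miss it are good trivially. *)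
Lemma lebesgue_number_disk (r : R) (Q : C -> R -> Prop) :
  (forall z, Cmod z <= r -> exists delta, 0 < delta /\ Q z delta) ->
  exists d, 0 < d /\ forall p, Cmod p <= r ->
    exists z delta, Cmod (p - z) < delta /\ d <= delta /\ Q z delta.
Proof.
  intros HQ.
  set (P := fun s : R * R * R * R => let '(a, b, c, d) := s in
    exists e, 0 < e /\ forall x y, a <= x <= b -> c <= y <= d -> Cmod (x, y) <= r ->
      exists z delta, Cmod ((x, y) - z) < delta /\ e <= delta /\ Q z delta).
  destruct (Rle_or_lt 0 r) as [Hr|Hr].
  2:{ exists 1. split; [lra|]. intros p Hp. generalize (Cmod_ge_0 p). lra. }
  assert (H : P (- r, r, - r, r)).
  { apply rect_induction; [lra|lra| |].
    - intros [[[a b] c] d] Hs Hq. simpl in Hs.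
      destruct (Hq (a, (a + b) / 2, c, (c + d) / 2)) as [e1 [He1 H1]]; [simpl; tauto|].
      destruct (Hq ((a + b) / 2, b, c, (c + d) / 2)) as [e2 [He2 H2]]; [simpl; tauto|].
      destruct (Hq (a, (a + b) / 2, (c + d) / 2, d)) as [e3 [He3 H3]]; [simpl; tauto|].
      destruct (Hq ((a + b) / 2, b, (c + d) / 2, d)) as [e4 [He4 H4]]; [simpl; tauto|].
      exists (Rmin (Rmin e1 e2) (Rmin e3 e4)). split; [repeat apply Rmin_pos; assumption|].
      intros x y Hx Hy Hm.
      assert (L1 := Rmin_l (Rmin e1 e2) (Rmin e3 e4)).
      assert (L2 := Rmin_r (Rmin e1 e2) (Rmin e3 e4)).
      assert (L3 := Rmin_l e1 e2). assert (L4 := Rmin_r e1 e2).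
      assert (L5 := Rmin_l e3 e4). assert (L6 := Rmin_r e3 e4).
      destruct (Rle_or_lt x ((a + b) / 2)), (Rle_or_lt y ((c + d) / 2));
        [destruct (H1 x y) as [z [dl Hz]]|destruct (H3 x y) as [z [dl Hz]]
        |destruct (H2 x y) as [z [dl Hz]]|destruct (H4 x y) as [z [dl Hz]]];
        try lra; exists z, dl; intuition lra.
    - intros x y _ _. destruct (Rle_or_lt (Cmod (x, y)) r) as [Hm|Hm].
      + destruct (HQ _ Hm) as [dl [Hdl Hz]]. exists (dl / 2). split; [lra|].
        intros a b c d _ Hx Hy Wx Wy. exists dl. split; [exact Hdl|].
        intros u v Hu Hv _. exists (x, y), dl. split; [|split; [lra|exact Hz]].
        eapply Rle_lt_trans; [apply Cmod_le_Rabs|]. simpl.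
        assert (Rabs (u + - x) < dl / 2) by (apply Rabs_def1; lra).
        assert (Rabs (v + - y) < dl / 2) by (apply Rabs_def1; lra). lra.
      (* Small rectangles around a point outside the disk do not meet the disk. *)
      + set (dl := Cmod (x, y) - r). exists (dl / 2). split; [unfold dl; lra|].
        intros a b c d _ Hx Hy Wx Wy. exists 1. split; [lra|].
        intros u v Hu Hv Huv. exfalso.
        assert (E := Cmod_triangle_inv (x, y) (u, v)).
        assert (F := Cmod_le_Rabs (x + - u) (y + - v)).
        change (Cmod ((x, y) - (u, v)) <= Rabs (x + - u) + Rabs (y + - v)) in F.
        assert (Rabs (x + - u) < dl / 2) by (apply Rabs_def1; lra).
        assert (Rabs (y + - v) < dl / 2) by (apply Rabs_def1; lra).
        unfold dl in *. lra. }
  destruct H as [e [He H]]. exists e. split; [exact He|].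
  intros [x y] Hp. apply H; [| |exact Hp]; apply Rabs_le_between.
  - eapply Rle_trans; [apply Rabs_le_Cmod_l|exact Hp].
  - eapply Rle_trans; [apply Rabs_le_Cmod_r|exact Hp].
Qed.

Lemma disk_unif_cont (h : C -> C) (r eps : R) : r < 1 -> 0 < eps -> disk_cont h ->
  exists d, 0 < d /\ forall p w, Cmod p <= r -> Cmod (w - p) < d -> Cmod (h w - h p) < eps.
Proof.
  intros Hr Heps Hh.
  (* The radius 2 dl leaves room for w, which is within d <= dl of p. *)
  destruct (lebesgue_number_disk r (fun z dl =>
    forall w, Cmod (w - z) < 2 * dl -> Cmod (h w - h z) < eps / 2)) as [d [Hd H]].
  - intros z Hz. destruct (Hh z) with (eps := eps / 2) as [d [Hd Hw]]; [lra|lra|].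
    exists (d / 2). split; [lra|]. intros w Bw. apply Hw. lra.
  - exists d. split; [exact Hd|]. intros p w Hp Hw.
    destruct (H p Hp) as [z [dl [H1 [H2 H3]]]].
    replace (h w - h p)%C with ((h w - h z) - (h p - h z))%C by ring.
    eapply Rle_lt_trans; [apply Cmod_minus_le|].
    assert (Cmod (h p - h z) < eps / 2).
    { apply H3. generalize (Cmod_ge_0 (p - z)). lra. }
    assert (Cmod (h w - h z) < eps / 2); [|lra].
    apply H3. replace (w - z)%C with ((w - p) + (p - z))%C by ring.
    eapply Rle_lt_trans; [apply Cmod_triangle|]. lra.
Qed.

Lemma Cmod_near (z w : C) (d : R) : Cmod (w - z) < d -> Cmod w < Cmod z + d.
Proof. intros H. generalize (Cmod_triangle_inv w z). lra. Qed.

Lemma Cinv_cis (v : R) : (/ cis v)%C = cis (- v).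
Proof.
  assert (N : cis v <> 0) by (apply Cmod_gt_0; rewrite Cmod_cis; lra).
  assert (E : (cis v * cis (- v))%C = 1).
  { assert (H := sin2_cos2 v). unfold Rsqr in H.
    unfold cis, Cmult, RtoC; simpl. rewrite cos_neg, sin_neg. f_equal; lra. }
  replace (cis (- v)) with (cis v * cis (- v) / cis v)%C by (field; exact N).
  rewrite E. field. exact N.
Qed.

Lemma pcont_cis_opp (v : R) : pcont (fun t => cis (- t)) v.
Proof.
  apply pcont_ext with (fun t => / cis t)%C; [exact Cinv_cis|].
  apply (pcont_comp (fun w => / w)%C cis v); [|apply pcont_cis].
  eapply cder_cont, cder_inv, Cmod_gt_0. rewrite Cmod_cis. lra.
Qed.

(** The integrand of Cauchy's formula for h'(w). Subtracting h w turns it into a difference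
    quotient, whose circle mean is already known. *)
Definition dker (h : C -> C) (rho : R) (w : C) (v : R) : C :=
  (/ RtoC (2 * PI * rho) * ((h (circ w rho v) - h w) * cis (- v)))%C.

(** The difference quotient of h at w, completed by h'(w), is continuous at w and differentiable
    elsewhere, so [circle_mean] computes its mean. *)
Lemma C_derive_circle (h : C -> C) (w : C) (rho : R) : hol h -> 0 < rho ->
  Cmod w + rho < 1 -> C_derive h w = CInt (dker h rho w) 0 (2 * PI).
Proof.
  intros Hh Hrho Hw. assert (HPI := PI_RGT_0).
  assert (Hw1 : Cmod w < 1) by lra.
  assert (Hd := hol_cder h w Hh Hw1). set (l := C_derive h w) in *.
  set (g := fun z => if Ceq_dec z w then l else ((h z - h w) / (z - w))%C).
  assert (M : CInt (fun v => g (circ w rho v)) 0 (2 * PI) = (RtoC (2 * PI) * g w)%C).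
  { apply circle_mean; [exact Hrho| |].
    - intros eps Heps. destruct (Hd (eps / 2)) as [d [Hd0 H]]; [lra|].
      exists d. split; [exact Hd0|]. intros z Bz. unfold g.
      destruct (Ceq_dec w w) as [_|N]; [|now elim N].
      destruct (Ceq_dec z w) as [_|N].
      { replace (l - l)%C with (RtoC 0) by ring. rewrite Cmod_0. exact Heps. }
      assert (N' : (z - w)%C <> 0).
      { intros E. apply N. replace z with ((z - w) + w)%C by ring. rewrite E. ring. }
      replace ((h z - h w) / (z - w) - l)%C with
        ((h z - h w - l * (z - w)) / (z - w))%C by (field; exact N').
      rewrite Cmod_div by exact N'.
      assert (K := proj1 (Cmod_gt_0 _) N').
      apply Rle_lt_trans with (eps / 2); [|lra].
      apply Rmult_le_reg_r with (Cmod (z - w)); [exact K|].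
      unfold Rdiv at 1. rewrite Rmult_assoc, Rinv_l, Rmult_1_r by lra. now apply H.
    - intros z Hz. exists ((C_derive h z * (z - w) - (h z - h w)) / ((z - w) * (z - w)))%C.
      assert (N : (z - w)%C <> 0) by (apply Cmod_gt_0; lra).
      apply (cder_ext_loc (fun z => (h z - h w) / (z - w))%C g z _ (Cmod (z - w))); [lra| |].
      + intros u Bu. unfold g. destruct (Ceq_dec u w) as [E|_]; [|reflexivity].
        exfalso. subst u. rewrite Cmod_minus_sym in Bu. lra.
      + eapply cder_eq; [|apply (cder_div (fun z => h z - h w)%C (fun z => z - w)%C z
           (C_derive h z - 0) (1 - 0)); [exact N| |]].
        * f_equal. ring.
        * apply cder_minus; [|apply cder_const]. apply hol_cder; [exact Hh|].
          generalize (Cmod_triangle_inv z w). lra.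
        * apply cder_minus; [apply cder_id|apply cder_const]. }
  unfold g at 2 in M. destruct (Ceq_dec w w) as [_|N]; [|now elim N].
  assert (N2 : RtoC (2 * PI) <> 0) by (intros E; apply RtoC_inj in E; lra).
  assert (Nr : RtoC rho <> 0) by (intros E; apply RtoC_inj in E; lra).
  replace l with (/ RtoC (2 * PI) * (RtoC (2 * PI) * l))%C by (field; exact N2).
  rewrite <- M. symmetry. apply is_CInt_unique.
  eapply is_CInt_ext; [lra| |apply is_CInt_scal, CInt_correct; [lra|]].
  - intros v _. unfold dker, g.
    destruct (Ceq_dec (circ w rho v) w) as [E|_].
    { exfalso. assert (K := Cmod_circ w rho v (Rlt_le _ _ Hrho)). rewrite E in K.
      replace (w - w)%C with (RtoC 0) in K by ring. rewrite Cmod_0 in K. lra. }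
    rewrite <- Cinv_cis, (RtoC_mult (2 * PI) rho).
    replace (circ w rho v - w)%C with (RtoC rho * cis v)%C by (unfold circ; ring).
    field. repeat split; [|exact Nr|exact N2].
    apply Cmod_gt_0. rewrite Cmod_cis. lra.
  - intros v _.
    apply pcont_ext with (fun v => (h (circ w rho v) - h w) * (/ RtoC rho * cis (- v)))%C.
    + intros t. unfold g. destruct (Ceq_dec (circ w rho t) w) as [E|_].
      { exfalso. assert (K := Cmod_circ w rho t (Rlt_le _ _ Hrho)). rewrite E in K.
        replace (w - w)%C with (RtoC 0) in K by ring. rewrite Cmod_0 in K. lra. }
      rewrite <- Cinv_cis.
      replace (circ w rho t - w)%C with (RtoC rho * cis t)%C by (unfold circ; ring).
      field. split; [|exact Nr]. apply Cmod_gt_0. rewrite Cmod_cis. lra.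
    + apply pcont_mult.
      * apply pcont_plus; [|apply pcont_const]. apply pcont_comp; [|apply pcont_circ].
        apply hol_cont; [exact Hh|]. assert (K := Cmod_circ w rho v (Rlt_le _ _ Hrho)).
        generalize (Cmod_triangle_inv (circ w rho v) w). lra.
      * apply pcont_mult; [apply pcont_const|apply pcont_cis_opp].
Qed.

Lemma Cmod_circ_lt (w : C) (rho v : R) : 0 < rho -> Cmod w + rho < 1 ->
  Cmod (circ w rho v) < 1.
Proof.
  intros Hr Hw. assert (K := Cmod_circ w rho v (Rlt_le _ _ Hr)).
  generalize (Cmod_triangle_inv (circ w rho v) w). lra.
Qed.

Lemma pcont_dker (h : C -> C) (rho : R) (w : C) : disk_cont h -> 0 < rho ->
  Cmod w + rho < 1 -> pcont_on (dker h rho w) 0 (2 * PI).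
Proof.
  intros Hh Hr Hw v _. unfold dker. apply pcont_mult; [apply pcont_const|].
  apply pcont_mult; [|apply pcont_cis_opp].
  apply pcont_plus; [|apply pcont_const]. apply pcont_comp; [|apply pcont_circ].
  apply Hh, Cmod_circ_lt; assumption.
Qed.

Lemma hol_C_derive_cont (h : C -> C) : hol h -> disk_cont (C_derive h).
Proof.
  intros Hh z Hz eps Heps. assert (HPI := PI_RGT_0).
  (* A third of the distance to the unit circle: circles of radius rho around any w with |w - z| <
     rho stay in the disk, so one radius serves for all these w. *)
  set (rho := (1 - Cmod z) / 3). assert (Hrho : 0 < rho) by (unfold rho; lra).
  assert (Kz := Cmod_ge_0 z).
  destruct (disk_unif_cont h (Cmod z + rho) (eps * rho / 3)) as [d [Hd H]].
  { unfold rho; lra. }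
  { apply Rdiv_lt_0_compat; [|lra]. now apply Rmult_lt_0_compat. }
  { now apply hol_cont. }
  exists (Rmin rho d). split; [now apply Rmin_pos|].
  intros w Bw. apply Rmin_Rgt_l in Bw. destruct Bw as [B1 B2].
  assert (Hw := Cmod_near _ _ _ B1).
  assert (Hzr : Cmod z + rho < 1) by (unfold rho; lra).
  assert (Hwr : Cmod w + rho < 1) by (unfold rho in *; lra).
  rewrite (C_derive_circle h z rho), (C_derive_circle h w rho) by assumption.
  assert (I := is_CInt_minus _ _ _ _ _ _
    (CInt_correct _ 0 (2 * PI) ltac:(lra) (pcont_dker h rho w (hol_cont h Hh) Hrho Hwr))
    (CInt_correct _ 0 (2 * PI) ltac:(lra) (pcont_dker h rho z (hol_cont h Hh) Hrho Hzr))).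
  assert (H2PI : 0 <= 2 * PI) by lra.
  apply Rle_lt_trans with (2 * (eps * rho / 3) / (2 * PI * rho) * (2 * PI - 0)).
  - refine (is_CInt_bound _ 0 (2 * PI) _ _ H2PI _ I).
    intros v _. unfold dker.
    replace (/ RtoC (2 * PI * rho) * ((h (circ w rho v) - h w) * cis (- v)) -
             / RtoC (2 * PI * rho) * ((h (circ z rho v) - h z) * cis (- v)))%C with
      (/ RtoC (2 * PI * rho) * (((h (circ w rho v) - h (circ z rho v)) - (h w - h z)) * cis (- v)))%C
      by ring.
    assert (Hp : 0 < 2 * PI * rho) by (apply Rmult_lt_0_compat; lra).
    rewrite !Cmod_mult, Cmod_cis, Rmult_1_r, Cmod_inv, Cmod_R, Rabs_right;
      [|lra|intros E; apply RtoC_inj in E; lra].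
    rewrite Rmult_comm. unfold Rdiv at 2. apply Rmult_le_compat_r.
    { apply Rlt_le, Rinv_0_lt_compat, Hp. }
    eapply Rle_trans; [apply Cmod_minus_le|].
    assert (Cmod (h (circ w rho v) - h (circ z rho v)) < eps * rho / 3).
    { apply H.
      - assert (K := Cmod_circ z rho v (Rlt_le _ _ Hrho)).
        generalize (Cmod_triangle_inv (circ z rho v) z). lra.
      - unfold circ.
        replace (w + RtoC rho * cis v - (z + RtoC rho * cis v))%C with (w - z)%C by ring.
        exact B2. }
    assert (Cmod (h w - h z) < eps * rho / 3) by (apply H; [lra|exact B2]).
    lra.
  - replace (2 * (eps * rho / 3) / (2 * PI * rho) * (2 * PI - 0)) with (2 / 3 * eps)
      by (field; split; lra). lra.
Qed.

(** Integrate h' - h'(p) along the segment from p to w, which lies in the disk by convexity. *)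
Lemma hol_increment (h : C -> C) (p w : C) (r eps : R) : hol h -> r < 1 ->
  Cmod p <= r -> Cmod w <= r ->
  (forall t, 0 <= t <= 1 -> Cmod (C_derive h (p + RtoC t * (w - p))%C - C_derive h p) <= eps) ->
  Cmod (h w - h p - C_derive h p * (w - p)) <= eps * Cmod (w - p).
Proof.
  intros Hh Hr Hp Hw Heps.
  assert (Hseg : forall t, 0 <= t <= 1 -> Cmod (p + RtoC t * (w - p)) < 1).
  { intros t Ht. replace (p + RtoC t * (w - p))%C with (RtoC (1 - t) * p + RtoC t * w)%C
      by (rewrite RtoC_minus; ring).
    eapply Rle_lt_trans; [apply Cmod_triangle|].
    rewrite !Cmod_mult, !Cmod_R, !Rabs_right by lra. nra. }
  assert (I : is_CInt (fun t => C_derive h (p + RtoC t * (w - p)) * (w - p))%C 0 1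
                (h (p + RtoC 1 * (w - p)) - h (p + RtoC 0 * (w - p)))%C).
  { apply (is_CInt_FTC (fun t => h (p + RtoC t * (w - p))%C)); [lra| |].
    - intros t Ht. apply (pder_comp_cder h (fun t => p + RtoC t * (w - p))%C).
      + apply hol_cder; [exact Hh|now apply Hseg].
      + apply pder_affine.
    - intros t Ht. apply pcont_mult; [|apply pcont_const].
      apply (pcont_comp (C_derive h)); [|apply pcont_affine].
      apply hol_C_derive_cont; [exact Hh|now apply Hseg]. }
  assert (J := is_CInt_minus _ _ _ _ _ _ I (is_CInt_const (C_derive h p * (w - p)) 0 1)).
  replace (p + RtoC 1 * (w - p))%C with w in J by ring.
  replace (p + RtoC 0 * (w - p))%C with p in J by ring.
  rewrite Rminus_0_r, Cmult_1_l in J.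
  replace (eps * Cmod (w - p)) with (eps * Cmod (w - p) * (1 - 0)) by ring.
  refine (is_CInt_bound _ 0 1 _ _ Rle_0_1 _ J).
  intros t Ht. simpl.
  replace (C_derive h (p + RtoC t * (w - p)) * (w - p) - C_derive h p * (w - p))%C with
    ((C_derive h (p + RtoC t * (w - p)) - C_derive h p) * (w - p))%C by ring.
  rewrite Cmod_mult. apply Rmult_le_compat_r; [apply Cmod_ge_0|now apply Heps].
Qed.

(** Uniformity in p is what differentiation under the integral sign asks for. *)
Lemma hol_unif_diff (h : C -> C) (r eps : R) : hol h -> r < 1 -> 0 < eps ->
  exists d, 0 < d /\ forall p w, Cmod p <= r -> Cmod (w - p) < d ->
    Cmod (h w - h p - C_derive h p * (w - p)) <= eps * Cmod (w - p).
Proof.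
  intros Hh Hr Heps.
  destruct (disk_unif_cont (C_derive h) r eps) as [d [Hd H]];
    [lra|exact Heps|now apply hol_C_derive_cont|].
  exists (Rmin d ((1 - r) / 2)). split; [apply Rmin_pos; lra|].
  intros p w Hp Bw. apply Rmin_Rgt_l in Bw. destruct Bw as [B1 B2].
  apply (hol_increment h p w ((1 + r) / 2)); [exact Hh|lra|lra| |].
  - generalize (Cmod_near _ _ _ B2). lra.
  - intros t Ht. apply Rlt_le, H; [exact Hp|].
    replace (p + RtoC t * (w - p) - p)%C with (RtoC t * (w - p))%C by ring.
    rewrite Cmod_mult, Cmod_R, Rabs_right by lra.
    assert (K := Cmod_ge_0 (w - p)). nra.
Qed.

Lemma cder_CInt (K : C -> R -> C) (D : R -> C) (a b : R) (z : C) : a < b ->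
  (forall eps, 0 < eps -> exists d, 0 < d /\ forall w, Cmod (w - z) < d ->
     forall t, a <= t <= b -> Cmod (K w t - K z t - D t * (w - z)) <= eps * Cmod (w - z)) ->
  (exists d, 0 < d /\ forall w, Cmod (w - z) < d -> pcont_on (K w) a b) ->
  pcont_on D a b ->
  cder (fun w => CInt (K w) a b) z (CInt D a b).
Proof.
  intros Hab HK [d0 [Hd0 H0]] HD eps Heps.
  destruct (HK (eps / (b - a))) as [d [Hd H]]; [apply Rdiv_lt_0_compat; lra|].
  exists (Rmin d0 d). split; [now apply Rmin_pos|].
  intros w Bw. apply Rmin_Rgt_l in Bw. destruct Bw as [B1 B2].
  assert (Hz : pcont_on (K z) a b).
  { apply H0. replace (z - z)%C with (RtoC 0) by ring. now rewrite Cmod_0. }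
  assert (I := is_CInt_minus _ _ _ _ _ _
    (is_CInt_minus _ _ _ _ _ _ (CInt_correct _ a b (Rlt_le _ _ Hab) (H0 w B1))
       (CInt_correct _ a b (Rlt_le _ _ Hab) Hz))
    (is_CInt_scal (w - z) _ _ _ _ (CInt_correct _ a b (Rlt_le _ _ Hab) HD))).
  rewrite (Cmult_comm (CInt D a b)).
  replace (eps * Cmod (w - z)) with (eps / (b - a) * Cmod (w - z) * (b - a)) by (field; lra).
  refine (is_CInt_bound _ a b _ _ (Rlt_le _ _ Hab) _ I).
  intros t Ht. simpl. rewrite (Cmult_comm (w - z)). now apply H.
Qed.

(** Near z, Cauchy's formula with a fixed radius represents h'. Differentiating it under the
    integral sign gives the same kernel with h' in place of h. *)
Lemma hol_C_derive (h : C -> C) : hol h -> hol (C_derive h).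
Proof.
  intros Hh z Hz. assert (HPI := PI_RGT_0).
  set (rho := (1 - Cmod z) / 3). assert (Hrho : 0 < rho) by (unfold rho; lra).
  assert (Kz := Cmod_ge_0 z).
  exists (CInt (dker (C_derive h) rho z) 0 (2 * PI)).
  apply (cder_ext_loc (fun w => CInt (dker h rho w) 0 (2 * PI)) _ _ _ rho Hrho).
  { intros w Bw. symmetry. apply C_derive_circle; [exact Hh|exact Hrho|].
    generalize (Cmod_near _ _ _ Bw). unfold rho; lra. }
  apply cder_CInt; [lra| | |].
  - intros eps Heps.
    destruct (hol_unif_diff h (Cmod z + rho) (eps * (2 * PI * rho) / 2)) as [d [Hd H]].
    { exact Hh. } { unfold rho; lra. }
    { assert (0 < PI * rho) by (apply Rmult_lt_0_compat; lra). nra. }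
    exists d. split; [exact Hd|]. intros w Bw v _. unfold dker.
    replace (/ RtoC (2 * PI * rho) * ((h (circ w rho v) - h w) * cis (- v)) -
       / RtoC (2 * PI * rho) * ((h (circ z rho v) - h z) * cis (- v)) -
       / RtoC (2 * PI * rho) * ((C_derive h (circ z rho v) - C_derive h z) * cis (- v)) * (w - z))%C
      with (/ RtoC (2 * PI * rho) * (((h (circ w rho v) - h (circ z rho v)
         - C_derive h (circ z rho v) * (circ w rho v - circ z rho v))
         - (h w - h z - C_derive h z * (w - z))) * cis (- v)))%C
      by (replace (circ w rho v - circ z rho v)%C with (w - z)%C by (unfold circ; ring); ring).
    assert (Hp : 0 < 2 * PI * rho) by (apply Rmult_lt_0_compat; lra).
    rewrite !Cmod_mult, Cmod_cis, Rmult_1_r, Cmod_inv, Cmod_R, Rabs_right;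
      [|lra|intros E; apply RtoC_inj in E; lra].
    apply Rmult_le_reg_l with (1 := Hp). rewrite <- Rmult_assoc, Rinv_r, Rmult_1_l by lra.
    eapply Rle_trans; [apply Cmod_minus_le|].
    assert (E : (circ w rho v - circ z rho v)%C = (w - z)%C) by (unfold circ; ring).
    assert (H1 := H (circ z rho v) (circ w rho v)). rewrite E in H1.
    assert (H2 := H z w).
    assert (K := Cmod_circ z rho v (Rlt_le _ _ Hrho)).
    assert (K2 := Cmod_triangle_inv (circ z rho v) z).
    specialize (H1 ltac:(lra) Bw). specialize (H2 ltac:(lra) Bw). rewrite E. lra.
  - exists rho. split; [exact Hrho|]. intros w Bw. apply pcont_dker; [now apply hol_cont|exact Hrho|].
    generalize (Cmod_near _ _ _ Bw). unfold rho; lra.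
  - apply pcont_dker; [now apply hol_C_derive_cont|exact Hrho|]. unfold rho; lra.
Qed.


Lemma hol_const (c : C) : hol (fun _ => c).
Proof. intros z _. exists 0. apply cder_const. Qed.

Lemma hol_id : hol (fun z => z).
Proof. intros z _. exists 1. apply cder_id. Qed.

Lemma hol_plus (f g : C -> C) : hol f -> hol g -> hol (fun z => f z + g z)%C.
Proof.
  intros Hf Hg z Hz. destruct (Hf z Hz) as [a Ha], (Hg z Hz) as [b Hb].
  exists (a + b)%C. now apply cder_plus.
Qed.

Lemma hol_minus (f g : C -> C) : hol f -> hol g -> hol (fun z => f z - g z)%C.
Proof.
  intros Hf Hg z Hz. destruct (Hf z Hz) as [a Ha], (Hg z Hz) as [b Hb].
  exists (a - b)%C. now apply cder_minus.
Qed.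

Lemma hol_mult (f g : C -> C) : hol f -> hol g -> hol (fun z => f z * g z)%C.
Proof.
  intros Hf Hg z Hz. destruct (Hf z Hz) as [a Ha], (Hg z Hz) as [b Hb].
  exists (a * g z + f z * b)%C. now apply cder_mult.
Qed.

Lemma hol_div (f g : C -> C) : hol f -> hol g ->
  (forall z, Cmod z < 1 -> g z <> 0) -> hol (fun z => f z / g z)%C.
Proof.
  intros Hf Hg N z Hz. destruct (Hf z Hz) as [a Ha], (Hg z Hz) as [b Hb].
  exists ((a * g z - f z * b) / (g z * g z))%C. apply cder_div; auto.
Qed.

Lemma hol_comp (f g : C -> C) : hol f -> hol g ->
  (forall z, Cmod z < 1 -> Cmod (g z) < 1) -> hol (fun z => f (g z)).
Proof.
  intros Hf Hg Hr z Hz. destruct (Hf _ (Hr z Hz)) as [a Ha], (Hg z Hz) as [b Hb].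
  exists (a * b)%C. now apply cder_comp.
Qed.

Lemma disk_nbhd (z : C) : Cmod z < 1 ->
  exists d, 0 < d /\ forall w, Cmod (w - z) < d -> Cmod w < 1.
Proof.
  intros Hz. exists (1 - Cmod z). split; [lra|]. intros w Hw.
  generalize (Cmod_near _ _ _ Hw). lra.
Qed.

Lemma hol_ext (f g : C -> C) : (forall z, Cmod z < 1 -> f z = g z) -> hol f -> hol g.
Proof.
  intros E Hf z Hz. destruct (Hf z Hz) as [l Hl]. exists l.
  destruct (disk_nbhd z Hz) as [d [Hd Hw]].
  apply (cder_ext_loc f g z l d Hd); [|exact Hl]. auto.
Qed.

Lemma C_derive_ext_disk (f g : C -> C) (z : C) : hol f ->
  (forall w, Cmod w < 1 -> f w = g w) -> Cmod z < 1 -> C_derive g z = C_derive f z.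
Proof.
  intros Hf E Hz. apply cder_C_derive.
  destruct (disk_nbhd z Hz) as [d [Hd Hw]].
  apply (cder_ext_loc f g z _ d Hd); [auto|]. now apply hol_cder.
Qed.

Lemma Cmod_0_lt_1 : Cmod 0 < 1.
Proof. rewrite Cmod_0. lra. Qed.

(** The backward shift on Taylor series: drop the constant term and divide by z. *)
Definition divz (h : C -> C) (z : C) : C :=
  if Ceq_dec z 0 then C_derive h 0 else ((h z - h (RtoC 0)) / z)%C.

Lemma divz_0 (h : C -> C) : divz h 0 = C_derive h 0.
Proof. unfold divz. destruct (Ceq_dec 0 0) as [_|N]; [reflexivity|now elim N]. Qed.

Lemma divz_neq_0 (h : C -> C) (z : C) : z <> 0 -> divz h z = ((h z - h (RtoC 0)) / z)%C.
Proof. intros N. unfold divz. now destruct (Ceq_dec z 0). Qed.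

Lemma divz_spec (h : C -> C) (z : C) : h z = (h (RtoC 0) + z * divz h z)%C.
Proof.
  unfold divz. destruct (Ceq_dec z 0) as [->|N]; [ring|]. field. exact N.
Qed.

(** Only the origin is delicate. With m = h''(0), the derivative of h - h'(0) z - (m/2) z^2 is at
    most eps |z| near 0, so that function varies by at most eps |z|^2, and the quotient has
    derivative m/2 at 0. *)
Lemma hol_divz (h : C -> C) : hol h -> hol (divz h).
Proof.
  intros Hh z Hz. destruct (Ceq_dec z 0) as [->|N].
  - destruct (hol_C_derive h Hh 0 Cmod_0_lt_1) as [m Hm].
    set (n := (RtoC (/ 2) * m)%C).
    assert (Hn : m = (n + n)%C)
      by (unfold n; destruct m; unfold Cplus, Cmult, RtoC; simpl; f_equal; field).
    exists n. intros eps Heps.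
    set (k := fun z => (h z - C_derive h 0 * z - n * (z * z))%C).
    assert (Dk : forall z, Cmod z < 1 -> cder k z (C_derive h z - C_derive h 0 - m * z)).
    { intros w Hw. eapply cder_eq; [|apply cder_minus; [apply cder_minus; [apply hol_cder; assumption
        |apply cder_scal, cder_id]|apply cder_scal, cder_mult; apply cder_id]].
      rewrite Hn. ring. }
    destruct (Hm eps Heps) as [d [Hd H]].
    exists (Rmin d (/ 2)). split; [apply Rmin_pos; lra|].
    intros w Bw. apply Rmin_Rgt_l in Bw. destruct Bw as [B1 B2].
    replace (w - 0)%C with w in * by ring.
    assert (Hk : hol k) by (intros u Hu; eexists; now apply Dk).
    assert (I := hol_increment k 0 w (/ 2) (eps * Cmod w) Hk ltac:(lra)
                   ltac:(rewrite Cmod_0; lra) ltac:(lra)).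
    replace (w - 0)%C with w in * by ring.
    rewrite (cder_C_derive k 0 _ (Dk 0 Cmod_0_lt_1)) in I.
    destruct (Ceq_dec w 0) as [->|Nw].
    { replace (divz h 0 - divz h 0 - n * 0)%C with (RtoC 0) by ring.
      rewrite Cmod_0. lra. }
    rewrite (divz_neq_0 h w Nw), divz_0.
    assert (K := proj1 (Cmod_gt_0 w) Nw).
    replace ((h w - h (RtoC 0)) / w - C_derive h 0 - n * w)%C with
      ((k w - k (RtoC 0) - (C_derive h 0 - C_derive h 0 - m * 0) * w) / w)%C.
    2:{ unfold k. rewrite Hn. field. exact Nw. }
    rewrite Cmod_div by exact Nw.
    apply Rmult_le_reg_r with (Cmod w); [exact K|].
    unfold Rdiv at 1. rewrite Rmult_assoc, Rinv_l, Rmult_1_r by lra.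
    apply I. intros t Ht.
    replace (0 + RtoC t * w)%C with (RtoC t * w)%C by ring.
    assert (Kt : Cmod (RtoC t * w) <= Cmod w).
    { rewrite Cmod_mult, Cmod_R, Rabs_right by lra. nra. }
    rewrite (cder_C_derive k _ _ (Dk (RtoC t * w)%C ltac:(lra))).
    specialize (H (RtoC t * w)%C).
    replace (RtoC t * w - 0)%C with (RtoC t * w)%C in H by ring.
    specialize (H ltac:(lra)).
    replace (C_derive h (RtoC t * w) - C_derive h 0 - m * (RtoC t * w)
             - (C_derive h 0 - C_derive h 0 - m * 0))%C with
      (C_derive h (RtoC t * w) - C_derive h 0 - m * (RtoC t * w))%C by ring.
    eapply Rle_trans; [exact H|]. apply Rmult_le_compat_l; lra.
  - destruct (Hh z Hz) as [l Hl].
    exists (((l - 0) * z - (h z - h (RtoC 0)) * 1) / (z * z))%C.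
    apply (cder_ext_loc (fun z => (h z - h (RtoC 0)) / z)%C _ z _ (Cmod z)).
    + now apply Cmod_gt_0.
    + intros w Bw. symmetry. apply divz_neq_0. intros ->.
      replace (0 - z)%C with (- z)%C in Bw by ring. rewrite Cmod_opp in Bw. lra.
    + apply (cder_div (fun z => h z - h (RtoC 0))%C (fun z => z)); [exact N| |apply cder_id].
      apply cder_minus; [exact Hl|apply cder_const].
Qed.

(** At 0 the product rule applied to a + z g gives g 0. The coefficient rules below all reduce to
    exhibiting such a g. *)
Lemma divz_unique (h g : C -> C) (a : C) : hol g ->
  (forall z, Cmod z < 1 -> h z = a + z * g z)%C ->
  forall z, Cmod z < 1 -> divz h z = g z.
Proof.
  intros Hg E z Hz.
  assert (E0 : h (RtoC 0) = a) by (rewrite E by apply Cmod_0_lt_1; ring).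
  destruct (Ceq_dec z 0) as [->|N].
  - rewrite divz_0. apply cder_C_derive.
    apply (cder_ext_loc (fun z => a + z * g z)%C _ 0 _ 1 Rlt_0_1).
    + intros w Bw. symmetry. apply E. replace (w - 0)%C with w in Bw by ring. exact Bw.
    + destruct (Hg 0 Cmod_0_lt_1) as [l Hl].
      apply cder_eq with (0 + (1 * g (RtoC 0) + 0 * l))%C; [ring|].
      apply cder_plus; [apply cder_const|]. apply (cder_mult (fun z => z) g); [apply cder_id|exact Hl].
  - rewrite divz_neq_0 by exact N. rewrite E, E0 by exact Hz. field. exact N.
Qed.

(** * The maximum principle *)

Lemma mean_bound (k : C -> C) (rho M : R) : hol k -> 0 < rho < 1 ->
  (forall z, Cmod z = rho -> Cmod (k z) <= M) -> Cmod (k (RtoC 0)) <= M.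
Proof.
  intros Hk Hrho HM. assert (HPI := PI_RGT_0).
  assert (I : is_CInt (fun v => k (circ 0 rho v)) 0 (2 * PI) (RtoC (2 * PI) * k (RtoC 0))).
  { rewrite <- (circle_mean k 0 rho); [|lra|apply hol_cont; [exact Hk|apply Cmod_0_lt_1]|].
    - apply CInt_correct; [lra|]. intros v _. apply pcont_comp; [|apply pcont_circ].
      apply hol_cont; [exact Hk|]. apply Cmod_circ_lt; [lra|rewrite Cmod_0; lra].
    - intros w Hw. replace (w - 0)%C with w in Hw by ring. apply Hk. lra. }
  apply (is_CInt_bound _ _ _ M) in I; [|lra|].
  - rewrite Cmod_mult, Cmod_R, Rabs_right in I by lra.
    apply Rmult_le_reg_l with (2 * PI); lra.
  - intros v _. apply HM.
    assert (K := Cmod_circ 0 rho v ltac:(lra)).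
    replace (circ 0 rho v - 0)%C with (circ 0 rho v) in K by ring. exact K.
Qed.

Lemma Cmod_sqr (z : C) : Cmod z * Cmod z = Re z * Re z + Im z * Im z.
Proof. assert (H := Cmod2_alt z). simpl in H. lra. Qed.

Lemma moebius_identity (z w : C) :
  Cmod (1 + Cconj w * z) * Cmod (1 + Cconj w * z) - Cmod (z + w) * Cmod (z + w) =
  (1 - Cmod z * Cmod z) * (1 - Cmod w * Cmod w).
Proof. rewrite !Cmod_sqr. destruct z, w; simpl. ring. Qed.

Lemma moebius_den_bound (z w : C) :
  1 - Cmod w * Cmod z <= Cmod (1 + Cconj w * z).
Proof.
  assert (H := Cmod_triangle_inv 1 (- (Cconj w * z))).
  rewrite Cmod_1, Cmod_opp, Cmod_mult, Cmod_conj in H.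
  replace (1 - - (Cconj w * z))%C with (1 + Cconj w * z)%C in H by ring. exact H.
Qed.

(* The point w is moved to the centre by a disk automorphism, which carries
   circles close to the boundary to curves close to the boundary. *)
Lemma schwarz_pointwise (g : C -> C) (w : C) : hol g ->
  (forall z, Cmod z < 1 -> Cmod z * Cmod (g z) <= 1) -> Cmod w < 1 -> Cmod (g w) <= 1.
Proof.
  intros Hg Hb Hw. apply Rnot_lt_le. intros HG. set (G := Cmod (g w)) in *.
  assert (Kw := Cmod_ge_0 w).
  set (T := fun z => ((z + w) / (1 + Cconj w * z))%C).
  assert (Den : forall z, Cmod z < 1 -> 0 < Cmod (1 + Cconj w * z)).
  { intros z Hz. assert (H := moebius_den_bound z w). assert (Kz := Cmod_ge_0 z). nra. }
  assert (T2 : forall z, Cmod z < 1 -> Cmod (T z) * Cmod (T z) =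
     1 - (1 - Cmod z * Cmod z) * (1 - Cmod w * Cmod w)
           / (Cmod (1 + Cconj w * z) * Cmod (1 + Cconj w * z))).
  { intros z Hz. assert (D := Den z Hz). unfold T.
    rewrite Cmod_div by (apply Cmod_gt_0; exact D).
    rewrite <- moebius_identity. field. lra. }
  assert (HT : forall z, Cmod z < 1 -> Cmod (T z) < 1).
  { intros z Hz. assert (D := Den z Hz). assert (Kz := Cmod_ge_0 z).
    assert (E := T2 z Hz). assert (KT := Cmod_ge_0 (T z)).
    assert (0 < (1 - Cmod z * Cmod z) * (1 - Cmod w * Cmod w)
           / (Cmod (1 + Cconj w * z) * Cmod (1 + Cconj w * z))).
    { apply Rdiv_lt_0_compat; [|nra]. apply Rmult_lt_0_compat; nra. }
    nra. }
  assert (Hk : hol (fun z => g (T z))).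
  { apply hol_comp; [exact Hg| |exact HT]. apply hol_div.
    - apply hol_plus; [apply hol_id|apply hol_const].
    - apply hol_plus; [apply hol_const|]. apply hol_mult; [apply hol_const|apply hol_id].
    - intros z Hz. apply Cmod_gt_0, Den, Hz. }
  assert (HT0 : T (RtoC 0) = w).
  { unfold T. replace (1 + Cconj w * 0)%C with (RtoC 1) by ring. field. }
  (* A equals (1 - |w|^2) / (1 - |w|)^2, so |T z|^2 >= 1 - A t on the circle |z|^2 = 1 - t. The
     choice of t gives m^2 = 1 - A t = (1 + 1/G^2) / 2 > 1/G^2, whence |g (T z)| <= 1/m < G on the
     circle, against the value G at the centre. *)
  set (A := (1 + Cmod w) / (1 - Cmod w)).
  assert (HA : 1 <= A).
  { unfold A. apply Rmult_le_reg_r with (1 - Cmod w); [lra|]. unfold Rdiv.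
    rewrite Rmult_assoc, Rinv_l by lra. lra. }
  assert (HG2 : / (G * G) < 1) by (rewrite <- Rinv_1; apply Rinv_lt_contravar; nra).
  assert (KG2 : 0 < / (G * G)) by (apply Rinv_0_lt_compat; nra).
  set (t := (1 - / (G * G)) / (2 * A)).
  assert (Ht : 0 < t) by (apply Rdiv_lt_0_compat; lra).
  assert (HAt : A * t = (1 - / (G * G)) / 2) by (unfold t; field; lra).
  assert (Ht1 : t < 1) by nra.
  set (rho := sqrt (1 - t)).
  assert (Hr2 : rho * rho = 1 - t) by (apply sqrt_sqrt; lra).
  assert (Hr0 : 0 < rho) by (apply sqrt_lt_R0; lra).
  assert (Hr1 : rho < 1) by nra.
  set (m := sqrt (1 - A * t)).
  assert (Hm2 : m * m = 1 - A * t) by (apply sqrt_sqrt; lra).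
  assert (Hm0 : 0 < m) by (apply sqrt_lt_R0; lra).
  assert (B : Cmod (g (T (RtoC 0))) <= / m).
  { apply (mean_bound (fun z => g (T z)) rho (/ m) Hk); [lra|].
    intros z Hz. assert (Hz1 : Cmod z < 1) by lra.
    assert (Hb' := Hb _ (HT z Hz1)). assert (E := T2 z Hz1).
    assert (KT : m <= Cmod (T z)).
    { apply Rsqr_incr_0_var; [|apply Cmod_ge_0]. unfold Rsqr. rewrite Hm2, E, Hz, Hr2.
      replace (1 - (1 - t)) with t by ring.
      assert (D := moebius_den_bound z w). rewrite Hz in D.
      set (D0 := Cmod (1 + Cconj w * z)) in *.
      assert (D1 : 1 - Cmod w <= D0) by nra.
      enough (t * (1 - Cmod w * Cmod w) / (D0 * D0) <= A * t) by lra.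
      apply Rmult_le_reg_r with (D0 * D0); [nra|].
      unfold Rdiv. rewrite Rmult_assoc, Rinv_l, Rmult_1_r by nra.
      replace (t * (1 - Cmod w * Cmod w)) with (A * t * ((1 - Cmod w) * (1 - Cmod w)))
        by (unfold A; field; lra).
      apply Rmult_le_compat_l; nra. }
    apply Rmult_le_reg_l with m; [exact Hm0|]. rewrite Rinv_r by lra.
    assert (Kg := Cmod_ge_0 (g (T z))). nra. }
  rewrite HT0 in B. fold G in B.
  assert (m * G <= 1).
  { apply Rmult_le_compat_l with (r := m) in B; [|lra]. rewrite Rinv_r in B by lra. exact B. }
  assert (E : m * m * (G * G) = (1 - (1 - / (G * G)) / 2) * (G * G)) by (rewrite Hm2, HAt; reflexivity).
  replace ((1 - (1 - / (G * G)) / 2) * (G * G)) with ((G * G + 1) / 2) in E by (field; lra).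
  assert (Q0 : 0 < m * G) by (apply Rmult_lt_0_compat; lra).
  assert (Q : m * G * (m * G) <= 1) by (set (q := m * G) in *; nra).
  assert (1 < G * G) by nra. lra.
Qed.

Lemma schwarz (h : C -> C) : hol h -> h (RtoC 0) = 0 ->
  (forall z, Cmod z < 1 -> Cmod (h z) <= 1) ->
  forall z, Cmod z < 1 -> Cmod (divz h z) <= 1.
Proof.
  intros Hh H0 Hb z Hz. apply schwarz_pointwise; [now apply hol_divz| |exact Hz].
  intros u Hu. rewrite <- Cmod_mult.
  replace (u * divz h u)%C with (h u); [now apply Hb|].
  rewrite (divz_spec h u), H0. ring.
Qed.

(** The Schwarz lemma for (h - a) / (1 - conj(a) h). The conclusion is cleared of quotients so that
    coefficients can be compared through products. *)
Lemma schur_step (h : C -> C) (a : C) : hol h -> h (RtoC 0) = a -> Cmod a < 1 ->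
  (forall z, Cmod z < 1 -> Cmod (h z) <= 1) ->
  exists k, hol k /\ (forall z, Cmod z < 1 -> Cmod (k z) <= 1) /\
    (forall z, Cmod z < 1 -> h z - a = z * k z * (1 - Cconj a * h z))%C.
Proof.
  intros Hh H0 Ha Hb.
  assert (Ka := Cmod_ge_0 a).
  assert (Den : forall z, Cmod z < 1 -> 0 < Cmod (1 - Cconj a * h z)).
  { intros z Hz. assert (H := moebius_den_bound (h z) (- a)).
    rewrite Cmod_opp in H. specialize (Hb z Hz). assert (K := Cmod_ge_0 (h z)).
    replace (1 + Cconj (- a) * h z)%C with (1 - Cconj a * h z)%C in H.
    - nra.
    - replace (Cconj (- a)) with (- Cconj a)%C; [ring|].
      destruct a; unfold Cconj, Copp; simpl. reflexivity. }
  set (g := fun z => ((h z - a) / (1 - Cconj a * h z))%C).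
  assert (Hg : hol g).
  { apply hol_div.
    - apply hol_minus; [exact Hh|apply hol_const].
    - apply hol_minus; [apply hol_const|]. apply hol_mult; [apply hol_const|exact Hh].
    - intros z Hz. apply Cmod_gt_0, Den, Hz. }
  assert (Hg0 : g (RtoC 0) = 0).
  { unfold g. rewrite H0. unfold Cdiv. ring. }
  assert (Hgb : forall z, Cmod z < 1 -> Cmod (g z) <= 1).
  { intros z Hz. assert (D := Den z Hz). unfold g.
    rewrite Cmod_div by (apply Cmod_gt_0; exact D).
    apply Rmult_le_reg_r with (1 := D). unfold Rdiv.
    rewrite Rmult_assoc, Rinv_l, Rmult_1_r, Rmult_1_l by lra.
    assert (M := moebius_identity (h z) (- a)).
    replace (1 + Cconj (- a) * h z)%C with (1 - Cconj a * h z)%C in M.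
    2:{ replace (Cconj (- a)) with (- Cconj a)%C; [ring|].
        destruct a; unfold Cconj, Copp; simpl. reflexivity. }
    change (h z + - a)%C with (h z - a)%C in M. rewrite Cmod_opp in M.
    specialize (Hb z Hz). assert (K := Cmod_ge_0 (h z)).
    assert (0 <= (1 - Cmod (h z) * Cmod (h z)) * (1 - Cmod a * Cmod a))
      by (apply Rmult_le_pos; nra).
    apply Rsqr_incr_0_var; [unfold Rsqr; lra|lra]. }
  exists (divz g). split; [now apply hol_divz|]. split; [now apply schwarz|].
  intros z Hz. assert (D := Den z Hz).
  assert (E := divz_spec g z). rewrite Hg0 in E.
  replace (z * divz g z)%C with (g z) by (rewrite E; ring).
  unfold g. field. apply Cmod_gt_0. exact D.
Qed.

(** * Primitives *)

Definition prim (h : C -> C) (z : C) : C := (z * CInt (fun t => h (RtoC t * z)%C) 0 1)%C.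

Lemma Cmod_scale (t : R) (z : C) : 0 <= t <= 1 -> Cmod (RtoC t * z) <= Cmod z.
Proof.
  intros Ht. rewrite Cmod_mult, Cmod_R, Rabs_right by lra.
  assert (K := Cmod_ge_0 z). nra.
Qed.

Lemma pcont_scale (h : C -> C) (z : C) (t : R) : disk_cont h -> Cmod z < 1 ->
  0 <= t <= 1 -> pcont (fun t => h (RtoC t * z)%C) t.
Proof.
  intros Hh Hz Ht. apply pcont_comp.
  - apply Hh. eapply Rle_lt_trans; [now apply Cmod_scale|exact Hz].
  - apply pcont_ext with (fun t => 0 + RtoC t * z)%C; [intros; ring|apply pcont_affine].
Qed.

Lemma pcont_RtoC (t : R) : pcont RtoC t.
Proof. apply pcont_ext with (fun t => 0 + RtoC t * 1)%C; [intros; ring|apply pcont_affine]. Qed.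

(** Differentiation under the integral sign gives the integral of h(t z) + t z h'(t z), which is the
    t-derivative of t h(t z). *)
Lemma cder_prim (h : C -> C) (z : C) : hol h -> Cmod z < 1 -> cder (prim h) z (h z).
Proof.
  intros Hh Hz.
  set (D := fun t => (RtoC t * C_derive h (RtoC t * z))%C).
  assert (HD : pcont_on D 0 1).
  { intros t Ht. apply pcont_mult; [apply pcont_RtoC|].
    apply pcont_scale; [now apply hol_C_derive_cont|exact Hz|exact Ht]. }
  assert (HI : pcont_on (fun t => h (RtoC t * z)%C) 0 1).
  { intros t Ht. apply pcont_scale; [now apply hol_cont|exact Hz|exact Ht]. }
  assert (Hd : cder (fun w => CInt (fun t => h (RtoC t * w)%C) 0 1) z (CInt D 0 1)).
  { apply (cder_CInt (fun w t => h (RtoC t * w)%C)); [lra| | |exact HD].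
    - intros eps Heps. destruct (hol_unif_diff h (Cmod z) eps Hh Hz Heps) as [d [Hd H]].
      exists d. split; [exact Hd|]. intros w Bw t Ht.
      assert (S := Cmod_scale t (w - z) Ht).
      assert (E : (RtoC t * w - RtoC t * z)%C = (RtoC t * (w - z))%C) by ring.
      assert (H1 := H (RtoC t * z)%C (RtoC t * w)%C (Cmod_scale t z Ht)). rewrite E in H1.
      unfold D. replace (RtoC t * C_derive h (RtoC t * z) * (w - z))%C with
        (C_derive h (RtoC t * z) * (RtoC t * (w - z)))%C by ring.
      eapply Rle_trans; [apply H1; lra|]. apply Rmult_le_compat_l; lra.
    - destruct (disk_nbhd z Hz) as [d [Hd0 Hw]]. exists d. split; [exact Hd0|].
      intros w Bw t Ht. apply pcont_scale; [now apply hol_cont|now apply Hw|exact Ht]. }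
  assert (P := cder_mult (fun w => w) _ z _ _ (cder_id z) Hd).
  eapply cder_eq; [|exact P].
  set (F := fun u => (u * h (u * z))%C).
  assert (J : is_CInt (fun t => (1 * h (RtoC t * z) + RtoC t * (C_derive h (RtoC t * z) * (1 * z + RtoC t * 0))) * 1)%C 0 1
     (F (0 + RtoC 1 * 1)%C - F (0 + RtoC 0 * 1)%C)).
  { apply (is_CInt_FTC (fun t => F (0 + RtoC t * 1)%C)); [lra| |].
    - intros t Ht. apply (pder_comp_cder F (fun t => 0 + RtoC t * 1)%C); [|apply pder_affine].
      replace (0 + RtoC t * 1)%C with (RtoC t) by ring.
      apply (cder_mult (fun u => u) (fun u => h (u * z)%C)); [apply cder_id|].
      apply (cder_comp h (fun u => u * z)%C).
      + apply hol_cder; [exact Hh|]. eapply Rle_lt_trans; [now apply Cmod_scale|exact Hz].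
      + apply (cder_mult (fun u => u) (fun _ => z)); [apply cder_id|apply cder_const].
    - intros t Ht. apply pcont_ext with (fun t => h (RtoC t * z) + z * D t)%C.
      + intros s. unfold D. ring.
      + apply pcont_plus; [now apply HI|]. apply pcont_mult; [apply pcont_const|now apply HD]. }
  assert (I := is_CInt_plus _ _ _ _ _ _ (CInt_correct _ 0 1 Rle_0_1 HI)
     (is_CInt_scal z _ _ _ _ (CInt_correct _ 0 1 Rle_0_1 HD))).
  apply is_CInt_unique in I. rewrite Cmult_1_l, <- I.
  apply is_CInt_unique in J. rewrite (CInt_ext _ (fun t => h (RtoC t * z) + z * D t)%C) in J.
  - rewrite J. unfold F. replace ((0 + RtoC 1 * 1) * z)%C with z by ring. ring.
  - lra.
  - intros t _. unfold D. ring.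
Qed.

Lemma prim_0 (h : C -> C) : prim h 0 = 0.
Proof. unfold prim. ring. Qed.


(** * Logarithms and sectors *)

Lemma hol_constant (h : C -> C) : hol h -> (forall z, Cmod z < 1 -> C_derive h z = 0) ->
  forall z, Cmod z < 1 -> h z = h (RtoC 0).
Proof.
  intros Hh H0 z Hz.
  assert (I := hol_increment h 0 z (Cmod z) 0 Hh Hz ltac:(rewrite Cmod_0; apply Cmod_ge_0)
    ltac:(lra)).
  rewrite (H0 0 Cmod_0_lt_1) in I.
  assert (E : Cmod (h z - h (RtoC 0) - 0 * (z - 0)) = 0).
  { apply Rle_antisym; [|apply Cmod_ge_0]. rewrite Rmult_0_l in I. apply I.
    intros t Ht. rewrite H0.
    - replace (0 - 0)%C with (RtoC 0) by ring. rewrite Cmod_0. lra.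
    - replace (0 + RtoC t * (z - 0))%C with (RtoC t * z)%C by ring.
      eapply Rle_lt_trans; [now apply Cmod_scale|exact Hz]. }
  apply Cmod_eq_0 in E.
  replace (h z) with ((h z - h (RtoC 0) - 0 * (z - 0)) + h (RtoC 0))%C by ring.
  rewrite E. ring.
Qed.

Lemma pcont_Im (f : R -> C) (x : R) : pcont f x -> continuity_pt (fun t => Im (f t)) x.
Proof.
  intros H eps Heps. destruct (H eps Heps) as [d [Hd Hy]]. exists d. split; [exact Hd|].
  intros y [_ By]. specialize (Hy y By).
  eapply Rle_lt_trans; [|exact Hy]. apply (Rabs_le_Cmod_r (Re (f y) - Re (f x))).
Qed.

(** On the radius to z the imaginary part starts at 0 and is continuous, so it cannot reach beyond c
    or -c without taking that value. *)
Lemma disk_Im_bound (h : C -> C) (c : R) : disk_cont h -> Im (h (RtoC 0)) = 0 -> 0 < c ->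
  (forall z, Cmod z < 1 -> Rabs (Im (h z)) <> c) ->
  forall z, Cmod z < 1 -> Rabs (Im (h z)) < c.
Proof.
  intros Hh H0 Hc N z Hz. apply Rnot_le_lt. intros [L|E]; [|now apply (N z Hz)].
  set (f := fun t => Im (h (RtoC t * z)%C)).
  assert (Hf : forall t, 0 <= t <= 1 -> continuity_pt f t).
  { intros t Ht. apply (pcont_Im (fun t => h (RtoC t * z)%C)). now apply pcont_scale. }
  assert (F0 : f 0 = 0) by (unfold f; replace (RtoC 0 * z)%C with (RtoC 0) by ring; exact H0).
  assert (F1 : f 1 = Im (h z)) by (unfold f; now replace (RtoC 1 * z)%C with z by ring).
  destruct (Rcase_abs (Im (h z))) as [Hn|Hp].
  - rewrite Rabs_left in L by exact Hn.
    destruct (Ranalysis5.IVT_interv (fun t => - f t - c)%R 0 1) as [t [Ht Et]]; try lra.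
    { intros t Ht. apply continuity_pt_minus; [apply continuity_pt_opp; now apply Hf|].
      apply continuity_pt_const. intros ? ?. reflexivity. }
    apply (N (RtoC t * z)%C); [eapply Rle_lt_trans; [now apply Cmod_scale|exact Hz]|].
    fold (f t). replace (f t) with (- c) by lra. rewrite Rabs_Ropp, Rabs_right; lra.
  - rewrite Rabs_right in L by exact Hp.
    destruct (Ranalysis5.IVT_interv (fun t => f t - c)%R 0 1) as [t [Ht Et]]; try lra.
    { intros t Ht. apply continuity_pt_minus; [now apply Hf|].
      apply continuity_pt_const. intros ? ?. reflexivity. }
    apply (N (RtoC t * z)%C); [eapply Rle_lt_trans; [now apply Cmod_scale|exact Hz]|].
    fold (f t). replace (f t) with c by lra. rewrite Rabs_right; lra.
Qed.

Definition dLam (z : C) : C := (1 / (1 - z) + 1 / (1 + z))%C.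

(* Log ((1 + z) / (1 - z)) *)
Definition Lam : C -> C := prim dLam.

Lemma disk_1_minus (z : C) : Cmod z < 1 -> (1 - z)%C <> 0.
Proof.
  intros Hz E. apply (f_equal Cmod) in E. rewrite Cmod_0 in E.
  generalize (Cmod_triangle_inv 1 z). rewrite Cmod_1. lra.
Qed.

Lemma disk_1_plus (z : C) : Cmod z < 1 -> (1 + z)%C <> 0.
Proof.
  intros Hz. replace (1 + z)%C with (1 - - z)%C by ring. apply disk_1_minus.
  now rewrite Cmod_opp.
Qed.

Lemma hol_dLam : hol dLam.
Proof.
  apply hol_plus; apply hol_div.
  - apply hol_const.
  - apply hol_minus; [apply hol_const|apply hol_id].
  - exact disk_1_minus.
  - apply hol_const.
  - apply hol_plus; [apply hol_const|apply hol_id].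
  - exact disk_1_plus.
Qed.

Lemma cder_Lam (z : C) : Cmod z < 1 -> cder Lam z (dLam z).
Proof. apply cder_prim, hol_dLam. Qed.

Lemma hol_Lam : hol Lam.
Proof. intros z Hz. eexists. now apply cder_Lam. Qed.

Lemma Lam_0 : Lam 0 = 0.
Proof. apply prim_0. Qed.

(** The product of exp(Lam z) and (1 - z) / (1 + z) has derivative 0 and the value 1 at the
    origin. *)
Lemma cexp_Lam (z : C) : Cmod z < 1 -> cexp (Lam z) = ((1 + z) / (1 - z))%C.
Proof.
  intros Hz.
  set (k := fun z => (cexp (Lam z) * ((1 - z) / (1 + z)))%C).
  assert (Dk : forall z, Cmod z < 1 -> cder k z 0).
  { intros w Hw. assert (N1 := disk_1_minus w Hw). assert (N2 := disk_1_plus w Hw).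
    eapply cder_eq; [|apply cder_mult;
      [apply cder_comp; [apply cder_cexp|now apply cder_Lam]
      |apply (cder_div (fun z => 1 - z) (fun z => 1 + z))%C; [exact N2
        |apply cder_minus; [apply cder_const|apply cder_id]
        |apply cder_plus; [apply cder_const|apply cder_id]]]].
    unfold dLam. field. auto. }
  assert (Hk : hol k) by (intros w Hw; eexists; now apply Dk).
  assert (E : k z = k (RtoC 0)).
  { apply hol_constant; [exact Hk| |exact Hz]. intros w Hw. now apply cder_C_derive, Dk. }
  assert (N1 := disk_1_minus z Hz). assert (N2 := disk_1_plus z Hz).
  replace (cexp (Lam z)) with (k z * ((1 + z) / (1 - z)))%C by (unfold k; field; auto).
  rewrite E. unfold k. rewrite Lam_0, cexp_0. field. exact N1.
Qed.

Lemma Re_cayley (z : C) : Cmod z < 1 -> 0 < Re ((1 + z) / (1 - z)).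
Proof.
  intros Hz. assert (N := disk_1_minus z Hz). apply Cmod_gt_0 in N.
  assert (E := Cmod_sqr (1 - z)). assert (F := Cmod_sqr z).
  assert (K := Cmod_ge_0 z). set (m := Cmod (1 - z)) in *. set (r := Cmod z) in *.
  destruct z as [x y]. simpl in E, F.
  assert (Dp : 0 < m * m) by nra. assert (Rp : r * r < 1) by nra.
  replace (Re ((1 + (x, y)) / (1 - (x, y)))) with ((1 - (x * x + y * y)) / (m * m)).
  - apply Rdiv_lt_0_compat; lra.
  - rewrite E. rewrite E in Dp. unfold Cdiv, Cinv, Cmult, Cplus, Cminus, Copp; simpl. field.
    nra.
Qed.

(** Since exp(Lam z) has positive real part, cos (Im (Lam z)) never vanishes, so the imaginary part
    cannot attain PI / 2 in absolute value. *)
Lemma Im_Lam_bound (z : C) : Cmod z < 1 -> Rabs (Im (Lam z)) < PI / 2.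
Proof.
  assert (HPI := PI_RGT_0).
  apply disk_Im_bound; [apply hol_cont, hol_Lam|now rewrite Lam_0|lra|].
  intros w Hw E. assert (P := Re_cayley w Hw). rewrite <- cexp_Lam in P by exact Hw.
  change (0 < exp (Re (Lam w)) * cos (Im (Lam w))) in P.
  replace (cos (Im (Lam w))) with 0 in P; [lra|].
  unfold Rabs in E. destruct (Rcase_abs (Im (Lam w))).
  - rewrite <- cos_neg, E. symmetry. apply cos_PI2.
  - rewrite E. symmetry. apply cos_PI2.
Qed.

(** The principal logarithm on the right half-plane, transported to the disk by the inverse of z ->
    (1 + z) / (1 - z). *)
Definition clog (w : C) : C := Lam ((w - 1) / (w + 1)).

Lemma Re_pos_plus_1 (w : C) : 0 < Re w -> (w + 1)%C <> 0.
Proof.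
  intros H E. apply (f_equal Re) in E. unfold Re in *. simpl in E. lra.
Qed.

Lemma Re_pos_neq_0 (w : C) : 0 < Re w -> w <> 0.
Proof. intros H ->. simpl in H. lra. Qed.

Lemma cayley_inv_disk (w : C) : 0 < Re w -> Cmod ((w - 1) / (w + 1)) < 1.
Proof.
  intros H. assert (N := Re_pos_plus_1 w H). rewrite Cmod_div by exact N.
  apply Cmod_gt_0 in N. apply Rmult_lt_reg_r with (1 := N). unfold Rdiv.
  rewrite Rmult_assoc, Rinv_l, Rmult_1_r, Rmult_1_l by lra.
  apply Rsqr_incrst_0; [|apply Cmod_ge_0|lra]. unfold Rsqr. rewrite !Cmod_sqr.
  destruct w as [x y]. simpl in *. lra.
Qed.

Lemma cexp_clog (w : C) : 0 < Re w -> cexp (clog w) = w.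
Proof.
  intros H. assert (N := Re_pos_plus_1 w H). unfold clog.
  rewrite cexp_Lam by now apply cayley_inv_disk. field.
  split; [exact N|].
  replace (w + 1 - (w - 1))%C with (RtoC 2).
  - intros E. apply RtoC_inj in E. lra.
  - destruct w; unfold Cminus, Cplus, Copp, RtoC; simpl. f_equal; ring.
Qed.

Lemma Re_pos_open (w : C) : 0 < Re w -> forall u, Cmod (u - w) < Re w -> 0 < Re u.
Proof.
  intros H u Hu. assert (K := re_le_Cmod (u - w)). simpl in K.
  apply Rle_lt_trans with (1 := K) in Hu. apply Rabs_def2 in Hu. unfold Re in *. lra.
Qed.

(** The chain rule provides some derivative; differentiating cexp (clog u) = u identifies it. *)
Lemma cder_clog (w : C) : 0 < Re w -> cder clog w (/ w).
Proof.
  intros H. assert (N := Re_pos_plus_1 w H).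
  assert (E : exists l, cder clog w l).
  { eexists. unfold clog. apply cder_comp; [now apply cder_Lam, cayley_inv_disk|].
    apply (cder_div (fun w => w - 1) (fun w => w + 1))%C; [exact N| |].
    - apply cder_minus; [apply cder_id|apply cder_const].
    - apply cder_plus; [apply cder_id|apply cder_const]. }
  destruct E as [l Hl].
  assert (U : (cexp (clog w) * l)%C = 1).
  { apply (cder_unique (fun u => u) w); [|apply cder_id].
    apply (cder_ext_loc (fun u => cexp (clog u)) _ w _ (Re w) H).
    - intros u Hu. apply cexp_clog. now apply (Re_pos_open w).
    - apply cder_comp; [apply cder_cexp|exact Hl]. }
  rewrite cexp_clog in U by exact H.
  replace (/ w)%C with l; [exact Hl|].
  replace l with (w * l / w)%C by (field; now apply Re_pos_neq_0).
  rewrite U. field. now apply Re_pos_neq_0.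
Qed.

Lemma clog_1 : clog 1 = 0.
Proof.
  unfold clog. replace ((1 - 1) / (1 + 1))%C with (RtoC 0); [apply Lam_0|].
  unfold Cdiv. ring.
Qed.

Lemma Im_clog_bound (w : C) : 0 < Re w -> Rabs (Im (clog w)) < PI / 2.
Proof. intros H. apply Im_Lam_bound. now apply cayley_inv_disk. Qed.

Lemma cos_Im_clog (w : C) : 0 < Re w -> Re w = Cmod w * cos (Im (clog w)).
Proof.
  intros H. rewrite <- (cexp_clog w H) at 1 2. rewrite Cmod_cexp. reflexivity.
Qed.

(** For c = cos b this is |arg w| < b, written without arguments: 0 is excluded, and openness and
    invariance under 1/w are visible. *)
Definition sector (c : R) (w : C) : Prop := c * Cmod w < Re w.

Lemma sector_Re_pos (c : R) (w : C) : 0 <= c -> sector c w -> 0 < Re w.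
Proof.
  intros Hc H. unfold sector in H. assert (K := Cmod_ge_0 w). nra.
Qed.

Lemma sector_open (c : R) (w : C) : 0 <= c <= 1 -> sector c w ->
  exists d, 0 < d /\ forall u, Cmod (u - w) < d -> sector c u.
Proof.
  intros Hc H. unfold sector in *. exists ((Re w - c * Cmod w) / 2). split; [lra|].
  intros u Hu. assert (K := re_le_Cmod (u - w)). simpl in K.
  assert (L := Cmod_triangle_inv u w).
  assert (M : Rabs (Re u + - Re w) < (Re w - c * Cmod w) / 2)
    by (eapply Rle_lt_trans; [exact K|exact Hu]).
  apply Rabs_def2 in M. assert (K0 := Cmod_ge_0 (u - w)). nra.
Qed.

Lemma cos_even_abs (v : R) : cos (Rabs v) = cos v.
Proof. unfold Rabs. destruct (Rcase_abs v); [apply cos_neg|reflexivity]. Qed.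

Lemma sector_Im_clog (b : R) (w : C) : 0 < b < PI / 2 -> sector (cos b) w ->
  Rabs (Im (clog w)) < b.
Proof.
  intros Hb H. assert (Cb : 0 < cos b) by (apply cos_gt_0; lra).
  assert (Rw := sector_Re_pos _ _ (Rlt_le _ _ Cb) H).
  assert (E := cos_Im_clog w Rw). assert (B := Im_clog_bound w Rw).
  unfold sector in H. rewrite E, Rmult_comm in H.
  apply Rmult_lt_reg_l in H; [|apply Cmod_gt_0, Re_pos_neq_0, Rw].
  rewrite <- (cos_even_abs (Im (clog w))) in H.
  assert (K := Rabs_pos (Im (clog w))). apply cos_decreasing_0; lra.
Qed.

Lemma Rabs_Carg (w : C) : w <> 0 -> Rabs (Carg w) = acos (Re w / Cmod w).
Proof.
  intros N. apply Cmod_gt_0 in N. assert (K := re_le_Cmod w). apply Rabs_le_between in K.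
  assert (B := acos_bound (Re w / Cmod w)).
  unfold Carg. destruct (Rle_dec 0 (Im w)); [|rewrite Rabs_Ropp]; rewrite Rabs_right; lra.
Qed.

Lemma Carg_sector (b : R) (w : C) : 0 < b < PI -> w <> 0 ->
  (Rabs (Carg w) < b <-> sector (cos b) w).
Proof.
  intros Hb N. rewrite (Rabs_Carg w N). apply Cmod_gt_0 in N.
  assert (K := re_le_Cmod w). apply Rabs_le_between in K.
  set (x := Re w / Cmod w).
  assert (Ex : Re w = x * Cmod w) by (unfold x; field; lra).
  assert (Hx : -1 <= x <= 1) by nra.
  assert (B := acos_bound x). assert (CA := cos_acos x Hx).
  unfold sector. rewrite Ex. split; intros H.
  - apply Rmult_lt_compat_r; [exact N|]. rewrite <- CA.
    apply cos_decreasing_1; lra.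
  - apply Rmult_lt_reg_r in H; [|exact N]. rewrite <- CA in H.
    apply cos_decreasing_0; lra.
Qed.


(** * The first exit from the sector *)

(* w ^ (- 1 / a) *)
Definition invroot (a : R) (w : C) : C := cexp (RtoC (- / a) * clog w).

(** If |arg w| < pi a / 2, then w^(-1/a) lies in the right half-plane; hence this sends the sector
    into the unit disk and 1 to 0. *)
Definition cayley_root (a : R) (w : C) : C := ((invroot a w - 1) / (invroot a w + 1))%C.

Lemma cder_invroot (a : R) (w : C) : 0 < Re w ->
  cder (invroot a) w (invroot a w * (RtoC (- / a) * / w)).
Proof.
  intros H. apply (cder_comp cexp (fun w => RtoC (- / a) * clog w)%C).
  - apply cder_cexp.
  - apply cder_scal. now apply cder_clog.
Qed.

Lemma invroot_1 (a : R) : invroot a 1 = 1.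
Proof.
  unfold invroot. rewrite clog_1. replace (RtoC (- / a) * 0)%C with (RtoC 0) by ring.
  apply cexp_0.
Qed.

Lemma invroot_Re_pos (a : R) (w : C) : 0 < a < 1 -> sector (cos (PI * a / 2)) w ->
  0 < Re (invroot a w).
Proof.
  intros Ha H. assert (HPI := PI_RGT_0).
  assert (Hb : 0 < PI * a / 2 < PI / 2) by (split; nra).
  assert (B := sector_Im_clog _ _ Hb H).
  unfold invroot.
  change (0 < exp (Re (RtoC (- / a) * clog w)) * cos (Im (RtoC (- / a) * clog w))).
  apply Rmult_lt_0_compat; [apply exp_pos|].
  replace (Im (RtoC (- / a) * clog w)) with (- / a * Im (clog w))
    by (unfold RtoC, Cmult; simpl; unfold Im; ring).
  apply Rabs_def2 in B.
  assert (Ia : 0 < / a) by (apply Rinv_0_lt_compat; lra).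
  assert (E : / a * (PI * a / 2) = PI / 2) by (field; lra).
  apply cos_gt_0; nra.
Qed.

Lemma cder_cayley (P : C -> C) (z l : C) : cder P z l -> (P z + 1)%C <> 0 ->
  cder (fun z => (P z - 1) / (P z + 1))%C z ((l + l) / ((P z + 1) * (P z + 1))).
Proof.
  intros H N. eapply cder_eq; [|apply (cder_div (fun z => P z - 1) (fun z => P z + 1))%C;
    [exact N|apply cder_minus; [exact H|apply cder_const]
    |apply cder_plus; [exact H|apply cder_const]]].
  field. exact N.
Qed.

Lemma Cmod_cayley_root (a : R) (w : C) : 0 < a < 1 -> sector (cos (PI * a / 2)) w ->
  Cmod (cayley_root a w) < 1.
Proof. intros Ha H. apply cayley_inv_disk. now apply invroot_Re_pos. Qed.

Lemma cos_half_PI_mult (a : R) : 0 < a < 1 -> 0 < cos (PI * a / 2) < 1.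
Proof.
  intros Ha. assert (HPI := PI_RGT_0). split.
  - apply cos_gt_0; nra.
  - rewrite <- cos_0. apply cos_decreasing_1; nra.
Qed.

Lemma cder_cayley_root_comp (a : R) (q : C -> C) (z l : C) : 0 < a < 1 ->
  sector (cos (PI * a / 2)) (q z) -> cder q z l ->
  exists P', cder (fun z => invroot a (q z)) z P' /\ P' = (invroot a (q z) * (RtoC (- / a) * / q z) * l)%C /\
   cder (fun z => cayley_root a (q z)) z
    ((P' + P') / ((invroot a (q z) + 1) * (invroot a (q z) + 1))).
Proof.
  intros Ha H Hq. assert (Cb := cos_half_PI_mult a Ha).
  assert (Rq : 0 < Re (q z)) by (apply (sector_Re_pos _ _ (Rlt_le _ _ (proj1 Cb)) H)).
  eexists. split; [|split; [reflexivity|]].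
  - apply (cder_comp (invroot a) q); [now apply cder_invroot|exact Hq].
  - apply (cder_cayley (fun z => invroot a (q z))).
    + apply (cder_comp (invroot a) q); [now apply cder_invroot|exact Hq].
    + apply Re_pos_plus_1. now apply invroot_Re_pos.
Qed.

Lemma hol_cayley_root (a : R) (q : C -> C) : 0 < a < 1 -> hol q ->
  (forall z, Cmod z < 1 -> sector (cos (PI * a / 2)) (q z)) ->
  hol (fun z => cayley_root a (q z)).
Proof.
  intros Ha Hq H z Hz. destruct (Hq z Hz) as [l Hl].
  destruct (cder_cayley_root_comp a q z l Ha (H z Hz) Hl) as [P' [_ [_ D]]].
  eexists. exact D.
Qed.

Lemma affine_nonpos_slope (p r : R) : (forall y, p + y * r <= 0) -> p <= 0 /\ r = 0.
Proof.
  intros H. split; [specialize (H 0); lra|].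
  destruct (Req_dec r 0) as [E|N]; [exact E|exfalso].
  specialize (H ((1 - p) / r)). replace ((1 - p) / r * r) with (1 - p) in H by (field; exact N).
  lra.
Qed.

(* Only directions pointing into the disk are available at the boundary point 1;
   those of the form -1 + i y suffice. *)
Lemma boundary_schwarz (W : C -> C) (l : C) : cder W 1 l ->
  (forall z, Cmod z < 1 -> Cmod (W z) <= Cmod z) -> Cmod (W (RtoC 1)) = 1 ->
  exists k, 1 <= k /\ l = (RtoC k * W (RtoC 1))%C.
Proof.
  intros Hd Hb H1.
  set (c := W (RtoC 1)) in *.
  assert (Ec : (Cconj c * c)%C = 1).
  { rewrite Cmult_comm, <- Cmod2_conj, H1. f_equal. ring. }
  set (kp := (Cconj c * l)%C).
  assert (HN : cder (fun z => Cconj c * W z)%C 1 kp) by now apply cder_scal.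
  (* After rotation by conj(c) the value at 1 is 1. Comparing first-order terms in |N(1 + t d)| <=
     |1 + t d| gives Re (kp d) <= Re d. For d = -1 + i y with arbitrary y this forces Im kp = 0 and
     Re kp >= 1. *)
  assert (Hy : forall y, - (Re kp - 1) + y * - Im kp <= 0).
  { intros y. set (d := (-1, y) : C).
    assert (Kd : 0 < Cmod d).
    { apply Cmod_gt_0. intros E. apply (f_equal Re) in E. simpl in E. lra. }
    assert (Sd : Cmod d * Cmod d = 1 + y * y) by (rewrite Cmod_sqr; simpl; ring).
    apply le_epsilon. intros e He. rewrite Rplus_0_l.
    destruct (HN (e / (2 * Cmod d))) as [dl [Hdl H]]; [apply Rdiv_lt_0_compat; lra|].
    set (M := 2 * (1 + y * y)).
    assert (HM : 2 <= M) by (unfold M; nra).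
    (* The three bounds put 1 + t d into the open disk, into the range of the differentiability
       estimate, and make the second-order term of |1 + t d| at most t e / 4. *)
    set (t := Rmin (/ M) (Rmin (dl / (2 * Cmod d)) (e / M))).
    assert (Ht : 0 < t).
    { repeat apply Rmin_pos; [apply Rinv_0_lt_compat|apply Rdiv_lt_0_compat|apply Rdiv_lt_0_compat]; lra. }
    assert (T1 : t <= / M) by apply Rmin_l.
    assert (T2 : t <= dl / (2 * Cmod d)) by (eapply Rle_trans; [apply Rmin_r|apply Rmin_l]).
    assert (T3 : t <= e / M) by (eapply Rle_trans; [apply Rmin_r|apply Rmin_r]).
    apply Rmult_le_compat_r with (r := M) in T1; [|lra]. rewrite Rinv_l in T1 by lra.
    apply Rmult_le_compat_r with (r := 2 * Cmod d) in T2; [|lra].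
    replace (dl / (2 * Cmod d) * (2 * Cmod d)) with dl in T2 by (field; lra).
    apply Rmult_le_compat_r with (r := M) in T3; [|lra].
    replace (e / M * M) with e in T3 by (field; lra).
    set (z := (1 + RtoC t * d)%C).
    assert (Ez : (z - 1)%C = (RtoC t * d)%C) by (unfold z; ring).
    assert (Mz : Cmod (z - 1) = t * Cmod d)
      by (rewrite Ez, Cmod_mult, Cmod_R, Rabs_right; lra).
    specialize (H z). rewrite Mz in H. specialize (H ltac:(nra)). rewrite Ez in H.
    replace (Cconj c * W (RtoC 1))%C with (RtoC 1) in H by (symmetry; exact Ec).
    assert (Sz : Cmod z * Cmod z = 1 - 2 * t + t * t * (1 + y * y)).
    { rewrite Cmod_sqr. unfold z, d; simpl. ring. }
    assert (Kz := Cmod_ge_0 z).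
    assert (Bt : t * t * (1 + y * y) <= t / 2) by (unfold M in T1; nra).
    assert (Lz : Cmod z <= 1 - t + t * (t * (1 + y * y) / 2)).
    { set (m := Cmod z) in *. nra. }
    assert (Lz1 : Cmod z < 1) by nra.
    assert (Nz : Cmod (Cconj c * W z) <= Cmod z).
    { rewrite Cmod_mult, Cmod_conj, H1, Rmult_1_l. now apply Hb. }
    assert (R1 := re_le_Cmod (Cconj c * W z - 1 - kp * (RtoC t * d))).
    assert (R2 := re_le_Cmod (Cconj c * W z)).
    set (N := (Cconj c * W z)%C) in *.
    replace (Re (N - 1 - kp * (RtoC t * d))) with (Re N - 1 - t * (- Re kp - y * Im kp)) in R1
      by (unfold d, Cminus, Cplus, Copp, Cmult, RtoC; simpl; unfold Re, Im; ring).
    apply Rabs_le_between in R1. apply Rabs_le_between in R2.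
    assert (E1 : e / (2 * Cmod d) * (t * Cmod d) = t * (e / 2)) by (field; lra).
    rewrite E1 in H.
    apply Rmult_le_reg_l with (1 := Ht).
    assert (t * (t * (1 + y * y) / 2) <= t * (e / 4)) by (apply Rmult_le_compat_l; unfold M in T3; lra).
    nra. }
  apply affine_nonpos_slope in Hy. destruct Hy as [Hk Hi].
  exists (Re kp). split; [lra|].
  assert (Ek : kp = RtoC (Re kp)).
  { destruct kp as [kx ky]. unfold RtoC. simpl in *. f_equal. lra. }
  rewrite <- Ek. unfold kp. replace (Cconj c * l * c)%C with (l * (Cconj c * c))%C by ring.
  rewrite Ec. ring.
Qed.

(** The sign s treats both edges of the sector at once. *)
Lemma cos_eq_sign (v b : R) : 0 < b < PI / 2 -> Rabs v < PI / 2 -> cos v = cos b ->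
  exists s, s * s = 1 /\ v = s * b.
Proof.
  intros Hb Hv E. assert (HPI := PI_RGT_0). assert (K := Rabs_pos v).
  assert (Ev : Rabs v = b).
  { apply cos_inj; [lra|lra|]. now rewrite cos_even_abs. }
  unfold Rabs in Ev. destruct (Rcase_abs v).
  - exists (-1). lra.
  - exists 1. lra.
Qed.

Lemma cos_sign (s b : R) : s * s = 1 -> cos (s * b) = cos b /\ sin (s * b) = s * sin b.
Proof.
  intros H. assert (D : s = 1 \/ s = -1).
  { destruct (Rmult_integral (s - 1) (s + 1)); [lra|left; lra|right; lra]. }
  destruct D as [-> | ->].
  - rewrite Rmult_1_l. split; [reflexivity|ring].
  - replace (-1 * b) with (- b) by ring. rewrite cos_neg, sin_neg. split; [reflexivity|ring].
Qed.

Definition boundary_height (a X : R) : R :=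
  Rpower X a * sin (PI * a / 2) + a * (X + / X) / 2.

(** The exit point is normalised to 1, where 1/q - l/q is the value of phi_f. With P = q^(-1/a), the
    term 1/q = P^a supplies x^a sin(pi a / 2) and -l/q = a P'/P supplies at least a (x + 1/x) / 2,
    with the same sign. *)
Lemma first_exit_height (a : R) (q : C -> C) (l : C) : 0 < a < 1 ->
  hol q -> q (RtoC 0) = 1 ->
  (forall z, Cmod z < 1 -> sector (cos (PI * a / 2)) (q z)) ->
  cder q 1 l -> q (RtoC 1) <> 0 ->
  Re (q (RtoC 1)) = cos (PI * a / 2) * Cmod (q (RtoC 1)) ->
  exists X, 0 < X /\
    boundary_height a X <= Rabs (Im (/ q (RtoC 1) - l / q (RtoC 1))).
Proof.
  intros Ha Hq Hq0 Hs Hl N Hb. assert (HPI := PI_RGT_0).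
  set (b := PI * a / 2) in *. set (w := q (RtoC 1)) in *.
  assert (Hb2 : 0 < b < PI / 2) by (unfold b; split; nra).
  assert (Cb := cos_half_PI_mult a Ha). fold b in Cb.
  assert (Kw := proj1 (Cmod_gt_0 w) N).
  assert (Rw : 0 < Re w) by (rewrite Hb; apply Rmult_lt_0_compat; lra).
  assert (Ew := cexp_clog w Rw). assert (Bw := Im_clog_bound w Rw).
  assert (Cw := cos_Im_clog w Rw).
  set (L := clog w) in *. set (u := Re L).
  assert (Cv : cos (Im L) = cos b).
  { apply Rmult_eq_reg_l with (Cmod w); [|lra]. rewrite <- Cw, Hb. ring. }
  destruct (cos_eq_sign (Im L) b Hb2 Bw Cv) as [s [Hss HL]].
  set (X := exp (- / a * u)).
  assert (HX : 0 < X) by apply exp_pos.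
  (* On the edge arg w = s pi a / 2 the power -1/a turns the argument into -s pi / 2. *)
  assert (EP : invroot a w = ((0, - s * X) : C)).
  { unfold invroot, cexp. fold L.
    replace (Re (RtoC (- / a) * L)) with (- / a * u)
      by (unfold u, RtoC, Cmult; simpl; unfold Re; ring).
    replace (Im (RtoC (- / a) * L)) with (- (s * (PI / 2))).
    2:{ replace (Im (RtoC (- / a) * L)) with (- / a * Im L)
          by (unfold RtoC, Cmult; simpl; unfold Im; ring).
        rewrite HL. unfold b. field. lra. }
    rewrite cos_neg, sin_neg. destruct (cos_sign s (PI / 2) Hss) as [-> ->].
    rewrite cos_PI2, sin_PI2. fold X. f_equal; ring. }
  set (P' := (invroot a w * (RtoC (- / a) * / w) * l)%C).
  assert (NP : (invroot a w + 1)%C <> 0).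
  { rewrite EP. intros E. apply (f_equal Re) in E. simpl in E. lra. }
  assert (DW : cder (fun z => cayley_root a (q z)) 1
    ((P' + P') / ((invroot a w + 1) * (invroot a w + 1)))).
  { apply (cder_cayley (fun z => invroot a (q z))); [|exact NP].
    apply (cder_comp (invroot a) q); [now apply cder_invroot|exact Hl]. }
  destruct (boundary_schwarz _ _ DW) as [k [Hk EW]].
  - intros z Hz. set (W := fun z => cayley_root a (q z)).
    assert (HW : hol W) by exact (hol_cayley_root a q Ha Hq Hs).
    assert (W0 : W (RtoC 0) = 0).
    { unfold W, cayley_root. rewrite Hq0, invroot_1. unfold Cdiv. ring. }
    change (Cmod (W z) <= Cmod z). rewrite (divz_spec W z), W0.
    replace (0 + z * divz W z)%C with (z * divz W z)%C by ring. rewrite Cmod_mult.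
    assert (S : Cmod (divz W z) <= 1).
    { apply schwarz; [exact HW|exact W0| |exact Hz].
      intros y Hy. exact (Rlt_le _ _ (Cmod_cayley_root a (q y) Ha (Hs y Hy))). }
    assert (Kz := Cmod_ge_0 z). nra.
  - unfold cayley_root. fold w. rewrite Cmod_div by exact NP. rewrite EP.
    replace (Cmod (((0, (- s * X)%R) : C) - 1)) with (Cmod (((0, (- s * X)%R) : C) + 1)).
    + apply Rinv_r. intros E. rewrite <- EP in E. apply Cmod_eq_0 in E. now apply NP.
    + unfold Cmod; simpl. f_equal. ring.
  - cbv beta in EW. fold w in EW. unfold cayley_root in EW.
    (* The relation W'(1) = k W(1) for W = (P - 1) / (P + 1), expressed through P: 2 P' = k (P^2 -
       1). *)
    assert (E2 : (P' + P')%C = (RtoC k * ((invroot a w - 1) * (invroot a w + 1)))%C).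
    { transitivity ((P' + P') / ((invroot a w + 1) * (invroot a w + 1))
         * ((invroot a w + 1) * (invroot a w + 1)))%C; [field; exact NP|].
      rewrite EW. field. exact NP. }
    set (m := (l / w)%C).
    assert (E3 : P' = (((0, (- s * X)%R) : C) * (RtoC (- / a) * m))%C).
    { unfold P', m. rewrite EP. unfold Cdiv. ring. }
    assert (Em : m = (0, s * (a * k * (1 + X * X) / (2 * X)))).
    { rewrite E3, EP in E2. destruct m as [mx my].
      unfold Cplus, Cminus, Cmult, Copp, RtoC in E2; simpl in E2. injection E2 as F1 F2.
      assert (G1 : s * my * X = a * (k * (1 + X * X)) / 2).
      { apply Rmult_eq_reg_l with (- / a * 2); [|apply Rlt_not_eq; apply Rmult_lt_reg_r with a;
          [lra|]; replace (- / a * 2 * a) with (-2) by (field; lra); lra].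
        replace (- / a * 2 * (a * (k * (1 + X * X)) / 2)) with (- (k * (1 + X * X))) by (field; lra).
        replace (- (k * (1 + X * X))) with (- (k * (1 + (s * s) * (X * X)))) by (rewrite Hss; ring).
        lra. }
      assert (G2 : s * mx * X = 0).
      { apply Rmult_eq_reg_l with (- / a * 2); [|apply Rlt_not_eq; apply Rmult_lt_reg_r with a;
          [lra|]; replace (- / a * 2 * a) with (-2) by (field; lra); lra].
        lra. }
      f_equal.
      - replace mx with (s * (s * mx * X) / X).
        + rewrite G2. field. lra.
        + replace (s * (s * mx * X)) with (s * s * mx * X) by ring. rewrite Hss. field. lra.
      - replace my with (s * (s * my * X) / X).
        + rewrite G1. field. lra.
        + replace (s * (s * my * X)) with (s * s * my * X) by ring. rewrite Hss. field. lra. }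
    exists X. split; [exact HX|].
    fold m. rewrite Em, <- Ew, <- cexp_opp.
    change (Im (cexp (- L) - (0, s * (a * k * (1 + X * X) / (2 * X))))) with
      (exp (- Re L) * sin (- Im L) + - (s * (a * k * (1 + X * X) / (2 * X)))).
    rewrite sin_neg, HL. destruct (cos_sign s b Hss) as [_ ->].
    replace (exp (- Re L)) with (Rpower X a).
    2:{ unfold Rpower, X. rewrite ln_exp. f_equal. fold u. field. lra. }
    assert (Sb : 0 < sin b) by (apply sin_gt_0; lra).
    assert (KR : 0 < Rpower X a) by apply exp_pos.
    replace (Rpower X a * - (s * sin b) + - (s * (a * k * (1 + X * X) / (2 * X))))
      with (- s * (Rpower X a * sin b + k * (a * (X + / X) / 2))) by (field; lra).
    rewrite Rabs_mult, Rabs_Ropp.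
    assert (As : Rabs s = 1).
    { assert (F : Rabs s * Rabs s = 1) by (rewrite <- Rabs_mult, Hss; apply Rabs_R1).
      assert (K := Rabs_pos s). nra. }
    rewrite As, Rmult_1_l. unfold boundary_height. fold b.
    eapply Rle_trans; [|apply Rle_abs].
    assert (0 < / X) by now apply Rinv_0_lt_compat.
    assert (0 < a * (X + / X) / 2) by (apply Rdiv_lt_0_compat; [apply Rmult_lt_0_compat|]; lra).
    nra.
Qed.


(** Let r be the largest radius of an open disk mapped into the sector. If the closed disk of radius
    r were mapped into it too, a Lebesgue number would allow a larger radius. *)
Lemma first_exit (c : R) (q : C -> C) : 0 <= c < 1 -> hol q -> q (RtoC 0) = 1 ->
  (exists z, Cmod z < 1 /\ ~ sector c (q z)) ->
  exists z0, 0 < Cmod z0 < 1 /\ ~ sector c (q z0) /\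
    forall z, Cmod z < Cmod z0 -> sector c (q z).
Proof.
  intros Hc Hq Hq0 [z1 [Hz1 N1]].
  set (S := fun r => forall z, Cmod z < r -> sector c (q z)).
  destruct (completeness S) as [r [Hub Hlub]].
  - exists (Cmod z1). intros r Hr. apply Rnot_lt_le. intros L. apply N1, Hr, L.
  - exists 0. intros z Hz. generalize (Cmod_ge_0 z). lra.
  - assert (Hr1 : r <= Cmod z1).
    { apply Hlub. intros t Ht. apply Rnot_lt_le. intros L. apply N1, Ht, L. }
    assert (Hr0 : 0 <= r) by (apply Hub; intros z Hz; generalize (Cmod_ge_0 z); lra).
    assert (Hin : S r).
    { intros z Hz. apply NNPP. intros N.
      assert (r <= Cmod z); [|lra]. apply Hlub. intros t Ht. apply Rnot_lt_le.
      intros L. apply N, Ht, L. }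
    assert (Hopen : forall z, Cmod z < 1 -> sector c (q z) -> exists d, 0 < d /\
       forall w, Cmod (w - z) < 2 * d -> sector c (q w)).
    { intros z Hz Sz. destruct (sector_open c (q z)) as [e [He Hw]]; [lra|exact Sz|].
      destruct (hol_cont q Hq z Hz e He) as [d [Hd H]].
      exists (d / 2). split; [lra|]. intros w Bw. apply Hw, H. lra. }
    assert (Hbad : exists z0, Cmod z0 <= r /\ ~ sector c (q z0)).
    { apply NNPP. intros N.
      destruct (lebesgue_number_disk r (fun z d => forall w, Cmod (w - z) < 2 * d -> sector c (q w)))
        as [d [Hd H]].
      { intros z Hz. apply Hopen; [lra|]. apply NNPP. intros Nz. apply N. now exists z. }
      assert (S (r + d)); [|specialize (Hub _ H0); lra].
      intros z Hz.
      assert (Hp : exists p, Cmod p <= r /\ Cmod (z - p) < d).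
      { destruct (Rle_or_lt (Cmod z) r) as [L|L].
        - exists z. split; [exact L|]. replace (z - z)%C with (RtoC 0) by ring.
          now rewrite Cmod_0.
        (* A point slightly outside is compared with its radial projection to the circle of radius
           r. *)
        - exists (RtoC (r / Cmod z) * z)%C.
          assert (E : Cmod (RtoC (r / Cmod z) * z) = r).
          { rewrite Cmod_mult, Cmod_R, Rabs_right.
            - field. lra.
            - apply Rle_ge, Rdiv_le_0_compat; lra. }
          split; [lra|].
          replace (z - RtoC (r / Cmod z) * z)%C with (RtoC (1 - r / Cmod z) * z)%C
            by (rewrite RtoC_minus; ring).
          assert (r / Cmod z < 1).
          { apply Rmult_lt_reg_r with (Cmod z); [lra|]. unfold Rdiv.
            rewrite Rmult_assoc, Rinv_l; lra. }
          rewrite Cmod_mult, Cmod_R, Rabs_right by lra.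
          replace ((1 - r / Cmod z) * Cmod z) with (Cmod z - r) by (field; lra). lra. }
      destruct Hp as [p [Hp1 Hp2]]. destruct (H p Hp1) as [y [dl [H1 [H2 H3]]]].
      apply H3. replace (z - y)%C with ((z - p) + (p - y))%C by ring.
      eapply Rle_lt_trans; [apply Cmod_triangle|]. lra. }
    destruct Hbad as [z0 [Hz0 Nz0]].
    assert (E : Cmod z0 = r).
    { apply Rle_antisym; [exact Hz0|]. apply Rnot_lt_le. intros L. apply Nz0, Hin, L. }
    exists z0. split; [|split; [exact Nz0|now rewrite E]].
    split; [|lra].
    apply Cmod_gt_0. intros ->. apply Nz0. rewrite Hq0.
    unfold sector. rewrite Cmod_1. simpl. lra.
Qed.

(** * The reciprocal of the starlike quotient and its differential equation *)

Definition rec_quotient (f : C -> C) (z : C) : C := (divz f z / C_derive f z)%C.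

Lemma hol_rec_quotient (f : C -> C) : hol f ->
  (forall z, Cmod z < 1 -> C_derive f z <> 0) -> hol (rec_quotient f).
Proof. intros Hf N. apply hol_div; [now apply hol_divz|now apply hol_C_derive|exact N]. Qed.

(** With d = f / z one has z d' = f' - d. In the quotient rule for d / f' the terms containing f''
    cancel against those of phi f. *)
Lemma rec_quotient_ode (f : C -> C) : hol f -> f (RtoC 0) = 0 ->
  (forall z, Cmod z < 1 -> C_derive f z <> 0) ->
  forall z, Cmod z < 1 ->
    (z * C_derive (rec_quotient f) z + rec_quotient f z * phi f z = 1)%C.
Proof.
  intros Hf H0 N z Hz.
  assert (Hd := hol_divz f Hf). assert (Hf' := hol_C_derive f Hf).
  assert (E : C_derive f z = (divz f z + z * C_derive (divz f) z)%C).
  { apply cder_C_derive. apply cder_ext with (fun z => z * divz f z)%C.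
    - intros w. rewrite (divz_spec f w), H0. ring.
    - eapply cder_eq; [|apply (cder_mult (fun z => z)); [apply cder_id|now apply hol_cder]].
      ring. }
  assert (Eq := cder_C_derive _ _ _
    (cder_div _ _ z _ _ (N z Hz) (hol_cder _ z Hd Hz) (hol_cder _ z Hf' Hz))).
  change (fun w => (divz f w / C_derive f w)%C) with (rec_quotient f) in Eq. rewrite Eq.
  unfold rec_quotient, phi.
  assert (E' : (z * C_derive (divz f) z)%C = (C_derive f z - divz f z)%C) by (rewrite E; ring).
  transitivity ((z * C_derive (divz f) z * C_derive f z - z * divz f z * C_derive (C_derive f) z)
     / (C_derive f z * C_derive f z) +
     divz f z / C_derive f z * (1 + z * C_derive (C_derive f) z / C_derive f z))%C.
  - field. now apply N.
  - rewrite E'. field. now apply N.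
Qed.

Lemma starlike_quotient_rec (f : C -> C) (z : C) : f (RtoC 0) = 0 -> C_derive f 0 = 1 ->
  divz f z <> 0 -> C_derive f z <> 0 -> starlike_quotient f z = (/ rec_quotient f z)%C.
Proof.
  intros H0 H1 Nd Nf. unfold starlike_quotient, rec_quotient.
  destruct (Ceq_dec z 0) as [->|N].
  - rewrite divz_0, H1. field.
  - rewrite (divz_spec f z), H0. field. auto.
Qed.

Lemma sector_inv (c : R) (w : C) : w <> 0 -> sector c w -> sector c (/ w).
Proof.
  intros N H. unfold sector in *. rewrite Cmod_inv by exact N.
  assert (K := proj1 (Cmod_gt_0 w) N). assert (E := Cmod_sqr w).
  replace (Re (/ w)) with (Re w / (Cmod w * Cmod w)).
  - apply Rmult_lt_reg_r with (Cmod w * Cmod w); [nra|].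
    replace (c * / Cmod w * (Cmod w * Cmod w)) with (c * Cmod w) by (field; lra).
    replace (Re w / (Cmod w * Cmod w) * (Cmod w * Cmod w)) with (Re w) by (field; lra).
    exact H.
  - rewrite E. destruct w as [x y]. unfold Cinv; simpl. unfold Rdiv. do 2 f_equal. ring.
Qed.

Lemma sector_0 (c : R) : ~ sector c 0.
Proof. unfold sector. rewrite Cmod_0. simpl. lra. Qed.

(* At a zero of q the equation gives z q'(z) = 1, so q is negative just before
   on the radius through z. *)
Lemma exit_point_neq_0 (q : C -> C) (z l : C) : cder q z l -> (z * l)%C = 1 ->
  (forall t, 0 <= t < 1 -> 0 < Re (q (RtoC t * z)%C)) -> q z <> 0.
Proof.
  intros Hd E H N.
  assert (P : pder (fun t => q (0 + RtoC t * z)%C) 1 (l * z)).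
  { apply (pder_comp_cder q (fun t => 0 + RtoC t * z)%C); [|apply pder_affine].
    replace (0 + RtoC 1 * z)%C with z by ring. exact Hd. }
  destruct (P (/ 2)) as [d [Hd0 HP]]; [lra|].
  set (t := 1 - Rmin (/ 2) (d / 2)).
  assert (H1 : Rmin (/ 2) (d / 2) <= / 2) by apply Rmin_l.
  assert (H2 : Rmin (/ 2) (d / 2) <= d / 2) by apply Rmin_r.
  assert (H3 : 0 < Rmin (/ 2) (d / 2)) by (apply Rmin_pos; lra).
  assert (Et : Rabs (t - 1) = 1 - t) by (rewrite Rabs_left; unfold t; lra).
  specialize (HP t). rewrite Et in HP. specialize (HP ltac:(unfold t; lra)).
  replace (0 + RtoC t * z)%C with (RtoC t * z)%C in HP by ring.
  replace (0 + RtoC 1 * z)%C with z in HP by ring. rewrite N in HP.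
  replace (RtoC (t - 1) * (l * z))%C with (RtoC (t - 1)) in HP
    by (rewrite (Cmult_comm l z), E; ring).
  assert (R := re_le_Cmod (q (RtoC t * z)%C - 0 - RtoC (t - 1))).
  assert (Ht := H t ltac:(unfold t; lra)).
  replace (Re (q (RtoC t * z)%C - 0 - RtoC (t - 1))) with (Re (q (RtoC t * z)%C) - (t - 1)) in R
    by (unfold Cminus, Cplus, Copp, RtoC; simpl; unfold Re; ring).
  apply Rabs_le_between in R. unfold t in *. lra.
Qed.

(** At the exit point the limit along the radius stays in the closed sector; together with the
    failure of the open condition this yields equality. *)
Lemma sector_closure (c : R) (f : R -> C) : pcont f 1 -> 0 <= c <= 1 ->
  (forall t, 0 <= t < 1 -> sector c (f t)) -> c * Cmod (f 1) <= Re (f 1).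
Proof.
  intros Hf Hc H. apply le_epsilon. intros e He.
  destruct (Hf (e / 2)) as [d [Hd Hw]]; [lra|].
  set (t := 1 - Rmin (/ 2) (d / 2)).
  assert (H1 : Rmin (/ 2) (d / 2) <= / 2) by apply Rmin_l.
  assert (H2 : Rmin (/ 2) (d / 2) <= d / 2) by apply Rmin_r.
  assert (H3 : 0 < Rmin (/ 2) (d / 2)) by (apply Rmin_pos; lra).
  specialize (Hw t). rewrite Rabs_left in Hw by (unfold t; lra).
  specialize (Hw ltac:(unfold t; lra)).
  specialize (H t ltac:(unfold t; lra)). unfold sector in H.
  assert (R := re_le_Cmod (f t - f 1)). simpl in R. apply Rabs_le_between in R.
  assert (L := Cmod_triangle_inv (f 1) (f t)). rewrite Cmod_minus_sym in L.
  unfold Re in *. assert (K := Cmod_ge_0 (f t - f 1)). nra.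
Qed.

Lemma strongly_starlike_of_strip (a g : R) (f : C -> C) : 0 < a < 1 ->
  (forall X, 0 < X -> g <= boundary_height a X) ->
  classA1 f -> phi_maps_into f (strip g) -> strongly_starlike a f.
Proof.
  intros Ha Hg Hf Hphi. destruct Hf as [Hf [Hf0 Hf1]].
  assert (Hh := proj1 (holomorphic_on_disk_hol f) Hf).
  assert (N : forall z, Cmod z < 1 -> C_derive f z <> 0) by (intros z Hz; apply Hphi, Hz).
  set (q := rec_quotient f).
  assert (Hq : hol q) by now apply hol_rec_quotient.
  assert (Hode := rec_quotient_ode f Hh Hf0 N). fold q in Hode.
  assert (Hq0 : q (RtoC 0) = 1).
  { unfold q, rec_quotient. rewrite divz_0, Hf1. field. }
  set (c := cos (PI * a / 2)). assert (Hc := cos_half_PI_mult a Ha). fold c in Hc.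
  assert (Hsec : forall z, Cmod z < 1 -> sector c (q z)).
  { intros z Hz. apply NNPP. intros Nz.
    destruct (first_exit c q) as [z0 [Hz0 [Nz0 Hin]]]; [lra|exact Hq|exact Hq0|exact (ex_intro _ z (conj Hz Nz))|].
    assert (Dq := hol_cder q z0 Hq (proj2 Hz0)). set (l := C_derive q z0) in *.
    assert (Eo := Hode z0 (proj2 Hz0)). fold l in Eo.
    assert (Hray : forall w, Cmod w < 1 -> sector c (q (w * z0)%C)).
    { intros w Hw. apply Hin. rewrite Cmod_mult. nra. }
    assert (Ht : forall t, 0 <= t < 1 -> sector c (q (RtoC t * z0)%C)).
    { intros t Ht. apply Hray. rewrite Cmod_R, Rabs_right; lra. }
    assert (Nq : q z0 <> 0).
    { intros E.
      assert (E1 : (z0 * l)%C = 1).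
      { rewrite <- Eo, E. ring. }
      exact (exit_point_neq_0 q z0 l Dq E1
        (fun t Ht' => sector_Re_pos c _ (Rlt_le _ _ (proj1 Hc)) (Ht t Ht')) E). }
    (* Rescaling moves the exit point to 1 and the disk |z| < |z0| to the unit disk. *)
    set (k := fun w => q (w * z0)%C).
    assert (Dw : forall w, cder (fun w => w * z0)%C w z0).
    { intros w. eapply cder_eq; [|apply (cder_mult (fun w => w) (fun _ => z0));
        [apply cder_id|apply cder_const]]. ring. }
    assert (Ek : k (RtoC 1) = q z0) by (unfold k; f_equal; ring).
    assert (Dk : cder k 1 (l * z0)).
    { apply (cder_comp q (fun w => w * z0)%C); [|apply Dw].
      replace (1 * z0)%C with z0 by ring. exact Dq. }
    assert (Hk : hol k).
    { intros w Hw. destruct (Hq (w * z0)%C) as [m Hm]; [rewrite Cmod_mult; nra|].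
      exists (m * z0)%C. apply (cder_comp q (fun w => w * z0)%C); [exact Hm|apply Dw]. }
    assert (Hk0 : k (RtoC 0) = 1).
    { unfold k. replace (0 * z0)%C with (RtoC 0) by ring. exact Hq0. }
    assert (Eb : Re (k (RtoC 1)) = c * Cmod (k (RtoC 1))).
    { apply Rle_antisym.
      - apply Rnot_lt_le. rewrite Ek. exact Nz0.
      - apply (sector_closure c (fun t => k (RtoC t))); [|lra|exact Ht].
        apply (pcont_comp k RtoC); [exact (cder_cont _ _ _ Dk)|apply pcont_RtoC]. }
    assert (Nk : k (RtoC 1) <> 0) by (rewrite Ek; exact Nq).
    destruct (first_exit_height a k (l * z0) Ha Hk Hk0 Hray Dk Nk Eb) as [X [HX HB]].
    assert (S := proj2 (Hphi z0 (proj2 Hz0))). unfold strip in S.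
    rewrite Ek in HB.
    (* The differential equation solved for phi f at z0. *)
    replace (/ q z0 - l * z0 / q z0)%C with (phi f z0) in HB.
    - specialize (Hg X HX). lra.
    - transitivity ((z0 * l + q z0 * phi f z0) / q z0 - l * z0 / q z0)%C.
      + field. exact Nq.
      + rewrite Eo. field. exact Nq. }
  split; [exact (conj Hf (conj Hf0 Hf1))|].
  intros z Hz. assert (Hz' : Cmod z < 1) by exact Hz.
  assert (Sz := Hsec z Hz').
  assert (Nq : q z <> 0).
  { intros E. rewrite E in Sz. exact (sector_0 c Sz). }
  assert (Nd : divz f z <> 0).
  { intros E. apply Nq. unfold q, rec_quotient. rewrite E. unfold Cdiv. ring. }
  rewrite (starlike_quotient_rec f z Hf0 Hf1 Nd (N z Hz')). fold q.
  assert (Ni : (/ q z)%C <> 0).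
  { apply Cmod_gt_0. rewrite Cmod_inv by exact Nq. apply Rinv_0_lt_compat. now apply Cmod_gt_0. }
  split; [|split; [exact Ni|]].
  - intros Nz. rewrite (divz_spec f z), Hf0. replace (0 + z * divz f z)%C with (z * divz f z)%C by ring.
    now apply Cmult_neq_0.
  - assert (HPI := PI_RGT_0). apply Carg_sector; [nra|exact Ni|]. now apply sector_inv.
Qed.


(** * Taylor coefficients at the origin *)

(** The n-th Taylor coefficient at 0, read off as the constant term after n backward shifts. *)
Fixpoint coef (n : nat) (h : C -> C) : C :=
  match n with O => h (RtoC 0) | S m => coef m (divz h) end.

(** The Cauchy product a_0 b_n + ... + a_n b_0; the recursion shifts a, in step with [coef]. *)
Fixpoint conv (n : nat) (a b : nat -> C) : C :=
  match n with
  | O => (a O * b O)%C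
  | S m => (a O * b (S m) + conv m (fun k => a (S k)) b)%C
  end.

Lemma coef_ext (n : nat) (f g : C -> C) : hol f ->
  (forall z, Cmod z < 1 -> f z = g z) -> coef n f = coef n g.
Proof.
  revert f g. induction n as [|n IH]; intros f g Hf E; simpl.
  - apply E, Cmod_0_lt_1.
  - symmetry. apply IH.
    + apply hol_divz. now apply hol_ext with f.
    + apply divz_unique with (f (RtoC 0)); [now apply hol_divz|].
      intros z Hz. rewrite <- E by exact Hz. apply divz_spec.
Qed.

Lemma coef_const (n : nat) (c : C) : coef n (fun _ => c) = match n with O => c | _ => 0 end.
Proof.
  destruct n as [|n]; [reflexivity|]. simpl.
  rewrite <- (coef_ext n (fun _ => RtoC 0)).
  - induction n as [|n IH]; [reflexivity|]. simpl.
    transitivity (coef n (fun _ => RtoC 0)); [|exact IH]. symmetry. apply coef_ext; [apply hol_const|]. intros z Hz. symmetry.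
    apply (divz_unique _ (fun _ => RtoC 0) (RtoC 0)); [apply hol_const| |exact Hz]. intros; ring.
  - apply hol_const.
  - intros z Hz. symmetry. apply (divz_unique _ (fun _ => RtoC 0) c); [apply hol_const| |exact Hz]. intros; ring.
Qed.

Lemma coef_mul_z (n : nat) (h : C -> C) : hol h ->
  coef n (fun z => z * h z)%C = match n with O => 0 | S m => coef m h end.
Proof.
  intros Hh. destruct n as [|n]; simpl; [ring|].
  symmetry. apply coef_ext; [exact Hh|]. intros z Hz. symmetry.
  apply divz_unique with (RtoC 0); [exact Hh| |exact Hz]. intros; ring.
Qed.

Lemma coef_plus (n : nat) (f g : C -> C) : hol f -> hol g ->
  coef n (fun z => f z + g z)%C = (coef n f + coef n g)%C.
Proof.
  revert f g. induction n as [|n IH]; intros f g Hf Hg; simpl; [reflexivity|].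
  rewrite <- IH by now apply hol_divz.
  symmetry. apply coef_ext; [apply hol_plus; now apply hol_divz|]. intros z Hz. symmetry.
  apply (divz_unique _ (fun z => divz f z + divz g z)%C (f (RtoC 0) + g (RtoC 0))%C); [apply hol_plus; now apply hol_divz| |exact Hz].
  intros w _. rewrite (divz_spec f w), (divz_spec g w) at 1. ring.
Qed.

(** The identity divz (f g) = f(0) divz g + (divz f) g reproduces the recursion of [conv]. *)
Lemma coef_mult (n : nat) (f g : C -> C) : hol f -> hol g ->
  coef n (fun z => f z * g z)%C = conv n (fun k => coef k f) (fun k => coef k g).
Proof.
  revert f. induction n as [|n IH]; intros f Hf Hg; simpl; [reflexivity|].
  assert (H1 := hol_divz f Hf). assert (H2 := hol_divz g Hg).
  assert (Hs : hol (fun z => f (RtoC 0) * divz g z + divz f z * g z)%C).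
  { apply hol_plus; apply hol_mult; auto. apply hol_const. }
  rewrite <- (coef_ext n (fun z => f (RtoC 0) * divz g z + divz f z * g z)%C _ Hs).
  - rewrite coef_plus, (IH (divz f)); auto.
    2: apply hol_mult; auto; apply hol_const.
    2: apply hol_mult; auto.
    f_equal. clear IH H1 Hs. revert H2. generalize (divz g). intros k Hk.
    generalize (f (RtoC 0)). intros c. clear - Hk. revert k Hk.
    induction n as [|n IH]; intros k Hk; simpl; [reflexivity|].
    rewrite <- IH by now apply hol_divz.
    symmetry. apply coef_ext.
    + apply hol_mult; [apply hol_const|now apply hol_divz].
    + intros z Hz. symmetry. apply (divz_unique _ (fun z => c * divz k z)%C (c * k (RtoC 0))%C); [|intros w _|exact Hz].
      * apply hol_mult; [apply hol_const|now apply hol_divz].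
      * rewrite (divz_spec k w) at 1. ring.
  - intros z Hz. symmetry. apply (divz_unique _ _ (f (RtoC 0) * g (RtoC 0))%C Hs); [|exact Hz].
    intros w _. rewrite (divz_spec f w), (divz_spec g w) at 1.
    transitivity (f (RtoC 0) * g (RtoC 0) + w * (f (RtoC 0) * divz g w
       + divz f w * (g (RtoC 0) + w * divz g w)))%C; [ring|].
    now rewrite <- (divz_spec g w).
Qed.

Lemma coef_scal (n : nat) (c : C) (f : C -> C) : hol f ->
  coef n (fun z => c * f z)%C = (c * coef n f)%C.
Proof.
  revert f. induction n as [|n IH]; intros f Hf; simpl; [reflexivity|].
  assert (Hs : hol (fun z => c * divz f z)%C)
    by (apply hol_mult; [apply hol_const|now apply hol_divz]).
  rewrite <- IH by now apply hol_divz.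
  symmetry. apply coef_ext; [exact Hs|]. intros z Hz. symmetry.
  apply (divz_unique _ _ (c * f (RtoC 0))%C Hs); [|exact Hz].
  intros w _. rewrite (divz_spec f w) at 1. ring.
Qed.

Lemma coef_minus (n : nat) (f g : C -> C) : hol f -> hol g ->
  coef n (fun z => f z - g z)%C = (coef n f - coef n g)%C.
Proof.
  intros Hf Hg.
  rewrite <- (coef_ext n (fun z => f z + - (1) * g z)%C).
  - rewrite coef_plus, coef_scal; auto; [ring|]. apply hol_mult; [apply hol_const|exact Hg].
  - apply hol_plus; [exact Hf|]. apply hol_mult; [apply hol_const|exact Hg].
  - intros z _. ring.
Qed.

(** Differentiating h = h(0) + z divz h gives h' = divz h + z (divz h)', so every shift adds one
    copy of the coefficient. *)
Lemma coef_zderiv (n : nat) (h : C -> C) : hol h ->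
  coef n (fun z => z * C_derive h z)%C = (RtoC (INR n) * coef n h)%C.
Proof.
  intros Hh. rewrite coef_mul_z by now apply hol_C_derive.
  revert h Hh. induction n as [|n IH]; intros h Hh; [simpl; ring|].
  assert (Hd := hol_divz h Hh).
  assert (H1 : hol (fun z => z * C_derive (divz h) z)%C)
    by (apply hol_mult; [apply hol_id|now apply hol_C_derive]).
  rewrite <- (coef_ext n (fun z => divz h z + z * C_derive (divz h) z)%C).
  - rewrite coef_plus, coef_mul_z, IH, S_INR, RtoC_plus; auto; [simpl; ring|].
    now apply hol_C_derive.
  - now apply hol_plus.
  - intros z Hz. symmetry. apply cder_C_derive.
    apply cder_ext with (fun z => h (RtoC 0) + z * divz h z)%C.
    + intros w. symmetry. apply divz_spec.
    + eapply cder_eq; [|apply cder_plus; [apply cder_const|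
        apply (cder_mult (fun z => z)); [apply cder_id|now apply hol_cder]]].
      ring.
Qed.

Lemma hol_neg (h : C -> C) : hol h -> hol (fun z => h (- z)%C).
Proof.
  intros Hh. apply (hol_comp h Copp); [exact Hh| |].
  - intros z _. exists (- (1))%C. apply (cder_opp (fun z => z)), cder_id.
  - intros z Hz. now rewrite Cmod_opp.
Qed.

Lemma coef_neg (n : nat) (h : C -> C) : hol h ->
  coef n (fun z => h (- z)%C) = (RtoC ((-1) ^ n) * coef n h)%C.
Proof.
  revert h. induction n as [|n IH]; intros h Hh; simpl.
  - replace (- 0)%C with (RtoC 0) by ring. ring.
  - assert (Hs : hol (fun z => - (1) * divz h (- z))%C)
      by (apply hol_mult; [apply hol_const|apply (hol_neg (divz h)); now apply hol_divz]).
    rewrite <- (coef_ext n _ _ Hs).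
    + rewrite coef_scal, IH, RtoC_mult; [|now apply hol_divz|apply (hol_neg (divz h)); now apply hol_divz].
      replace (RtoC (-1)) with (- (1))%C by (unfold Copp, RtoC; simpl; f_equal; ring). ring.
    + intros z Hz. symmetry. apply (divz_unique _ _ (h (RtoC 0)) Hs); [|exact Hz].
      intros w _. rewrite (divz_spec h (- w)) at 1. ring.
Qed.


Ltac RtoC_solve :=
  unfold Cminus, Cplus, Copp, Cmult, RtoC; simpl; f_equal; [try field; try lra|try ring].

Lemma Csolve (r y : R) (x : C) : r <> 0 -> (RtoC r * x)%C = RtoC y -> x = RtoC (y / r).
Proof.
  intros Hr E. assert (N : RtoC r <> 0) by (intros F; now apply RtoC_inj in F).
  rewrite RtoC_div, <- E by exact Hr. field. exact N.
Qed.

Lemma Cconj_R (r : R) : Cconj (RtoC r) = RtoC r.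
Proof. unfold Cconj, RtoC; simpl. f_equal. ring. Qed.

(* The odd part is averaged away, after which two Schwarz steps apply. *)
Lemma even_coef_bound (k : C -> C) (a0 a2 : R) : hol k ->
  (forall z, Cmod z < 1 -> Cmod (k z) <= 1) -> coef 0 k = RtoC a0 -> coef 2 k = RtoC a2 ->
  Rabs a0 < 1 -> Rabs a2 <= 1 - a0 * a0.
Proof.
  intros Hk Hb H0 H2 Ha.
  set (e := fun z => (RtoC (/ 2) * (k z + k (- z)))%C).
  assert (Hn := hol_neg k Hk).
  assert (Hs : hol (fun z => k z + k (- z))%C) by now apply hol_plus.
  assert (He : hol e) by (apply hol_mult; [apply hol_const|exact Hs]).
  assert (Ce : forall n, coef n e = (RtoC (/ 2) * (coef n k + RtoC ((-1) ^ n) * coef n k))%C).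
  { intros n. unfold e. rewrite (coef_scal n _ _ Hs), (coef_plus n _ _ Hk Hn), coef_neg by exact Hk.
    reflexivity. }
  assert (E0 : coef 0 e = RtoC a0) by (rewrite Ce, H0; RtoC_solve).
  assert (E1 : coef 1 e = 0).
  { rewrite Ce. replace ((-1) ^ 1) with (- 1) by ring.
    replace (RtoC (- 1)) with (- (1))%C by (unfold Copp, RtoC; simpl; f_equal; ring). ring. }
  assert (E2 : coef 2 e = RtoC a2) by (rewrite Ce, H2; RtoC_solve).
  destruct (schur_step e (RtoC a0) He E0) as [f [Hf [Fb Ef]]].
  - now rewrite Cmod_R.
  - intros z Hz. unfold e. rewrite Cmod_mult, Cmod_R, Rabs_right by lra.
    assert (T := Cmod_triangle (k z) (k (- z)%C)).
    assert (Hb1 := Hb z Hz). assert (Hb2 := Hb (- z)%C). rewrite Cmod_opp in Hb2.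
    specialize (Hb2 Hz). lra.
  - rewrite Cconj_R in Ef.
    set (D := fun z => (1 - RtoC a0 * e z)%C).
    assert (HD : hol D).
    { apply hol_minus; [apply hol_const|]. apply hol_mult; [apply hol_const|exact He]. }
    assert (HfD : hol (fun z => f z * D z)%C) by now apply hol_mult.
    assert (CD : forall n, coef n D = (match n with O => RtoC 1 | _ => RtoC 0 end - RtoC a0 * coef n e)%C).
    { intros n. unfold D. rewrite coef_minus, coef_const, coef_scal; auto. apply hol_const.
      apply hol_mult; [apply hol_const|exact He]. }
    assert (R : forall n, coef (S n) e = coef n (fun z => f z * D z)%C).
    { intros n. simpl. symmetry. apply coef_ext; [exact HfD|]. intros z Hz. symmetry.
      apply (divz_unique _ _ (RtoC a0) HfD); [|exact Hz].
      intros w Hw. unfold D. transitivity (RtoC a0 + (e w - RtoC a0))%C; [ring|].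
      rewrite Ef by exact Hw. ring. }
    assert (Np : 0 < 1 - a0 * a0) by (apply Rabs_def2 in Ha; nra).
    assert (R0 := R O). assert (R1 := R 1%nat).
    rewrite coef_mult in R0, R1 by assumption. cbn [conv] in R0, R1.
    rewrite (CD O), E0 in R0. rewrite (CD 1%nat), (CD O), E0, E1 in R1. rewrite E1 in R0. rewrite E2 in R1.
    assert (F0 : coef 0 f = RtoC (0 / (1 - a0 * a0))).
    { apply Csolve; [lra|]. rewrite R0. rewrite !RtoC_minus, !RtoC_mult. ring. }
    unfold Rdiv in F0. rewrite Rmult_0_l in F0. rewrite F0 in R1.
    assert (F1 : coef 1 f = RtoC (a2 / (1 - a0 * a0))).
    { apply Csolve; [lra|]. rewrite R1. rewrite !RtoC_minus, !RtoC_mult. ring. }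
    (* Since e has no linear term, f vanishes at 0 and the Schwarz lemma bounds its first
       coefficient a2 / (1 - a0^2). *)
    assert (B := schwarz f Hf F0 Fb 0 Cmod_0_lt_1).
    change (divz f 0) with (coef 1 f) in B. rewrite F1, Cmod_R in B.
    unfold Rdiv in B. rewrite Rabs_mult, (Rabs_right (/ (1 - a0 * a0))) in B.
    2:{ apply Rle_ge, Rlt_le, Rinv_0_lt_compat, Np. }
    apply Rmult_le_compat_r with (r := 1 - a0 * a0) in B; [|lra].
    rewrite Rmult_assoc, Rinv_l, Rmult_1_r in B by lra. lra.
Qed.

(** Let o = om / z and let k be given by o - w1 = z k (1 - w1 o). Comparing coefficients shows that
    a0, a1, a2 are the first three coefficients of k. *)
Lemma schwarz_coef_bound (om : C -> C) (w1 w2 w3 w4 : R) : hol om ->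
  (forall z, Cmod z < 1 -> Cmod (om z) <= 1) -> coef 0 om = 0 ->
  coef 1 om = RtoC w1 -> coef 2 om = RtoC w2 -> coef 3 om = RtoC w3 -> coef 4 om = RtoC w4 ->
  Rabs w1 < 1 ->
  let a0 := w2 / (1 - w1 * w1) in
  let a1 := (w3 + w1 * w2 * a0) / (1 - w1 * w1) in
  let a2 := (w4 + w1 * w2 * a1 + w1 * w3 * a0) / (1 - w1 * w1) in
  Rabs a0 < 1 -> Rabs a2 <= 1 - a0 * a0.
Proof.
  intros Hom Hb H0 H1 H2 H3 H4 Hw a0 a1 a2 Ha0.
  set (o := divz om).
  assert (Ho : hol o) by now apply hol_divz.
  assert (Hob : forall z, Cmod z < 1 -> Cmod (o z) <= 1) by now apply schwarz.
  change (coef 0 o = RtoC w1) in H1. change (coef 1 o = RtoC w2) in H2.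
  change (coef 2 o = RtoC w3) in H3. change (coef 3 o = RtoC w4) in H4.
  destruct (schur_step o (RtoC w1) Ho H1) as [k [Hk [Kb Ek]]].
  - now rewrite Cmod_R.
  - exact Hob.
  - rewrite Cconj_R in Ek.
    set (D := fun z => (1 - RtoC w1 * o z)%C).
    assert (HD : hol D).
    { apply hol_minus; [apply hol_const|]. apply hol_mult; [apply hol_const|exact Ho]. }
    assert (HkD : hol (fun z => k z * D z)%C) by now apply hol_mult.
    assert (CD : forall n, coef n D = (match n with O => RtoC 1 | _ => RtoC 0 end - RtoC w1 * coef n o)%C).
    { intros n. unfold D. rewrite coef_minus, coef_const, coef_scal; auto. apply hol_const.
      apply hol_mult; [apply hol_const|exact Ho]. }
    assert (R : forall n, coef (S n) o = coef n (fun z => k z * D z)%C).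
    { intros n. simpl. symmetry. apply coef_ext; [exact HkD|]. intros z Hz. symmetry.
      apply (divz_unique _ _ (RtoC w1) HkD); [|exact Hz].
      intros w Hw'. unfold D. transitivity (RtoC w1 + (o w - RtoC w1))%C; [ring|].
      rewrite Ek by exact Hw'. ring. }
    assert (Np : 0 < 1 - w1 * w1) by (apply Rabs_def2 in Hw; nra).
    assert (R0 := R O). assert (R1 := R 1%nat). assert (R2 := R 2%nat).
    rewrite coef_mult in R0, R1, R2 by assumption. cbn [conv] in R0, R1, R2.
    rewrite (CD O), H1, H2 in R0. rewrite (CD O), (CD 1%nat), H1, H2, H3 in R1.
    rewrite (CD O), (CD 1%nat), (CD 2%nat), H1, H2, H3, H4 in R2.
    assert (K0 : coef 0 k = RtoC a0).
    { apply Csolve; [lra|]. rewrite R0, !RtoC_minus, !RtoC_mult. ring. }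
    rewrite K0 in R1, R2.
    assert (K1 : coef 1 k = RtoC a1).
    { apply Csolve; [lra|]. rewrite RtoC_plus, R1, !RtoC_minus, !RtoC_mult. ring. }
    rewrite K1 in R2.
    assert (K2 : coef 2 k = RtoC a2).
    { apply Csolve; [lra|]. rewrite !RtoC_plus, R2, !RtoC_minus, !RtoC_mult. ring. }
    now apply (even_coef_bound k a0 a2).
Qed.

(* The coefficients of z p' = p u and 2 a z w' = u (1 - w^2) with p + u = F. *)
Lemma coef_recurrence (a b : R) (F P U V W : nat -> C) : a <> 0 ->
  let c := 2 * a * b in
  F O = RtoC 1 -> F 1%nat = RtoC (2 * c) -> F 2%nat = RtoC 0 -> F 3%nat = RtoC (2 * c / 3) ->
  F 4%nat = RtoC 0 ->
  P O = RtoC 1 -> (forall n, U n = F n - P n)%C ->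
  (forall n, RtoC (INR n) * P n = conv n P U)%C ->
  W O = RtoC 0 ->
  (forall n, V n = match n with O => RtoC 1 | _ => RtoC 0 end - conv n W W)%C ->
  (forall n, RtoC (2 * a) * (RtoC (INR n) * W n) = conv n U V)%C ->
  W 1%nat = RtoC b /\ W 2%nat = RtoC (- a * b ^ 2 / 3) /\ W 3%nat = RtoC (b / 6 - b ^ 3 / 3) /\
  W 4%nat = RtoC (a * b ^ 4 / 3 - a * b ^ 2 / 15 + 2 / 45 * a ^ 3 * b ^ 4).
Proof.
  intros Ha c F0 F1 F2 F3 F4 P0 HU HP W0 HV HW.
  assert (U0 : U O = RtoC 0) by (rewrite HU, F0, P0; RtoC_solve).
  assert (EP1 := HP 1%nat). assert (EP2 := HP 2%nat). assert (EP3 := HP 3%nat).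
  assert (EP4 := HP 4%nat). cbn [conv] in EP1, EP2, EP3, EP4.
  (* The top term P 0 * U n contains - P n; moving it to the left turns the factor n into n + 1. *)
  assert (step : forall (x : C) (n f r : R), n + 1 <> 0 ->
    (RtoC n * x)%C = (RtoC f - x + RtoC r)%C -> x = RtoC ((f + r) / (n + 1))).
  { intros x n f r N E. apply Csolve; [exact N|]. rewrite RtoC_plus.
    replace ((RtoC n + RtoC 1) * x)%C with (RtoC n * x + x)%C by ring. rewrite E.
    rewrite RtoC_plus. ring. }
  assert (P1 : P 1%nat = RtoC c).
  { replace c with ((2 * c + 0) / (1 + 1)) by field. apply step; [lra|].
    change (INR 1) with 1 in EP1. rewrite EP1, P0, U0, HU, F1. ring. }
  assert (U1 : U 1%nat = RtoC c) by (rewrite HU, F1, P1; RtoC_solve).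
  assert (P2 : P 2%nat = RtoC (c * c / 3)).
  { replace (c * c / 3) with ((0 + c * c) / (2 + 1)) by field. apply step; [lra|].
    replace (INR 2) with 2 in EP2 by (simpl; ring).
    rewrite EP2, P0, U0, U1, P1, (HU 2%nat), F2, RtoC_mult. ring. }
  assert (U2 : U 2%nat = RtoC (- (c * c / 3))) by (rewrite HU, F2, P2; RtoC_solve).
  assert (P3 : P 3%nat = RtoC (c / 6)).
  { replace (c / 6) with ((2 * c / 3 + (c * - (c * c / 3) + c * c / 3 * c)) / (3 + 1)) by field.
    apply step; [lra|]. replace (INR 3) with 3 in EP3 by (simpl; ring).
    rewrite EP3, P0, U0, U1, U2, P1, P2, (HU 3%nat), F3, RtoC_plus, !RtoC_mult. ring. }
  assert (U3 : U 3%nat = RtoC (c / 2)) by (rewrite HU, F3, P3; RtoC_solve).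
  assert (P4 : P 4%nat = RtoC (2 * c * c / 15 - c * c * c * c / 45)).
  { replace (2 * c * c / 15 - c * c * c * c / 45) with
      ((0 + (c * (c / 2) + (c * c / 3 * - (c * c / 3) + c / 6 * c))) / (4 + 1)) by field.
    apply step; [lra|]. replace (INR 4) with 4 in EP4 by (simpl; ring).
    rewrite EP4, P0, U0, U1, U2, U3, P1, P2, P3, (HU 4%nat), F4, !RtoC_plus, !RtoC_mult. ring. }
  assert (U4 : U 4%nat = RtoC (- (2 * c * c / 15 - c * c * c * c / 45)))
    by (rewrite HU, F4, P4; RtoC_solve).
  assert (EW1 := HW 1%nat). assert (EW2 := HW 2%nat). assert (EW3 := HW 3%nat).
  assert (EW4 := HW 4%nat). cbn [conv] in EW1, EW2, EW3, EW4.
  assert (V0 := HV 0%nat). assert (V1 := HV 1%nat). assert (V2 := HV 2%nat).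
  assert (V3 := HV 3%nat). cbn [conv] in V0, V1, V2, V3.
  assert (V0' : V 0%nat = RtoC 1) by (rewrite V0, W0; RtoC_solve).
  assert (V1' : V 1%nat = RtoC 0) by (rewrite V1, W0; ring).
  (* As U 0 = 0, only V 0, ..., V (n - 1) matter, so the right side is already known. *)
  assert (stepW : forall (x : C) (n r : R), n <> 0 ->
    (RtoC (2 * a) * (RtoC n * x))%C = RtoC r -> x = RtoC (r / (2 * a * n))).
  { intros x n r N E. apply Csolve.
    - apply Rmult_integral_contrapositive_currified; [lra|exact N].
    - rewrite <- E, (RtoC_mult (2 * a) n). ring. }
  assert (W1 : W 1%nat = RtoC b).
  { replace b with (c / (2 * a * 1)) by (unfold c; field; exact Ha). apply stepW; [lra|].
    change (INR 1) with 1 in EW1. rewrite EW1, U0, U1, V0'. ring. }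
  assert (W2 : W 2%nat = RtoC (- a * b ^ 2 / 3)).
  { replace (- a * b ^ 2 / 3) with (- (c * c / 3) / (2 * a * 2)) by (unfold c; field; exact Ha).
    apply stepW; [lra|].
    replace (INR 2) with 2 in EW2 by (simpl; ring). rewrite EW2, U0, U1, U2, V0', V1'. ring. }
  assert (V2' : V 2%nat = RtoC (- (b * b))) by (rewrite V2, W0, W1; RtoC_solve).
  assert (V3' : V 3%nat = RtoC (2 * a * b ^ 3 / 3)) by (rewrite V3, W0, W1, W2; RtoC_solve).
  assert (W3 : W 3%nat = RtoC (b / 6 - b ^ 3 / 3)).
  { replace (b / 6 - b ^ 3 / 3) with ((c / 2 + c * - (b * b)) / (2 * a * 3))
      by (unfold c; field; exact Ha).
    apply stepW; [lra|]. replace (INR 3) with 3 in EW3 by (simpl; ring).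
    rewrite EW3, U0, U1, U2, U3, V0', V1', V2', RtoC_plus, RtoC_mult. ring. }
  repeat split; [exact W1|exact W2|exact W3|].
  replace (a * b ^ 4 / 3 - a * b ^ 2 / 15 + 2 / 45 * a ^ 3 * b ^ 4) with
    ((- (2 * c * c / 15 - c * c * c * c / 45) + - (c * c / 3) * - (b * b) + c * (2 * a * b ^ 3 / 3))
      / (2 * a * 4)) by (unfold c; field; exact Ha).
  apply stepW; [lra|]. replace (INR 4) with 4 in EW4 by (simpl; ring).
  rewrite EW4, U0, U1, U2, U3, U4, V0', V1', V2', V3', !RtoC_plus, !RtoC_mult. ring.
Qed.

(** Compare coefficients in z Lam'(z) (1 - z^2) = 2 z. *)
Lemma Lam_coef : coef 1 Lam = RtoC 2 /\ coef 2 Lam = RtoC 0 /\ coef 3 Lam = RtoC (2 / 3) /\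
  coef 4 Lam = RtoC 0.
Proof.
  assert (HL := hol_Lam). assert (HL' := hol_C_derive Lam HL).
  set (d := fun z => (1 - z * z)%C).
  assert (Hzz : hol (fun z => z * z)%C) by (apply hol_mult; apply hol_id).
  assert (Hd : hol d) by (apply hol_minus; [apply hol_const|exact Hzz]).
  assert (Hz : hol (fun z => z * C_derive Lam z)%C) by (apply hol_mult; [apply hol_id|exact HL']).
  assert (Ci : forall n, coef n (fun z => z) = match n with 1%nat => RtoC 1 | _ => RtoC 0 end).
  { intros n. rewrite <- (coef_ext n (fun z => z * 1)%C).
    - rewrite (coef_mul_z n (fun _ => RtoC 1)) by apply hol_const. destruct n; [reflexivity|].
      rewrite coef_const. now destruct n.
    - apply hol_mult; [apply hol_id|apply hol_const].
    - intros z _. ring. }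
  assert (Cd : forall n, coef n d = (match n with O => RtoC 1 | _ => RtoC 0 end -
      match n with 2%nat => RtoC 1 | _ => RtoC 0 end)%C).
  { intros n. unfold d. rewrite (coef_minus n _ _ (hol_const 1) Hzz), coef_const.
    rewrite (coef_mul_z n (fun z => z) hol_id). f_equal. destruct n as [|n]; [reflexivity|].
    rewrite Ci. now destruct n as [|[|]]. }
  assert (E : forall n, conv n (fun k => RtoC (INR k) * coef k Lam)%C (fun k => coef k d) =
     match n with 1%nat => RtoC 2 | _ => RtoC 0 end).
  { intros n. transitivity (coef n (fun z => z * C_derive Lam z * d z)%C).
    - rewrite (coef_mult n _ _ Hz Hd).
      assert (Ez : (fun k => coef k (fun z => z * C_derive Lam z)%C) =
                   (fun k => RtoC (INR k) * coef k Lam)%C).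
      { apply FunctionalExtensionality.functional_extensionality. intros k.
        now apply coef_zderiv. }
      now rewrite Ez.
    - rewrite <- (coef_ext n (fun z => RtoC 2 * z)%C).
      + rewrite (coef_scal n _ _ hol_id), Ci. destruct n as [|[|]]; ring.
      + apply hol_mult; [apply hol_const|apply hol_id].
      + intros z Hz'. rewrite (cder_C_derive _ _ _ (cder_Lam z Hz')). unfold d, dLam.
        replace (RtoC 2) with (1 + 1)%C by (unfold Cplus, RtoC; simpl; f_equal; ring).
        field. split; [now apply disk_1_plus|now apply disk_1_minus]. }
  assert (E1 := E 1%nat). assert (E2 := E 2%nat). assert (E3 := E 3%nat). assert (E4 := E 4%nat).
  cbn [conv] in E1, E2, E3, E4.
  rewrite (Cd O), (Cd 1%nat) in E1. rewrite (Cd O), (Cd 1%nat), (Cd 2%nat) in E2.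
  rewrite (Cd O), (Cd 1%nat), (Cd 2%nat), (Cd 3%nat) in E3.
  rewrite (Cd O), (Cd 1%nat), (Cd 2%nat), (Cd 3%nat), (Cd 4%nat) in E4.
  replace (INR 0) with 0 in * by reflexivity.
  replace (INR 1) with 1 in * by reflexivity.
  replace (INR 2) with 2 in * by (simpl; ring).
  replace (INR 3) with 3 in * by (simpl; ring).
  replace (INR 4) with 4 in * by (simpl; ring).
  assert (L1 : coef 1 Lam = RtoC 2) by (rewrite <- E1; ring).
  assert (L2 : coef 2 Lam = RtoC (0 / 2)) by (apply Csolve; [lra|]; rewrite <- E2; ring).
  assert (L3 : coef 3 Lam = RtoC (2 / 3)).
  { apply Csolve; [lra|]. rewrite L1 in E3.
    transitivity (RtoC 0 + RtoC 2)%C; [rewrite <- E3; ring|ring]. }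
  replace (0 / 2) with 0 in L2 by field.
  assert (L4 : coef 4 Lam = RtoC (0 / 4)).
  { apply Csolve; [lra|]. rewrite L2 in E4. rewrite <- E4. ring. }
  replace (0 / 4) with 0 in L4 by field.
  repeat split; assumption.
Qed.


(** Here p = z f' / f and om = (P - 1) / (P + 1) with P = p^(1/a). From z P'/P = (z p'/p) / a and 1
    - om^2 = 4 P / (P + 1)^2 the fractional power drops out: both equations are polynomial in p and
    om, and coefficients can be compared. *)
Lemma strongly_starlike_schur (a : R) (f : C -> C) : 0 < a < 1 ->
  strongly_starlike a f -> (forall z, Cmod z < 1 -> C_derive f z <> 0) ->
  exists p om, hol p /\ hol om /\ p (RtoC 0) = 1 /\ om (RtoC 0) = 0 /\
    (forall z, Cmod z < 1 -> Cmod (om z) <= 1) /\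
    (forall z, Cmod z < 1 -> z * C_derive p z = p z * (phi f z - p z))%C /\
    (forall z, Cmod z < 1 ->
       RtoC (2 * a) * (z * C_derive om z) = (phi f z - p z) * (1 - om z * om z))%C.
Proof.
  intros Ha [[Hf [Hf0 Hf1]] Hs] N. assert (HPI := PI_RGT_0).
  assert (Hh := proj1 (holomorphic_on_disk_hol f) Hf).
  set (q := rec_quotient f).
  assert (Hq : hol q) by exact (hol_rec_quotient f Hh N).
  assert (Hode := rec_quotient_ode f Hh Hf0 N). fold q in Hode.
  assert (Hq0 : q (RtoC 0) = 1).
  { unfold q, rec_quotient. rewrite divz_0, Hf1. field. }
  set (c := cos (PI * a / 2)). assert (Hc := cos_half_PI_mult a Ha). fold c in Hc.
  assert (Nd : forall z, Cmod z < 1 -> divz f z <> 0).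
  { intros z Hz E. destruct (Ceq_dec z 0) as [->|Nz].
    - rewrite divz_0, Hf1 in E. apply RtoC_inj in E. lra.
    - apply (proj1 (Hs z Hz) Nz). rewrite (divz_spec f z), Hf0, E. ring. }
  assert (Nq : forall z, Cmod z < 1 -> q z <> 0).
  { intros z Hz. unfold q, rec_quotient. apply Cmod_gt_0.
    rewrite Cmod_div by exact (N z Hz).
    apply Rdiv_lt_0_compat; apply Cmod_gt_0; [exact (Nd z Hz)|exact (N z Hz)]. }
  assert (Hsec : forall z, Cmod z < 1 -> sector c (q z)).
  { intros z Hz. destruct (Hs z Hz) as [_ [Ns Hb]].
    rewrite (starlike_quotient_rec f z Hf0 Hf1 (Nd z Hz) (N z Hz)) in Ns, Hb. fold q in Ns, Hb.
    apply (Carg_sector (PI * a / 2)) in Hb; [|nra|exact Ns].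
    replace (q z) with (/ / q z)%C.
    - exact (sector_inv c (/ q z) Ns Hb).
    - field. exact (Nq z Hz). }
  set (p := fun z => (1 / q z)%C). set (om := fun z => cayley_root a (q z)).
  exists p, om.
  assert (Dp : forall z, Cmod z < 1 -> cder p z ((0 * q z - 1 * C_derive q z) / (q z * q z))).
  { intros z Hz. apply (cder_div (fun _ => RtoC 1) q); [exact (Nq z Hz)|apply cder_const|].
    exact (hol_cder q z Hq Hz). }
  split; [intros z Hz; eexists; exact (Dp z Hz)|].
  split; [exact (hol_cayley_root a q Ha Hq Hsec)|].
  split; [unfold p; rewrite Hq0; field|].
  split; [unfold om, cayley_root; rewrite Hq0, invroot_1; unfold Cdiv; ring|].
  split; [intros z Hz; exact (Rlt_le _ _ (Cmod_cayley_root a (q z) Ha (Hsec z Hz)))|].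
  split.
  - intros z Hz. rewrite (cder_C_derive _ _ _ (Dp z Hz)). unfold p.
    assert (Eo : (z * C_derive q z)%C = (1 - q z * phi f z)%C).
    { rewrite <- (Hode z Hz). ring. }
    transitivity (- (z * C_derive q z) / (q z * q z))%C; [field; exact (Nq z Hz)|].
    rewrite Eo. field. exact (Nq z Hz).
  - intros z Hz.
    destruct (cder_cayley_root_comp a q z _ Ha (Hsec z Hz) (hol_cder q z Hq Hz))
      as [P' [_ [EP Dom]]].
    change (cder om z ((P' + P') / ((invroot a (q z) + 1) * (invroot a (q z) + 1)))) in Dom.
    rewrite (cder_C_derive _ _ _ Dom), EP. unfold p, om, cayley_root.
    assert (NP : (invroot a (q z) + 1)%C <> 0).
    { apply Re_pos_plus_1. exact (invroot_Re_pos a (q z) Ha (Hsec z Hz)). }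
    set (P := invroot a (q z)) in *.
    assert (Eo : (z * C_derive q z)%C = (1 - q z * phi f z)%C).
    { rewrite <- (Hode z Hz). ring. }
    assert (Ea : (RtoC (2 * a) * RtoC (- / a))%C = (- (1 + 1))%C).
    { unfold Cplus, Copp, Cmult, RtoC; simpl. f_equal; [field; lra|ring]. }
    transitivity ((RtoC (2 * a) * RtoC (- / a)) * (z * C_derive q z) * ((1 + 1) * P)
      / (q z * ((P + 1) * (P + 1))))%C.
    + field. split; [exact NP|exact (Nq z Hz)].
    + rewrite Ea, Eo. field. split; [exact NP|exact (Nq z Hz)].
Qed.

(** * The extremal function *)

(** This is log f' of the extremal function: z f''/f' = c Lam prescribes its derivative c Lam(z) /
    z. *)
Definition ext_log (c : C) : C -> C := prim (fun z => (c * divz Lam z)%C).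

Definition ext_fun (c : C) : C -> C := prim (fun z => cexp (ext_log c z)).

Lemma hol_c_divz_Lam (c : C) : hol (fun z => c * divz Lam z)%C.
Proof. apply hol_mult; [apply hol_const|apply hol_divz, hol_Lam]. Qed.

Lemma cder_ext_log (c z : C) : Cmod z < 1 -> cder (ext_log c) z (c * divz Lam z).
Proof. exact (cder_prim _ z (hol_c_divz_Lam c)). Qed.

Lemma cder_exp_ext_log (c z : C) : Cmod z < 1 ->
  cder (fun z => cexp (ext_log c z)) z (cexp (ext_log c z) * (c * divz Lam z)).
Proof.
  intros Hz. apply (cder_comp cexp (ext_log c)); [apply cder_cexp|exact (cder_ext_log c z Hz)].
Qed.

Lemma hol_exp_ext_log (c : C) : hol (fun z => cexp (ext_log c z)).
Proof. intros z Hz. eexists. exact (cder_exp_ext_log c z Hz). Qed.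

Lemma cder_ext_fun (c z : C) : Cmod z < 1 -> cder (ext_fun c) z (cexp (ext_log c z)).
Proof. exact (cder_prim _ z (hol_exp_ext_log c)). Qed.

Lemma C_derive_ext_fun (c z : C) : Cmod z < 1 ->
  C_derive (ext_fun c) z = cexp (ext_log c z).
Proof. intros Hz. exact (cder_C_derive _ _ _ (cder_ext_fun c z Hz)). Qed.

Lemma ext_fun_classA1 (c : C) : classA1 (ext_fun c).
Proof.
  split; [|split].
  - apply holomorphic_on_disk_hol. intros z Hz. eexists. exact (cder_ext_fun c z Hz).
  - exact (prim_0 _).
  - rewrite (C_derive_ext_fun c 0 Cmod_0_lt_1).
    replace (ext_log c 0) with (RtoC 0) by (symmetry; exact (prim_0 _)). exact cexp_0.
Qed.

Lemma phi_ext_fun (c z : C) : Cmod z < 1 -> phi (ext_fun c) z = (1 + c * Lam z)%C.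
Proof.
  intros Hz. unfold phi.
  assert (E2 : C_derive (C_derive (ext_fun c)) z = (cexp (ext_log c z) * (c * divz Lam z))%C).
  { rewrite (C_derive_ext_disk (fun z => cexp (ext_log c z)) _ z (hol_exp_ext_log c)).
    - exact (cder_C_derive _ _ _ (cder_exp_ext_log c z Hz)).
    - intros w Hw. symmetry. exact (C_derive_ext_fun c w Hw).
    - exact Hz. }
  rewrite E2, (C_derive_ext_fun c z Hz).
  assert (El := divz_spec Lam z). rewrite Lam_0 in El. rewrite El.
  field. apply cexp_neq_0.
Qed.

Lemma ext_fun_phi_strip (r : R) : 0 < r ->
  phi_maps_into (ext_fun (RtoC r)) (strip (r * (PI / 2))).
Proof.
  intros Hr z Hz. split.
  - rewrite (C_derive_ext_fun _ z Hz). apply cexp_neq_0.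
  - unfold strip. rewrite (phi_ext_fun _ z Hz).
    replace (Im (1 + RtoC r * Lam z)) with (r * Im (Lam z)).
    + rewrite Rabs_mult, (Rabs_right r) by lra.
      apply Rmult_lt_compat_l; [exact Hr|]. exact (Im_Lam_bound z Hz).
    + destruct (Lam z) as [x y]. simpl. ring.
Qed.

Lemma ext_fun_coef_bound (a b : R) : 0 < a < 1 -> 0 < b < 1 ->
  strongly_starlike a (ext_fun (RtoC (2 * a * b))) ->
  let w2 := - a * b ^ 2 / 3 in
  let w3 := b / 6 - b ^ 3 / 3 in
  let w4 := a * b ^ 4 / 3 - a * b ^ 2 / 15 + 2 / 45 * a ^ 3 * b ^ 4 in
  let a0 := w2 / (1 - b * b) in
  let a1 := (w3 + b * w2 * a0) / (1 - b * b) in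
  let a2 := (w4 + b * w2 * a1 + b * w3 * a0) / (1 - b * b) in
  Rabs a0 < 1 -> Rabs a2 <= 1 - a0 * a0.
Proof.
  intros Ha Hb Hs w2 w3 w4 a0 a1 a2 Ha0.
  set (c := RtoC (2 * a * b)) in *.
  destruct (strongly_starlike_schur a (ext_fun c) Ha Hs) as
    [p [om [Hp [Hom [Hp0 [Hom0 [Homb [E1 E2]]]]]]]].
  { intros z Hz. rewrite (C_derive_ext_fun _ z Hz). apply cexp_neq_0. }
  set (F := fun z => (1 + c * Lam z)%C).
  assert (HcL : hol (fun z => c * Lam z)%C) by exact (hol_mult _ _ (hol_const c) hol_Lam).
  assert (HF : hol F) by exact (hol_plus _ _ (hol_const 1) HcL).
  set (u := fun z => (F z - p z)%C). assert (Hu : hol u) by exact (hol_minus _ _ HF Hp).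
  assert (Hoo : hol (fun z => om z * om z)%C) by exact (hol_mult _ _ Hom Hom).
  set (v := fun z => (1 - om z * om z)%C).
  assert (Hv : hol v) by exact (hol_minus _ _ (hol_const 1) Hoo).
  assert (Hzp : hol (fun z => z * C_derive p z)%C)
    by exact (hol_mult _ _ hol_id (hol_C_derive p Hp)).
  assert (Hzo : hol (fun z => z * C_derive om z)%C)
    by exact (hol_mult _ _ hol_id (hol_C_derive om Hom)).
  destruct Lam_coef as [L1 [L2 [L3 L4]]].
  assert (CF : forall n, coef n F = (match n with O => RtoC 1 | _ => RtoC 0 end + c * coef n Lam)%C).
  { intros n. unfold F. rewrite (coef_plus n _ _ (hol_const 1) HcL), coef_const,
      (coef_scal n c _ hol_Lam). reflexivity. }
  assert (R1 : forall n, (RtoC (INR n) * coef n p)%C = conv n (fun k => coef k p) (fun k => coef k u)).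
  { intros n. rewrite <- (coef_mult n p u Hp Hu), <- (coef_zderiv n p Hp).
    apply coef_ext; [exact Hzp|]. intros z Hz. unfold u, F.
    rewrite <- (phi_ext_fun c z Hz). exact (E1 z Hz). }
  assert (R2 : forall n, (RtoC (2 * a) * (RtoC (INR n) * coef n om))%C =
     conv n (fun k => coef k u) (fun k => coef k v)).
  { intros n. rewrite <- (coef_mult n u v Hu Hv), <- (coef_zderiv n om Hom),
      <- (coef_scal n _ _ Hzo).
    apply coef_ext; [exact (hol_mult _ _ (hol_const _) Hzo)|]. intros z Hz. unfold u, v, F.
    rewrite <- (phi_ext_fun c z Hz). exact (E2 z Hz). }
  assert (CU : forall n, coef n u = (coef n F - coef n p)%C)
    by (intros n; exact (coef_minus n F p HF Hp)).
  assert (CV : forall n, coef n v = (match n with O => RtoC 1 | _ => RtoC 0 end -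
      conv n (fun k => coef k om) (fun k => coef k om))%C).
  { intros n. unfold v. rewrite (coef_minus n _ _ (hol_const 1) Hoo), coef_const,
      (coef_mult n om om Hom Hom). reflexivity. }
  assert (F0 : coef 0 F = RtoC 1).
  { rewrite (CF O). change (coef 0 Lam) with (Lam 0). rewrite Lam_0. ring. }
  assert (F1 : coef 1 F = RtoC (2 * (2 * a * b))) by (rewrite (CF 1%nat), L1; unfold c; RtoC_solve).
  assert (F2 : coef 2 F = RtoC 0) by (rewrite (CF 2%nat), L2; ring).
  assert (F3 : coef 3 F = RtoC (2 * (2 * a * b) / 3))
    by (rewrite (CF 3%nat), L3; unfold c; RtoC_solve).
  assert (F4 : coef 4 F = RtoC 0) by (rewrite (CF 4%nat), L4; ring).
  destruct (coef_recurrence a b (fun k => coef k F) (fun k => coef k p) (fun k => coef k u)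
    (fun k => coef k v) (fun k => coef k om) ltac:(lra) F0 F1 F2 F3 F4 Hp0 CU R1 Hom0 CV R2)
    as [W1 [W2 [W3 W4]]].
  refine (schwarz_coef_bound om b w2 w3 w4 Hom Homb Hom0 W1 W2 W3 W4 _ Ha0).
  rewrite Rabs_right; lra.
Qed.


(** * The explicit bounds *)

Lemma derivable_pt_lim_sin_half_PI (x : R) :
  derivable_pt_lim (fun x => sin (PI * x / 2)) x (PI / 2 * cos (PI * x / 2)).
Proof.
  apply is_derive_Reals. auto_derive; [exact I|]. unfold Rdiv. ring.
Qed.

(* By the mean value theorem the slopes of the chords over [0, a] and [a, 1]
   are values of a strictly decreasing derivative. *)
Lemma sin_half_PI_gt (a : R) : 0 < a < 1 -> a < sin (PI * a / 2) < 1.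
Proof.
  intros Ha. assert (HPI := PI_RGT_0).
  assert (Upper : sin (PI * a / 2) < 1).
  { rewrite <- sin_PI2. apply sin_increasing_1; nra. }
  split; [|exact Upper].
  apply Rnot_le_lt. intros L.
  set (f := fun x => sin (PI * x / 2)).
  set (f' := fun x => PI / 2 * cos (PI * x / 2)).
  assert (D : forall x, derivable_pt_lim f x (f' x)) by exact derivable_pt_lim_sin_half_PI.
  destruct (MVT_cor2 f f' 0 a (proj1 Ha) (fun x _ => D x)) as [c1 [E1 B1]].
  destruct (MVT_cor2 f f' a 1 (proj2 Ha) (fun x _ => D x)) as [c2 [E2 B2]].
  assert (F0 : f 0 = 0) by (unfold f; replace (PI * 0 / 2) with 0 by field; apply sin_0).
  assert (F1 : f 1 = 1) by (unfold f; replace (PI * 1 / 2) with (PI / 2) by field; apply sin_PI2).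
  rewrite F0 in E1. rewrite F1 in E2. change (f a <= a) in L.
  assert (S1 : f' c1 <= 1) by (apply Rmult_le_reg_r with a; lra).
  assert (S2 : 1 <= f' c2) by (apply Rmult_le_reg_r with (1 - a); lra).
  assert (S3 : f' c2 < f' c1).
  { unfold f'. apply Rmult_lt_compat_l; [lra|]. apply cos_decreasing_1; nra. }
  lra.
Qed.

Lemma sqrt3_bound (a s : R) : 0 < a < 1 -> a < s ->
  sqrt 3 * a < (a + (1 + a) * s) / sqrt (1 + 2 * s).
Proof.
  intros Ha Hs. assert (D : 0 < sqrt (1 + 2 * s)) by (apply sqrt_lt_R0; lra).
  apply Rmult_lt_reg_r with (1 := D).
  replace ((a + (1 + a) * s) / sqrt (1 + 2 * s) * sqrt (1 + 2 * s)) with (a + (1 + a) * s)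
    by (field; lra).
  assert (D2 := sqrt_sqrt (1 + 2 * s) ltac:(lra)). assert (T2 := sqrt_sqrt 3 ltac:(lra)).
  apply Rsqr_incrst_0; [|apply Rmult_le_pos; [apply Rmult_le_pos; [apply sqrt_pos|lra]|lra]|nra].
  unfold Rsqr.
  replace (sqrt 3 * a * sqrt (1 + 2 * s) * (sqrt 3 * a * sqrt (1 + 2 * s))) with
    ((sqrt 3 * sqrt 3) * (a * a) * (sqrt (1 + 2 * s) * sqrt (1 + 2 * s))) by ring.
  rewrite D2, T2.
  (* With s = a + r the difference of the squares is a^2 (1-a)^2 + a r (4 + 2 a^2) + (1+a)^2 r^2, a
     sum of positive terms. *)
  replace s with (a + (s - a)) by ring. set (r := s - a). assert (Hr : 0 < r) by (unfold r; lra).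
  assert (P1 : 0 < a * a * ((1 - a) * (1 - a))) by (repeat apply Rmult_lt_0_compat; lra).
  assert (P2 : 0 < a * r * (4 + 2 * (a * a))) by (repeat apply Rmult_lt_0_compat; nra).
  assert (P3 : 0 < (1 + a) * (1 + a) * (r * r)) by (repeat apply Rmult_lt_0_compat; lra).
  nra.
Qed.

(** Combine u^a >= 1 + a ln u with ln u >= 1 - 1/u. The bound touches u^a at u = 1 and is linear in
    1/u, so it keeps the height rational. *)
Lemma Rpower_tangent (a u : R) : 0 < a -> 0 < u -> 1 + a - a / u <= Rpower u a.
Proof.
  intros Ha Hu. unfold Rpower.
  assert (E1 := exp_ineq1_le (a * ln u)). assert (E2 := exp_ineq1_le (- ln u)).
  rewrite exp_Ropp, exp_ln in E2 by exact Hu. unfold Rdiv. nra.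
Qed.

Lemma height_stationary_point (a s : R) : 0 < a < 1 -> 0 < s < 1 ->
  exists y, 0 < y /\ y * sqrt (1 + 2 * s) < 1 /\ 2 * s * (y * Rpower y a) = 1 - y * y.
Proof.
  intros Ha Hs. set (D := sqrt (1 + 2 * s)).
  assert (D2 : D * D = 1 + 2 * s) by (apply sqrt_sqrt; lra).
  assert (D1 : 1 < D) by (assert (0 <= D) by apply sqrt_pos; nra).
  assert (D3 : D < 4) by nra.
  set (X := / D). assert (XD : X * D = 1) by (apply Rinv_l; lra).
  assert (HX : / 4 < X < 1).
  { split; [apply Rinv_lt_contravar; nra|]. rewrite <- Rinv_1. apply Rinv_lt_contravar; lra. }
  (* h has the sign of the derivative of the height. It is negative at 1/4, and positive at X = 1/D
     because X^a > X and X^2 (1 + 2 s) = 1. *)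
  set (h := fun y => 2 * s * (y * Rpower y a) + y * y - 1).
  assert (Hc : forall y, / 4 <= y <= X -> continuity_pt h y).
  { intros y Hy. unfold h. apply continuity_pt_minus; [apply continuity_pt_plus|].
    - apply continuity_pt_mult; [apply continuity_pt_const; intros ? ?; reflexivity|].
      apply continuity_pt_mult; [apply derivable_continuous_pt, derivable_pt_id|].
      apply derivable_continuous_pt. eexists. apply derivable_pt_lim_power. lra.
    - apply continuity_pt_mult; apply derivable_continuous_pt, derivable_pt_id.
    - apply continuity_pt_const; intros ? ?; reflexivity. }
  assert (Pow : forall y, 0 < y < 1 -> y < Rpower y a < 1).
  { intros y Hy. assert (ln y < 0) by (rewrite <- ln_1; apply ln_increasing; lra).
    unfold Rpower. split.
    - rewrite <- (exp_ln y) at 1 by lra. apply exp_increasing. nra.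
    - rewrite <- exp_0. apply exp_increasing. nra. }
  assert (HX2 : X * X * (1 + 2 * s) = 1).
  { rewrite <- D2. replace (X * X * (D * D)) with ((X * D) * (X * D)) by ring. rewrite XD. ring. }
  destruct (Ranalysis5.IVT_interv h (/ 4) X Hc) as [y [Hy Ey]].
  - lra.
  - unfold h. assert (P := Pow (/ 4) ltac:(lra)). nra.
  - unfold h. assert (P := Pow X ltac:(lra)).
    assert (0 < s * (X * (Rpower X a - X))) by (repeat apply Rmult_lt_0_compat; lra). nra.
  - exists y. split; [lra|]. unfold h in Ey. split; [|lra].
    apply Rmult_lt_reg_l with X; [lra|]. replace (X * (y * D)) with (y * (X * D)) by ring.
    (* The intermediate value theorem only gives y <= X; equality is excluded since h is positive at
       X. *)
    rewrite XD. destruct (proj2 Hy) as [L|E]; [lra|exfalso].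
    rewrite E in Ey. assert (P := Pow X ltac:(lra)).
    assert (0 < s * (X * (Rpower X a - X))) by (repeat apply Rmult_lt_0_compat; lra). nra.
Qed.

(** Write X^a = y^a (X/y)^a with y the stationary point and replace the second factor by its tangent
    bound. What results exceeds the value at y by exactly a (X - y)^2 / (2 X), so y is a global
    minimum. *)
Lemma boundary_height_lower (a : R) : 0 < a < 1 ->
  let s := sin (PI * a / 2) in
  exists g, (a + (1 + a) * s) / sqrt (1 + 2 * s) < g /\
    forall X, 0 < X -> g <= boundary_height a X.
Proof.
  intros Ha s. assert (Hs := sin_half_PI_gt a Ha). fold s in Hs.
  destruct (height_stationary_point a s Ha ltac:(lra)) as [y [Hy [HyD Ey]]].
  set (D := sqrt (1 + 2 * s)) in *.
  assert (D2 : D * D = 1 + 2 * s) by (apply sqrt_sqrt; lra).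
  assert (D1 : 0 < D) by (apply sqrt_lt_R0; lra).
  exists (((1 + a) / y - (1 - a) * y) / 2). split.
  - apply Rle_lt_trans with (((1 + a) * D - (1 - a) * / D) / 2).
    + apply Req_le. replace s with ((D * D - 1) / 2) by lra. field. lra.
    + assert (I1 : D < / y).
      { apply Rmult_lt_reg_l with y; [exact Hy|]. rewrite Rinv_r; lra. }
      assert (I2 : y < / D).
      { apply Rmult_lt_reg_r with D; [exact D1|]. rewrite Rinv_l; lra. }
      unfold Rdiv. nra.
  - intros X HX. unfold boundary_height. fold s.
    assert (Hu : 0 < X / y) by (now apply Rdiv_lt_0_compat).
    assert (T := Rpower_tangent a (X / y) (proj1 Ha) Hu).
    assert (Kp : 0 < Rpower y a) by apply exp_pos.
    assert (EX : Rpower X a = Rpower y a * Rpower (X / y) a).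
    { rewrite Rpower_mult_distr by assumption. f_equal. field. lra. }
    rewrite EX.
    apply Rle_trans with (s * Rpower y a * (1 + a - a / (X / y)) + a * (X + / X) / 2).
    + assert (Es : s * Rpower y a = (1 - y * y) / (2 * y)) by (rewrite <- Ey; field; lra).
      rewrite Es.
      assert (Sq : 0 <= a * ((X - y) * (X - y)) / (2 * X)).
      { apply Rdiv_le_0_compat; [|lra]. apply Rmult_le_pos; [lra|apply Rle_0_sqr]. }
      replace ((1 - y * y) / (2 * y) * (1 + a - a / (X / y)) + a * (X + / X) / 2) with
        (((1 + a) / y - (1 - a) * y) / 2 + a * ((X - y) * (X - y)) / (2 * X)) by (field; lra).
      lra.
    + assert (0 < s * Rpower y a) by (apply Rmult_lt_0_compat; lra). nra.
Qed.

(* In terms of t = b^2, the case t = 3 / (3 + a) gives a0 = -1 and a2 > 0. *)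
Lemma coef_bound_violated (a : R) : 0 < a < 1 ->
  exists b, 0 < b /\ b < sqrt 3 / sqrt (3 + a) /\ b < 1 /\
    let w2 := - a * b ^ 2 / 3 in
    let w3 := b / 6 - b ^ 3 / 3 in
    let w4 := a * b ^ 4 / 3 - a * b ^ 2 / 15 + 2 / 45 * a ^ 3 * b ^ 4 in
    let a0 := w2 / (1 - b * b) in
    let a1 := (w3 + b * w2 * a0) / (1 - b * b) in
    let a2 := (w4 + b * w2 * a1 + b * w3 * a0) / (1 - b * b) in
    Rabs a0 < 1 /\ 1 - a0 * a0 < Rabs a2.
Proof.
  intros Ha. set (B := sqrt 3 / sqrt (3 + a)).
  assert (S3 := sqrt_sqrt 3 ltac:(lra)). assert (Sa := sqrt_sqrt (3 + a) ltac:(lra)).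
  assert (P3 : 0 < sqrt 3) by (apply sqrt_lt_R0; lra).
  assert (Pa : 0 < sqrt (3 + a)) by (apply sqrt_lt_R0; lra).
  assert (HB : 0 < B) by (now apply Rdiv_lt_0_compat).
  assert (B2 : B * B = 3 / (3 + a)).
  { unfold B. replace (sqrt 3 / sqrt (3 + a) * (sqrt 3 / sqrt (3 + a))) with
      ((sqrt 3 * sqrt 3) / (sqrt (3 + a) * sqrt (3 + a))) by (field; lra). now rewrite S3, Sa. }
  assert (B3 : B * B * (3 + a) = 3) by (rewrite B2; field; lra).
  clearbody B.
  assert (B1 : B < 1).
  { apply Rnot_le_lt. intros L. assert (1 <= B * B) by nra. nra. }
  set (A0 := fun t => - a * t / 3 / (1 - t)).
  (* a1 is odd in b; [A1] stands for b a1, which is a function of t. *)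
  set (A1 := fun t => (t / 6 - t * t / 3 + t * (- a * t / 3) * A0 t) / (1 - t)).
  set (A2 := fun t => (a * t * t / 3 - a * t / 15 + 2 / 45 * a ^ 3 * (t * t) + (- a * t / 3) * A1 t
      + (t / 6 - t * t / 3) * A0 t) / (1 - t)).
  set (G := fun b => A2 (b * b) - (1 - A0 (b * b) * A0 (b * b))).
  assert (GB : 0 < G B).
  { unfold G, A2, A1, A0. rewrite B2.
    (* At t = 3 / (3 + a) one has A0 = -1, so G B is just the value of A2; the negative terms of the
       numerator sum to less than 9/15. *)
    match goal with |- 0 < ?e => replace e with
      ((1 - 8 * a / 15 - a * a / 15 + 2 * a ^ 3 / 15) * 3 / ((3 + a) * a)) end.
    - apply Rdiv_lt_0_compat; [|nra]. assert (0 < a ^ 3) by (apply pow_lt; lra). nra.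
    - field. lra. }
  assert (CG : continuous G B).
  { apply (ex_derive_continuous (V := R_NormedModule)). unfold G, A2, A1, A0. auto_derive.
    repeat split; nra. }
  destruct (CG (fun y => 0 < y)) as [d Hd].
  { exists (mkposreal _ GB). intros y Hy. change (Rabs (y - G B) < G B) in Hy.
    apply Rabs_def2 in Hy. lra. }
  set (e := Rmin (B / 2) (d / 2)).
  assert (He1 : e <= B / 2) by apply Rmin_l. assert (He2 : e <= d / 2) by apply Rmin_r.
  assert (He : 0 < e) by (apply Rmin_pos; [lra|]; assert (K := cond_pos d); lra).
  set (b := B - e). assert (Hb0 : 0 < b) by (unfold b; lra).
  assert (HbB : b < B) by (unfold b; lra).
  assert (Gb : 0 < G b).
  { apply Hd. change (Rabs (b - B) < d). unfold b. rewrite Rabs_left; lra. }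
  clearbody b. exists b. split; [exact Hb0|]. split; [exact HbB|]. split; [lra|].
  assert (Hbb : b * b * (3 + a) < 3) by nra.
  assert (Hb1 : 0 < 1 - b * b) by nra.
  assert (Pab : 0 < a * (b * b)) by (repeat apply Rmult_lt_0_compat; lra).
  intros w2 w3 w4 a0 a1 a2.
  assert (E0 : a0 = A0 (b * b)) by (unfold a0, w2, A0; field; lra).
  assert (E2 : a2 = A2 (b * b)).
  { unfold a2, a1, w4, w3, a0, w2, A2, A1, A0. field. lra. }
  split.
  - rewrite E0. unfold A0. apply Rabs_def1.
    + apply Rlt_trans with 0; [|lra]. apply Rmult_lt_reg_r with (1 := Hb1).
      replace (- a * (b * b) / 3 / (1 - b * b) * (1 - b * b)) with (- a * (b * b) / 3) by (field; lra).
      lra.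
    + apply Rmult_lt_reg_r with (1 := Hb1).
      replace (- a * (b * b) / 3 / (1 - b * b) * (1 - b * b)) with (- a * (b * b) / 3) by (field; lra).
      nra.
  - eapply Rlt_le_trans; [|apply Rle_abs]. rewrite E0, E2. unfold G in Gb. lra.
Qed.

Theorem theorem1p2 (alpha : R) (alpha_gt0 : 0 < alpha) (alpha_lt1 : alpha < 1) :
  sqrt 3 * alpha <
    (alpha + (1 + alpha) * sin (PI * alpha / 2)) /
      sqrt (1 + 2 * sin (PI * alpha / 2)) /\
  Rbar_lt
    (Finite ((alpha + (1 + alpha) * sin (PI * alpha / 2)) /
               sqrt (1 + 2 * sin (PI * alpha / 2))))
    (gamma (strongly_starlike alpha)) /\
  Rbar_lt
    (gamma (strongly_starlike alpha))
    (Finite (sqrt 3 * PI * alpha / sqrt (3 + alpha))).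
Proof.
  assert (Ha : 0 < alpha < 1) by lra. assert (HPI := PI_RGT_0).
  assert (Hs := sin_half_PI_gt alpha Ha).
  assert (S3 := sqrt3_bound alpha _ Ha (proj1 Hs)).
  destruct (Lub_Rbar_correct (fun g : R => 0 <= g /\
    forall f, classA1 f -> phi_maps_into f (strip g) -> strongly_starlike alpha f)) as [Hub Hlub].
  split; [exact S3|]. split.
  - destruct (boundary_height_lower alpha Ha) as [g [Hg Hh]].
    apply Rbar_lt_le_trans with (Finite g); [exact Hg|].
    apply Hub. split.
    (* The supremum ranges over nonnegative g; here g exceeds sqrt 3 * alpha. *)
    + assert (0 < sqrt 3) by (apply sqrt_lt_R0; lra). nra.
    + intros f. exact (strongly_starlike_of_strip alpha g f Ha Hh).
  - destruct (coef_bound_violated alpha Ha) as [b [Hb0 [HbB [Hb1 [A0 A2]]]]].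
    assert (Nb : ~ strongly_starlike alpha (ext_fun (RtoC (2 * alpha * b)))).
    { intros H. assert (K := ext_fun_coef_bound alpha b Ha (conj Hb0 Hb1) H A0).
      cbv zeta in A2. lra. }
    apply Rbar_le_lt_trans with (Finite (PI * alpha * b)).
    (* An admissible g above pi alpha b would give a strip containing the image of phi for the
       extremal function, which is not strongly starlike for this b. *)
    + apply Hlub. intros g [_ Hg]. apply Rnot_lt_le. intros L. apply Nb, Hg.
      * apply ext_fun_classA1.
      * assert (Hc : 0 < 2 * alpha * b) by (apply Rmult_lt_0_compat; lra).
        intros z Hz. destruct (ext_fun_phi_strip _ Hc z Hz) as [N S].
        split; [exact N|]. unfold strip in *.
        replace (2 * alpha * b * (PI / 2)) with (PI * alpha * b) in S by field.
        exact (Rlt_trans _ _ _ S L).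
    + change (PI * alpha * b < sqrt 3 * PI * alpha / sqrt (3 + alpha)).
      replace (sqrt 3 * PI * alpha / sqrt (3 + alpha)) with
        (PI * alpha * (sqrt 3 / sqrt (3 + alpha))) by (unfold Rdiv; ring).
      apply Rmult_lt_compat_l; [|exact HbB]. apply Rmult_lt_0_compat; lra.
Qed.
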